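(* Let $p_0(y),\dots,p_{l+n}(y)$ be degree $1$ real polynomials on $\mathbb{R}^l$ and let $\beta_{i,j}$ ($0\le i\le l+n$, $1\le j\le l$) be real numbers. Suppose that the polyhedron $\Delta=\{y\in\mathbb{R}^l\mid p_i(y)>0,\ i=0,\dots,l+n\}$ is bounded, that the $p_i$ are general in that no $l+1$ of them have a common zero, and that the exponents $\beta_{i,j}$ are sufficiently general. Then the Khovanskii-Rolle Continuation Algorithm (described in the context) finds all solutions in $\Delta$ to the system $$\prod_{i=0}^{l+n}p_i(y)^{\beta_{i,j}}=1,\qquad j=1,\dots,l.$$ It accomplishes this by solving auxiliary polynomial systems of the form $$p_{i_1}=\dots=p_{i_j}=J_{j+1}=\dots=J_l=0$$ (where $J_1,\dots,J_l$ are the polynomials defined in the context) and following implicit curves. For each $j=0,\dots,l-1$, it will solve at most $\binom{l+n+1}{j}$ polynomial systems in $l-j$ variables, each having Bézout number $2^{\binom{l-j}{2}}n^{l-j}$. In all, it will trace at most $$l\,2^{\binom{l}{2}+1}n^l+\sum_{j=1}^{l}(l+1-j)\,2^{\binom{l-j}{2}}n^{l-j}\binom{l+n+1}{j}\;<\;l\,\frac{e^2+3}{2}\,2^{\binom{l}{2}}n^l$$ implicit curves in $\Delta$.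
   Context: Functions. On $\Delta$ put $\psi_j(y)=\prod_{i=0}^{l+n}p_i(y)^{\beta_{i,j}}$ and $\varphi_j(y)=\log\psi_j(y)=\sum_{i=0}^{l+n}\beta_{i,j}\log p_i(y)$ for $j=1,\dots,l$. Write $\psi_j=\psi_j^+/\psi_j^-$, where $\psi_j^+$ is the product of the factors $p_i^{\beta_{i,j}}$ with $\beta_{i,j}>0$ and $\psi_j^-$ is the product of the factors $p_i^{-\beta_{i,j}}$ with $\beta_{i,j}<0$, and set $f_j=\psi_j^+-\psi_j^-$; on $\Delta$ the equations $\psi_j=1$, $\varphi_j=0$ and $f_j=0$ are equivalent. For $j=l,l-1,\dots,1$ define recursively the Jacobian determinant (of $l$ functions in $l$ variables) $$\widetilde J_j=\text{J-det}(\varphi_1,\dots,\varphi_j,\widetilde J_{j+1},\dots,\widetilde J_l),$$ and put $J_j=\widetilde J_j\cdot\prod_{i=0}^{l+n}p_i(y)^{2^{l-j}}$, which is a polynomial of degree $2^{l-j}n$. The number of variables and the Bézout number (product of the degrees) of an auxiliary system are counted after using $p_{i_1}=\dots=p_{i_j}=0$ to eliminate $j$ variables. Sets. For $j=0,\dots,l$, $S_j$ is the set of solutions in $\Delta$ of $\varphi_1=\dots=\varphi_j=\widetilde J_{j+1}=\dots=\widetilde J_l=0$. For $j=1,\dots,l$, $C_j$ is the curve in $\Delta$ defined by $\varphi_1=\dots=\varphi_{j-1}=\widetilde J_{j+1}=\dots=\widetilde J_l=0$, and $T_j$ is the set of solutions in the boundary of $\Delta$ of $f_1=\dots=f_{j-1}=0$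 and $\widetilde J_{j+1}=\dots=\widetilde J_l=0$, where on the boundary the $\widetilde J_k$ are replaced by the polynomials $J_k$. Generality of the exponents. ''Sufficiently general'' $\beta_{i,j}$ is meant in the sense of generic; in particular the hypotheses of the continuation step below are to hold for each $j=1,\dots,l$: $C_j$ is a smooth curve in $\Delta$, and $\varphi_j$ has finitely many zeroes on $C_j$, all simple. Algorithm. Precomputation: $S_0$ and $T_1,\dots,T_l$ are found from the solutions of the auxiliary polynomial systems (with $j=0$ for $S_0$, and with index $j$ for $T_j$), discarding the solutions that do not lie in $\Delta$, respectively those $y$ with $p_i(y)<0$ for some $i$. Then for $j=1,2,\dots,l$ in turn, perform the continuation step with input $S_{j-1}$ and $T_j$ and output $S_j$: from each $s\in S_{j-1}$ follow $C_j$ in both directions, and from each $t\in T_j$ follow $C_j$ in the direction of the interior of $\Delta$, in each case until one of the following is found: (1) a zero of $\varphi_j$ on $C_j$, (2) a point of $S_{j-1}$ (a zero of $\widetilde J_j$ on $C_j$), or (3) a point of $T_j$. The points found under (1) form the output. The last set computed, $S_l$, is the set of solutions in $\Delta$ of the given system. Curve following and polynomial system solving are treated as elementary routines (function calls). The number of curves traced is the total number of paths followed over all $l$ steps.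
   Formalization: Bounds use d≥n with deg J_j ≤ 2^(l-j)d instead of n (degree n fails in general; d=n+1 always works); Bézout numbers are upper bounds, equal at full degree; last inequality omits (l,d)=(2,1); l,n≥1; ''sufficiently general'' lists smoothness, nonzero minors, transversality. *)

(* Defs.v *)
From HB Require Import structures.
From mathcomp Require Import all_boot all_order all_algebra.
From mathcomp.multinomials Require Import -(notations) mpoly.
From mathcomp Require Import all_classical all_reals all_analysis.
Set Implicit Arguments.
Unset Strict Implicit.
Unset Printing Implicit Defensive.
Import Order.TTheory GRing.Theory Num.Theory.
Import numFieldNormedType.Exports.
Local Open Scope classical_set_scope.
Local Open Scope ring_scope.

(* Indices are 0-based: k : 'I_l stands for the index j = k + 1 of phi_j,
   \tilde J_j, J_j and C_j.  A natural number k <= l indexing the solution sets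
   S_0, ..., S_l keeps its value. *)

Definition peval (R : realType) (m : nat) (q : mpoly m R) (y : 'rV[R]_m)
  : R := meval (fun i => y 0 i) q.

Definition degree (R : realType) (m : nat) (q : mpoly m R) : nat :=
  (mmeasure (@mdeg m) q).-1.

Definition dmpoly (R : realType) (m : nat) (q : mpoly m R)
  (y v : 'rV[R]_m) : R :=
  \sum_(a < m) peval (mderiv a q) y * v 0 a.

Section Gale.
Context {R : realType} {l n : nat}.
Local Notation pt := 'rV[R]_l.
Context (p : 'I_(l + n).+1 -> mpoly l R).
Context (beta : 'I_(l + n).+1 -> 'I_l -> R).

Definition Delta : set pt := [set y | forall i, 0 < peval (p i) y].

Definition boundary_Delta : set pt := closure Delta `\` interior Delta.

Definition general_position : Prop :=
  forall A : {set 'I_(l + n).+1}, #|A| = l.+1 ->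
  ~ exists y : pt, forall i, i \in A -> peval (p i) y = 0.

Definition psi (k : 'I_l) (y : pt) : R := \prod_i (peval (p i) y `^ beta i k).

Definition phi (k : 'I_l) (y : pt) : R := \sum_i beta i k * ln (peval (p i) y).

Definition psi_plus (k : 'I_l) (y : pt) : R :=
  \prod_(i | 0 < beta i k) (peval (p i) y `^ beta i k).

Definition psi_minus (k : 'I_l) (y : pt) : R :=
  \prod_(i | beta i k < 0) (peval (p i) y `^ (- beta i k)).

Definition fdiff (k : 'I_l) (y : pt) : R := psi_plus k y - psi_minus k y.

Definition jacobian (F : 'I_l -> pt -> R) (y : pt) : 'M[R]_l :=
  \matrix_(a, b) 'D_(delta_mx 0 b : pt) (F a) y.

Definition Jdet (F : 'I_l -> pt -> R) (y : pt) : R := \det (jacobian F y).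

(* The l functions phi_1, ..., phi_(l-m), \tilde J_(l-m+1), ..., \tilde J_l:
   one step replaces the last remaining phi, that is phi_j with j = l - m, by
   Jdet (phi_1, ..., phi_j, \tilde J_(j+1), ..., \tilde J_l). *)
Fixpoint replace_last (m : nat) : 'I_l -> pt -> R :=
  if m is m'.+1 then
    fun k => if k == (l - m)%N :> nat then Jdet (replace_last m')
             else replace_last m' k
  else phi.

(* phi_1, ..., phi_j, \tilde J_(j+1), ..., \tilde J_l *)
Definition mixed (j : nat) : 'I_l -> pt -> R := replace_last (l - j).

Definition tildeJ (k : 'I_l) : pt -> R := Jdet (mixed k.+1).

Definition cleared (J : 'I_l -> mpoly l R) : Prop :=
  forall k y, Delta y ->
  peval (J k) y = tildeJ k y * (\prod_i peval (p i) y) ^+ (2 ^ (l - k.+1)).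

Definition Sset (j : nat) : set pt :=
  Delta `&` [set y | forall k, mixed j k y = 0].

Definition Cset (k : 'I_l) : set pt :=
  Delta `&` [set y | forall a, a != k -> mixed k.+1 a y = 0].

Definition Tset (J : 'I_l -> mpoly l R) (k : 'I_l) : set pt :=
  boundary_Delta `&` [set y |
    (forall a : 'I_l, (a < k)%N -> fdiff a y = 0) /\
    (forall a : 'I_l, (k < a)%N -> peval (J a) y = 0)].

Definition smooth_curve (k : 'I_l) : Prop :=
  forall y, Cset k y -> row_free (row' k (jacobian (mixed k.+1) y)).

Definition zeroes_on_curve (k : 'I_l) : set pt :=
  Cset k `&` [set y | phi k y = 0].

Definition continuation_hypotheses (k : 'I_l) : Prop :=
  [/\ smooth_curve k, finite_set (zeroes_on_curve k) &
      forall y, zeroes_on_curve k y -> Jdet (mixed k.+1) y != 0].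

Definition zero_flat (I : {set 'I_(l + n).+1}) : set pt :=
  [set y | forall i, i \in I -> peval (p i) y = 0].

Definition aux_solutions (J : 'I_l -> mpoly l R)
    (I : {set 'I_(l + n).+1}) : set pt :=
  zero_flat I `&` [set y | forall k : 'I_l, (#|I| <= k)%N -> peval (J k) y = 0].

Definition retained (J : 'I_l -> mpoly l R)
    (I : {set 'I_(l + n).+1}) : set pt :=
  aux_solutions J I `&` (if I == finset.set0 then Delta
                         else [set y | forall i, 0 <= peval (p i) y]).

(* Genericity of the exponents: the hypotheses of each continuation step, the
   minors of beta on leading columns, and transversality of the auxiliary
   systems at the solutions that are kept (which lie on no further p_i = 0). *)
Definition sufficiently_general (J : 'I_l -> mpoly l R) : Prop :=
  [/\ forall k, continuation_hypotheses k,
      forall m (le_m_l : (m <= l)%N) (r : 'I_m -> 'I_(l + n).+1), injective r ->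
        \det (\matrix_(a, b) beta (r a) (widen_ord le_m_l b)) != 0 &
      forall (I : {set 'I_(l + n).+1}) y, (#|I| <= l)%N -> retained J I y ->
        (forall i, i \notin I -> 0 < peval (p i) y) /\
        (forall v : pt, (forall i, i \in I -> dmpoly (p i) y v = 0) ->
           (forall k : 'I_l, (#|I| <= k)%N -> dmpoly (J k) y v = 0) -> v = 0)].

(* th is a parametrization of p_i = 0 (i in I) by affine functions of m
   variables, so that substituting it eliminates l - m variables. *)
Definition elimination (I : {set 'I_(l + n).+1}) (m : nat)
    (th : l.-tuple (mpoly m R)) : Prop :=
  let g := fun z : 'rV[R]_m => (\row_i peval (tnth th i) z : pt) in
  [/\ forall i, (degree (tnth th i) <= 1)%N, injective g &
      range g = zero_flat I].

Definition reduced (J : 'I_l -> mpoly l R) (m : nat)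
    (th : l.-tuple (mpoly m R)) (k : 'I_l) : mpoly m R :=
  comp_mpoly th (J k).

Definition bezout (J : 'I_l -> mpoly l R) (j m : nat)
    (th : l.-tuple (mpoly m R)) : nat :=
  (\prod_(k < l | j <= k) degree (reduced J th k))%N.

(* curve_arc k S T (a, A, b): following C_k from the input point a (in S or in
   T), the tracer runs through A, where it meets no stopping point, and stops
   at b.
   Arcs from the same a in different directions differ in A. *)
Definition curve_arc (k : 'I_l) (S T : set pt) (t : pt * set pt * pt) : Prop :=
  let: (a, A, b) := t in
  let stop := zeroes_on_curve k `|` S `|` T in
  [/\ (S `|` T) a, A `<=` Cset k `\` stop, stop b &
    exists g : R -> pt,
      [/\ {within `[0, 1], continuous g}, {in `[0, 1[ &, injective g},
          g 0 = a, g @` `]0, 1[ = A & g 1 = b]].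

Definition step_output (k : 'I_l) (S T : set pt) : set pt :=
  [set b | zeroes_on_curve k b /\ exists a A, curve_arc k S T (a, A, b)].

Definition found_T (J : 'I_l -> mpoly l R) (k : 'I_l) : set pt :=
  [set y | exists I : {set 'I_(l + n).+1}, #|I| = k.+1 /\ retained J I y].

(* The set held by the algorithm after j continuation steps. *)
Fixpoint found_S (J : 'I_l -> mpoly l R) (j : nat) : set pt :=
  if j is j'.+1 then
    [set y | exists k : 'I_l, k = j' :> nat /\
             step_output k (found_S J j') (found_T J k) y]
  else retained J finset.set0.

Definition arcs_from (J : 'I_l -> mpoly l R) (k : 'I_l) (a : pt)
  : set (set pt * pt) :=
  [set t | curve_arc k (found_S J k) (found_T J k) (a, t.1, t.2)].

Definition traced (J : 'I_l -> mpoly l R)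
  : set ('I_l * (pt * set pt * pt)) :=
  [set t | curve_arc t.1 (found_S J t.1) (found_T J t.1) t.2].

End Gale.

(* d is a number such that each J_j has degree at most 2^(l-j) d.  The
   published bounds are those for d = n; d = n + 1 is admissible whatever the
   exponents, but d = n in general is not: for l = 1 the coefficient of degree
   n + 1 in J_1 is (\sum_i beta_i) * \prod_i p_i'. *)
Definition bezout_bound (l j d : nat) : nat :=
  (2 ^ 'C(l - j, 2) * d ^ (l - j))%N.

Definition curve_bound (l n d : nat) : nat :=
  (l * 2 ^ ('C(l, 2) + 1) * d ^ l +
   \sum_(1 <= j < l.+1)
      (l + 1 - j) * 2 ^ 'C(l - j, 2) * d ^ (l - j) * 'C(l + n + 1, j))%N.

(* Main.v *)
(* On C_k the function h = phi_k / (1 + |phi_k|) is a local coordinate wherever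
   \tilde J_k, the Jacobian determinant of (phi_1, ..., phi_k, \tilde J_(k+1),
   ..., \tilde J_l), does not vanish.  At a corner of the closure of C_k the
   minors of beta let the equations phi_1 = ... = phi_(k-1) = 0 be solved for
   the vanishing p_i as powers, with exponents at least 1, of the largest one
   times smooth factors; so the curve arrives there as a single branch, along
   which phi_k tends to +oo or -oo.  Hence the closure is a finite graph whose
   edges are monotone in h, with two edges at each zero of phi_k or \tilde J_k
   and one at each corner.  No edge joins two zeroes of phi_k (Rolle), so each
   of them is found, and counting edge ends gives 2 |S_k| <= 2 |S_(k-1)| + |T_k|.

   The solutions of the auxiliary systems are nondegenerate, and their number
   is at most the product of the degrees: for interpolation polynomials e_a at
   the zeros a, the products e_a f^alpha are linearly independent, because the
   lowest order part at a of a relation is a form in the independent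
   differentials df, and dimensions are compared as the degree grows.

   The polynomials J_k are determinants of a bordered matrix whose Schur
   complement is the Jacobian matrix, each row multiplied by its denominator. *)
Require Import Defs.
From mathcomp Require Import all_boot all_order all_algebra.
From mathcomp.multinomials Require Import -(notations) mpoly.
From mathcomp Require Import all_classical all_reals all_analysis.
From mathcomp Require Import perm ring lra zify.
Set Implicit Arguments.
Unset Strict Implicit.
Unset Printing Implicit Defensive.
Import Order.TTheory GRing.Theory Num.Theory.
Import numFieldNormedType.Exports.
Local Open Scope classical_set_scope.
Local Open Scope card_scope.
Local Open Scope ring_scope.

(** * Strict differentiability *)

Section StrictDifferentiability.
Context {R : realType}.

(** Near a corner the curve is described by real powers of a quantity that vanishes there, so its
    equations are meaningful on one side only. They are continued evenly across the zero, and all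
    differential calculus is done with strict differentiability at one point: this suffices for the
    inverse function theorem and passes through sums, products and compositions without any
    statement about a neighbourhood.

    The vertices of the graph are all points where the tracer may stop, including the zeroes of
    [phi] on the curve, where the height is a good coordinate. Edges are thereby the same objects as
    traced arcs. Squashing [phi] to values in [[-1, 1]] makes the height interval of a maximal arc
    bounded, and compactness of the closed curve then provides its end points.

    The constant [(e^2 + 3) / 2] is used only through [e^2 > 7], which makes it exceed 5. With
    [P = l 2^'C(l, 2) d^l], the first term of the bound is [2 P] and the sum over corners is at most
    [3 P]. *)

Lemma near_normP (V : normedModType R) (q : V) (P : V -> Prop) :
  (\forall x \near q, P x) <->
  exists2 r : R, 0 < r & forall x, `|x - q| < r -> P x.
Proof.
split=> [/nbhs_ballP[r /= r0 rP]|[r r0 rP]].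
  by exists r => // x xq; apply: rP; rewrite -ball_normE /= distrC.
by apply/nbhs_ballP; exists r => //= x; rewrite -ball_normE /= distrC; exact: rP.
Qed.

Lemma nbhs_normP (V : normedModType R) (q : V) (A : set V) :
  nbhs q A <-> exists2 r : R, 0 < r & forall x, `|x - q| < r -> A x.
Proof. exact: near_normP. Qed.

Lemma continuous_normP (V W : normedModType R) (f : V -> W) (q : V) :
  {for q, continuous f} <->
  (forall e : R, 0 < e -> exists2 r : R, 0 < r &
     forall x, `|x - q| < r -> `|f x - f q| < e).
Proof.
split=> [/cvgrPdist_lt fc e e0|fc].
  by have /near_normP[r r0 rP] := fc _ e0; exists r => // x /rP; rewrite distrC.
apply/cvgrPdist_lt => e e0; apply/near_normP.
by have [r r0 rP] := fc _ e0; exists r => // x /rP; rewrite distrC.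
Qed.

(** Strict differentiability: both points of the difference quotient move. It is a condition at [a]
    alone, yet strong enough to invert maps near [a]. *)
Definition sdiff1 (h : R -> R) (d a : R) := forall e : R, 0 < e ->
  exists2 r : R, 0 < r & forall x y, `|x - a| < r -> `|y - a| < r ->
    `|h x - h y - d * (x - y)| <= e * `|x - y|.

(** By the mean value theorem an increment is the derivative at an intermediate point, which is
    close to [dh a] by continuity. *)
Lemma sdiff1_C1 (h dh : R -> R) (a : R) :
  (\forall x \near a, is_derive x (1 : R) h (dh x)) -> {for a, continuous dh} ->
  sdiff1 h (dh a) a.
Proof.
move=> hd cd e e0.
have cd' : \forall x \near a, `|dh x - dh a| < e.
  by move/cvgrPdist_lt : cd => /(_ _ e0); apply: filterS => x; rewrite distrC.
have [r /= r0 rP] : nbhs_ball a [set x | is_derive x (1:R) h (dh x) /\ `|dh x - dh a| < e].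
  by apply/nbhs_ballP; exact: filterI hd cd'.
exists r => // x y.
wlog lt_yx : x y / y < x.
  move=> W xa ya; have [xy|xy|->] := ltgtP x y; last first.
      by rewrite !subrr mulr0 subrr normr0 mulr0.
    exact: W.
    rewrite -normrN [X in `|X|](_ : _ = h y - h x - dh a * (y - x)); last by ring.
    by rewrite (distrC x y); apply: W.
move=> xa ya.
have inb z : y <= z <= x -> ball a r z.
  by move=> /andP[yz zx]; rewrite -ball_normE /= distrC; move: xa ya; rewrite !ltr_distl; lra.
have [||c] := @MVT R h dh y x lt_yx.
- by move=> z; rewrite in_itv /= => /andP[/ltW yz /ltW zx]; apply: (rP z _).1; apply: inb; rewrite yz.
- apply: continuous_in_subspaceT => z; rewrite inE /= in_itv /= => zi.
  have [hz _] := rP z (inb _ zi).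
  by apply: differentiable_continuous; apply/derivable1_diffP; apply: ex_derive.
- rewrite in_itv /= => /andP[yc cx] ->.
  rewrite -mulrBl normrM ler_wpM2r //; apply/ltW.
  by apply: (rP c _).2; apply: inb; rewrite !ltW.
Qed.

Lemma sdiff1_expR a : sdiff1 expR (expR a) a.
Proof.
apply: sdiff1_C1; last exact: continuous_expR.
by apply/near_normP; exists 1 => // x _; apply: is_derive_expR.
Qed.

Lemma sdiff1_ln a : 0 < a -> sdiff1 (@ln R) a^-1 a.
Proof.
move=> a0; apply: (@sdiff1_C1 _ (fun x => x^-1)).
  apply/near_normP; exists a => // x xa; apply: is_derive1_ln.
  by move: xa; rewrite ltr_distl subrr => /andP[].
by apply: inv_continuous; rewrite gt_eqF.
Qed.

Lemma sdiff1_inv a : a != 0 -> sdiff1 (fun x => x^-1) (- (a ^+ 2)^-1) a.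
Proof.
move=> a0; apply: (@sdiff1_C1 _ (fun x => - (x ^+ 2)^-1)).
  apply/near_normP; exists `|a| => [|x xa]; first by rewrite normr_gt0.
  have x0 : x != 0 by apply: contraTneq xa => ->; rewrite sub0r normrN ltxx.
  have := @is_deriveV R id x 1 1 x0 (is_derive_id _ _).
  by rewrite /GRing.scale /= mulr1.
apply: continuousN; apply: continuousV; first by rewrite expf_neq0.
exact: exprn_continuous.
Qed.

Lemma sdiff1_sqr a : sdiff1 (fun x => x ^+ 2) (2 * a) a.
Proof.
move=> e e0; exists (e / 2); first by rewrite divr_gt0.
move=> x y xa ya.
rewrite (_ : _ - _ = (x - a + (y - a)) * (x - y)); last by ring.
by rewrite normrM ler_wpM2r // (le_trans (ler_normD _ _)) //; move: xa ya; lra.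
Qed.

(* For [r > 1] the even function |x|^r has derivative [0] at [0] in the strict
   sense; [r = 1] is not covered. *)
Lemma sdiff1_norm_powR (r : R) : 1 < r -> sdiff1 (fun x => `|x| `^ r) 0 0.
Proof.
move=> r1 e e0.
have r10 : 0 < r - 1 by rewrite subr_gt0.
(* Below [d] the slope bound [r * x ^ (r - 1)] of the power function is at most [e]. *)
pose d := (e / r) `^ (r - 1)^-1.
have r0 : 0 < r by apply: lt_trans r1.
have er0 : 0 < e / r by rewrite divr_gt0.
have d0 : 0 < d by apply: powR_gt0.
have dE : d `^ (r - 1) = e / r.
  by rewrite /d -powRrM mulVf ?powRr1 ?ltW // gt_eqF.
have key (x y : R) : 0 <= y -> y <= x -> x < d -> 0 <= x `^ r - y `^ r <= e * (x - y).
  move=> y0 yx xd.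
  rewrite subr_ge0 ge0_ler_powR ?nnegrE ?(le_trans y0 yx) ?(ltW r0) //=.
  have x0 := le_trans y0 yx.
  have xe : x `^ (r - 1) <= e / r.
    by rewrite -dE ge0_ler_powR ?nnegrE ?(ltW r10) ?(ltW d0) ?(ltW xd).
  have [y_gt0|] := ltrP 0 y; last first.
    move=> y_le0; have -> : y = 0 by apply/le_anti; rewrite y0 y_le0.
    rewrite powR0 ?gt_eqF // !subr0 -(mulr_powRB1 x0 r0) mulrC ler_wpM2r //.
    by rewrite (le_trans xe) // ler_pdivrMr // ler_peMr // ltW.
  have x_gt0 : 0 < x by apply: lt_le_trans yx.
  rewrite -(mulr_powRB1 x0 r0) -(mulr_powRB1 y0 r0).
  set X := x `^ (r - 1); set Y := y `^ (r - 1).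
  have X0 : 0 < X by apply: powR_gt0.
  (* Comes from [expR u >= 1 + u] and [ln (1 + u) <= u], applied to [(y / x) ^ (r - 1)]. *)
  have XY : X * (1 - (r - 1) * (x - y) / y) <= Y.
    have -> : Y = X * expR ((r - 1) * ln (y / x)).
      rewrite /X /Y mulrC -{1}(lnK (x := y)) ?posrE //.
      rewrite /powR (gt_eqF x_gt0) expRK.
      rewrite (gt_eqF (expR_gt0 _)) -expRD; congr expR.
      by rewrite ln_div ?posrE //; ring.
    rewrite ler_wpM2l ?(ltW X0) //.
    apply: (le_trans _ (expR_ge1Dx _)).
    rewrite lerD2l -mulrA -mulrN ler_wpM2l ?(ltW r10) //.
    rewrite -[leRHS]opprK lerN2.
    have -> : - ln (y / x) = ln (1 + (x - y) / y).
      rewrite -lnV ?posrE ?divr_gt0 //; congr ln.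
      by field; rewrite !gt_eqF.
    by apply: le_ln1Dx; rewrite (lt_le_trans (ltrN10 _)) // divr_ge0 // subr_ge0.
  have h1 : x * X - y * Y <= (x - y) * X * r.
    have := ler_wpM2l y0 XY.
    rewrite (_ : y * (X * _) = y * X - X * (r - 1) * (x - y)); last first.
      by field; rewrite gt_eqF.
    lra.
  apply: le_trans h1 _.
  rewrite (_ : _ * r = X * r * (x - y)); last by ring.
  by rewrite ler_wpM2r ?subr_ge0 // -ler_pdivlMr.
exists d => // x y; rewrite !subr0 mul0r subr0 => xd yd.
apply: (@le_trans _ _ (e * `| `|x| - `|y| |)); last first.
  by rewrite ler_wpM2l ?(ltW e0) // ler_dist_dist.
have [xy|/ltW xy] := leP `|y| `|x|.
  have /andP[h1 h2] := key _ _ (normr_ge0 y) xy xd.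
  by rewrite ger0_norm // [X in _ <= _ * X]ger0_norm ?subr_ge0.
have /andP[h1 h2] := key _ _ (normr_ge0 x) xy yd.
by rewrite distrC ger0_norm // [X in _ <= _ * X]distrC [X in _ <= _ * X]ger0_norm ?subr_ge0.
Qed.

Context {m : nat}.
Implicit Types (f : 'rV[R]_m -> R) (g : 'I_m -> R) (q : 'rV[R]_m).

Definition dot g (v : 'rV[R]_m) : R := \sum_a g a * v 0 a.

Definition sdiff f g q := forall e : R, 0 < e ->
  exists2 r : R, 0 < r & forall x y, `|x - q| < r -> `|y - q| < r ->
    `|f x - f y - dot g (x - y)| <= e * `|x - y|.

Lemma mx_entry_le (n k : nat) (A : 'M[R]_(n, k)) i j : `|A i j| <= `|A|.
Proof.
rewrite [leRHS]/Num.norm /= mx_normrE.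
by apply/bigmax_geP; right; exists (i, j).
Qed.

Lemma dot_bound g : exists2 M : R, 0 < M & forall v, `|dot g v| <= M * `|v|.
Proof.
exists (1 + \sum_a `|g a|); first by rewrite ltr_pwDl // sumr_ge0.
move=> v; rewrite (le_trans (ler_norm_sum _ _ _)) // mulrDl mul1r ler_wpDl //.
rewrite mulr_suml ler_sum // => a _.
by rewrite normrM ler_wpM2l // mx_entry_le.
Qed.

Lemma dotD g g' v : dot (fun a => g a + g' a) v = dot g v + dot g' v.
Proof. by rewrite /dot -big_split; apply: eq_bigr => a _; rewrite mulrDl. Qed.

Lemma dotZ c g v : dot (fun a => c * g a) v = c * dot g v.
Proof. by rewrite /dot mulr_sumr; apply: eq_bigr => a _; rewrite mulrA. Qed.

Lemma eq_dot g g' v : g =1 g' -> dot g v = dot g' v.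
Proof. by move=> gg; apply: eq_bigr => a _; rewrite gg. Qed.

Lemma eq_sdiff f g g' q : g =1 g' -> sdiff f g q -> sdiff f g' q.
Proof.
move=> gg fd e /fd[r r0 rP]; exists r => // x y xq yq.
by rewrite -(eq_dot _ gg); apply: rP.
Qed.

Lemma near_sdiff f f' g q :
  (\forall x \near q, f x = f' x) -> sdiff f g q -> sdiff f' g q.
Proof.
move=> /near_normP[r1 r10 r1P] fd e /fd[r r0 rP].
exists (Num.min r r1); first by rewrite lt_min r0.
move=> x y; rewrite !lt_min => /andP[xr xr1] /andP[yr yr1].
by rewrite -!r1P //; apply: rP.
Qed.

Lemma sdiff_lip f g q : sdiff f g q ->
  exists2 M : R, 0 < M & exists2 r, 0 < r & forall x y,
    `|x - q| < r -> `|y - q| < r -> `|f x - f y| <= M * `|x - y|.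
Proof.
move=> /(_ 1 ltr01)[r r0 rP]; have [M M0 MP] := dot_bound g.
exists (1 + M); first by rewrite addr_gt0.
exists r => // x y xq yq.
rewrite -[f x - f y](subrK (dot g (x - y))) (le_trans (ler_normD _ _)) //.
by rewrite mulrDl lerD // rP.
Qed.

Lemma sdiff_continuous f g q : sdiff f g q -> {for q, continuous f}.
Proof.
move=> /sdiff_lip[M M0 [r r0 rP]].
apply/continuous_normP => e e0; exists (Num.min r (e / M)).
  by rewrite lt_min r0 divr_gt0.
move=> x; rewrite lt_min => /andP[xr xe].
rewrite (@le_lt_trans _ _ (M * `|x - q|)) ?rP ?subrr ?normr0 //.
by rewrite mulrC -ltr_pdivlMr.
Qed.

Lemma sdiff_cst c q : sdiff (fun=> c) (fun=> 0) q.
Proof.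
move=> e e0; exists 1 => // x y _ _; rewrite subrr sub0r normrN.
rewrite /dot big1 ?normr0 ?mulr_ge0 ?(ltW e0) // => a _; exact: mul0r.
Qed.

Lemma sdiff_coord b q : sdiff (fun y => y 0 b) (fun a => (a == b)%:R) q.
Proof.
move=> e e0; exists 1 => // x y _ _.
rewrite /dot (bigD1 b) //= eqxx mul1r big1 ?addr0; last first.
  by move=> a /negPf->; exact: mul0r.
by rewrite !mxE subrr normr0 mulr_ge0 // ltW.
Qed.

Lemma sdiffD f g f' g' q : sdiff f g q -> sdiff f' g' q ->
  sdiff (fun y => f y + f' y) (fun a => g a + g' a) q.
Proof.
move=> fd fd' e e0; have e20 : 0 < e / 2 by rewrite divr_gt0.
have [r r0 rP] := fd _ e20; have [r' r'0 rP'] := fd' _ e20.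
exists (Num.min r r'); first by rewrite lt_min r0.
move=> x y; rewrite !lt_min => /andP[xr xr'] /andP[yr yr'].
rewrite dotD (_ : _ - _ = (f x - f y - dot g (x - y)) + (f' x - f' y - dot g' (x - y))); last by ring.
rewrite (le_trans (ler_normD _ _)) // (splitr e) mulrDl lerD //; [exact: rP|exact: rP'].
Qed.

Lemma sdiff_comp h d f g q : sdiff f g q -> sdiff1 h d (f q) ->
  sdiff (fun y => h (f y)) (fun a => d * g a) q.
Proof.
move=> fd hd e e0; have [M M0 [r r0 rP]] := sdiff_lip fd.
have [s s0 sP] := hd (e / 2 / M) (divr_gt0 (divr_gt0 e0 (ltr0Sn _ 1)) M0).
have d0 : 0 < `|d| + 1 by rewrite ltr_wpDl.
have [t t0 tP] := fd (e / 2 / (`|d| + 1)) (divr_gt0 (divr_gt0 e0 (ltr0Sn _ 1)) d0).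
exists (Num.min (Num.min r t) (s / M)).
  by rewrite !lt_min r0 t0 divr_gt0.
move=> x y; rewrite !lt_min => /andP[/andP[xr xt] xs] /andP[/andP[yr yt] ys].
have q0 : `|q - q| < r by rewrite subrr normr0.
have fs z : `|z - q| < r -> `|z - q| < s / M -> `|f z - f q| < s.
  by move=> zr zs; rewrite (le_lt_trans (rP _ _ zr q0)) // mulrC -ltr_pdivlMr.
rewrite dotZ.
rewrite (_ : _ - _ = (h (f x) - h (f y) - d * (f x - f y)) +
  d * (f x - f y - dot g (x - y))); last by ring.
rewrite (le_trans (ler_normD _ _)) // [in leRHS](splitr e) mulrDl lerD //.
  apply: (le_trans (sP _ _ (fs _ xr xs) (fs _ yr ys))).
  rewrite -[leLHS]mulrA ler_wpM2l ?divr_ge0 ?(ltW e0) ?(ltW M0) //.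
  by rewrite mulrC ler_pdivrMr // mulrC rP.
rewrite normrM.
apply: (@le_trans _ _ ((`|d| + 1) * (e / 2 / (`|d| + 1) * `|x - y|))).
  by rewrite ler_pM // ?lerDl // tP.
by rewrite mulrA mulrCA mulfV ?mulr1 // gt_eqF.
Qed.

Lemma sdiffZ c f g q : sdiff f g q -> sdiff (fun y => c * f y) (fun a => c * g a) q.
Proof.
move=> fd; apply: (@sdiff_comp (fun x => c * x) c) => // e e0.
by exists 1 => // x y _ _; rewrite -mulrBr subrr normr0 mulr_ge0 // ltW.
Qed.

(** Polarization: a product is a quarter of the difference of the squares of sum and difference, so
    the chain rule for squaring suffices. *)
Lemma sdiffM f g f' g' q : sdiff f g q -> sdiff f' g' q ->
  sdiff (fun y => f y * f' y) (fun a => g a * f' q + f q * g' a) q.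
Proof.
move=> fd fd'.
have h1 := sdiff_comp (sdiffD fd fd') (sdiff1_sqr _).
have h2 := sdiff_comp (sdiffD fd (sdiffZ (-1) fd')) (sdiff1_sqr _).
have := sdiffZ (1 / 4) (sdiffD h1 (sdiffZ (-1) h2)).
set F := (X in sdiff X); set F' := (X in _ -> sdiff X _ _).
have -> : F = F' by apply/funext => y; rewrite /F /F'; field.
by apply: eq_sdiff => a; field.
Qed.

Lemma sdiff_sum (I : Type) (s : seq I) (P : pred I) (F : I -> 'rV[R]_m -> R)
    (G : I -> 'I_m -> R) q :
  (forall i, P i -> sdiff (F i) (G i) q) ->
  sdiff (fun y => \sum_(i <- s | P i) F i y) (fun a => \sum_(i <- s | P i) G i a) q.
Proof.
move=> FG; elim: s => [|i s IH].
  under [X in sdiff X]eq_fun do rewrite big_nil.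
  by apply: eq_sdiff (sdiff_cst _ _) => a; rewrite big_nil.
under [X in sdiff X]eq_fun do rewrite big_cons.
case: (boolP (P i)) => Pi; last by apply: eq_sdiff IH => a; rewrite big_cons (negPf Pi).
by apply: eq_sdiff (sdiffD (FG _ Pi) IH) => a; rewrite big_cons Pi.
Qed.

Lemma dot_delta g b : dot g (delta_mx 0 b) = g b.
Proof.
rewrite /dot (bigD1 b) //= mxE !eqxx mulr1 big1 ?addr0 // => a /negPf ab.
by rewrite mxE ab andbF mulr0.
Qed.

(** Identifies the strict derivative with the directional derivatives that define [jacobian]. *)
Lemma sdiff_derive f g q b : sdiff f g q ->
  'D_(delta_mx 0 b : 'rV[R]_m) f q = g b.
Proof.
move=> fd; rewrite /derive; apply/cvg_lim => //.
apply/cvgrPdist_le => e e0.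
have [r r0 rP] := fd _ e0.
near=> h.
have h0 : h != 0 by near: h; exact: nbhs_dnbhs_neq.
set v : 'rV[R]_m := delta_mx 0 b.
have v1 : `|v| <= 1.
  rewrite [leLHS]/Num.norm /= mx_normrE; apply/bigmax_leP; split=> // -[i j] _ /=.
  by rewrite mxE; case: (_ && _); rewrite ?normr1 ?normr0.
have hr : `|h *: v| < r.
  rewrite normrZ (@le_lt_trans _ _ `|h|) //; first by rewrite ler_piMr.
  near: h; apply: dnbhs0_lt => //.
have := rP (h *: v + q) q; rewrite addrK subrr normr0 => /(_ hr r0).
rewrite /dot; under eq_bigr do rewrite mxE mulrCA.
rewrite -mulr_sumr -/(dot g v) dot_delta normrZ => H.
rewrite distrC.
rewrite (_ : _ - _ = h^-1 * (f (h *: v + q) - f q - h * g b)); last first.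
  by rewrite mulrBr mulKf.
rewrite normrM normfV ler_pdivrMl ?normr_gt0 // (le_trans H) // mulrCA.
by rewrite ler_wpM2l // ler_piMr // ltW.
Unshelve. all: by end_near. Qed.

End StrictDifferentiability.

(** * Inverse functions *)

Section InverseFunction.
Context {R : realType} {m : nat}.
Implicit Types (q y z v : 'rV[R]_m).

Lemma mulmx_norm_le (B : 'M[R]_m) :
  exists2 K : R, 0 < K & forall v, `|v *m B| <= K * `|v|.
Proof.
have /choice[M MP] : forall a, exists K, 0 < K /\
    forall v, `|dot (fun b => B b a) v| <= K * `|v|.
  by move=> a; have [K K0 KP] := dot_bound (fun b => B b a); exists K.
exists (1 + \sum_a M a) => [|v].
  by rewrite ltr_pwDl // sumr_ge0 // => a _; exact/ltW/(MP a).1.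
rewrite [leLHS]/Num.norm /= mx_normrE; apply/bigmax_leP; split=> [|[i a] _ /=].
  by rewrite mulr_ge0 // addr_ge0 // sumr_ge0 // => a _; exact/ltW/(MP a).1.
rewrite (_ : (v *m B) i a = dot (fun b => B b a) v); last first.
  by rewrite mxE; apply: eq_bigr => b _; rewrite (ord1 i) mulrC.
rewrite (le_trans ((MP a).2 v)) // ler_wpM2r // (bigD1 a) //= addrCA lerDl.
by rewrite addr_ge0 // sumr_ge0 // => b _; exact/ltW/(MP b).1.
Qed.

Lemma inj_unitmx (A : 'M[R]_m) : (forall v, v *m A = 0 -> v = 0) -> A \in unitmx.
Proof.
move=> inj; rewrite -row_free_unit -kermx_eq0; apply/eqP/row_matrixP => i.
by rewrite row0; apply: inj; rewrite -row_mul mulmx_ker row0.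
Qed.

(** Solvability of [F y = z] needs no iteration: the residual, measured through the inverse
    derivative, attains its minimum on a closed ball, and a Newton step from the minimizer would at
    least halve it, so the minimum is 0. *)
Lemma inverse_function (F : 'rV[R]_m -> 'rV[R]_m) (G : 'I_m -> 'I_m -> R) q (rho : R) :
  0 < rho ->
  (forall a, sdiff (fun y => F y 0 a) (G a) q) ->
  (forall v, (forall a, dot (G a) v = 0) -> v = 0) ->
  exists psi : 'rV[R]_m -> 'rV[R]_m, exists2 r : R, 0 < r &
    [/\ forall z, `|z - F q| < r -> `|psi z - q| < rho /\ F (psi z) = z,
        forall z, `|z - F q| < r -> {for z, continuous psi} &
        \forall y \near q, psi (F y) = y].
Proof.
move=> rho0 Fd Ginj; pose A := \matrix_(b, a) G a b.
have mulA v a : (v *m A) 0 a = dot (G a) v.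
  by rewrite mxE; apply: eq_bigr => b _; rewrite mxE mulrC.
have Au : A \in unitmx.
  apply: inj_unitmx => v vA; apply: Ginj => a; rewrite -mulA vA mxE //.
have [K K0 KP] := mulmx_norm_le (invmx A).
have K20 : 0 < (2 * K)^-1 by rewrite invr_gt0 mulr_gt0.
have [s s0 sP] : exists2 s : R, 0 < s & forall x y, `|x - q| < s -> `|y - q| < s ->
    `|F x - F y - (x - y) *m A| <= (2 * K)^-1 * `|x - y|.
  have /choice[r rP] : forall a, exists r : R, 0 < r /\ forall x y,
      `|x - q| < r -> `|y - q| < r ->
      `|F x 0 a - F y 0 a - dot (G a) (x - y)| <= (2 * K)^-1 * `|x - y|.
    by move=> a; have [r r0 rP] := Fd a _ K20; exists r.
  exists (\big[Num.min/1]_a r a).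
    by apply/bigmin_gtP; split=> // a _; case: (rP a).
  move=> x y /bigmin_gtP[_ xr] /bigmin_gtP[_ yr].
  rewrite [leLHS]/Num.norm /= mx_normrE; apply/bigmax_leP; split=> [|[i a] _ /=].
    by rewrite mulr_ge0 // ltW.
  rewrite (ord1 i); have := (rP a).2 x y (xr a isT) (yr a isT).
  by rewrite -mulA !mxE.
pose t := Num.min s rho / 2.
have t0 : 0 < t by rewrite divr_gt0 // lt_min s0.
have ts : t < s by rewrite /t ltr_pdivrMr // mulr_natr mulr2n (@le_lt_trans _ _ s) ?ge_min ?lexx // ltrDl.
have trho : t < rho.
  by rewrite /t ltr_pdivrMr // mulr_natr mulr2n (@le_lt_trans _ _ rho) ?ge_min ?lexx ?orbT // ltrDl.
(* The map sending [y] to [y - F y *m invmx A] contracts by 1/2 near [q]. This controls the Newton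
   step and yields the Lipschitz bound [explip] for the inverse. *)
have contr x y : `|x - q| < s -> `|y - q| < s ->
    `|((x - y) *m A - (F x - F y)) *m invmx A| <= 2^-1 * `|x - y|.
  move=> xs ys; apply: (le_trans (KP _)).
  rewrite -normrN opprB; apply: (le_trans (ler_wpM2l (ltW K0) (sP _ _ xs ys))).
  by rewrite mulrA invfM mulrCA mulfV ?gt_eqF // mulr1.
have explip x y : `|x - q| < s -> `|y - q| < s -> `|x - y| <= 2 * K * `|F x - F y|.
  move=> xs ys; have := contr _ _ xs ys; have := KP (F x - F y).
  have := ler_normD (((x - y) *m A - (F x - F y)) *m invmx A) ((F x - F y) *m invmx A).
  by rewrite -mulmxDl subrK mulmxK //; lra.
have q0 : `|q - q| = 0 by rewrite subrr normr0.
have solve z : `|z - F q| < t / (2 * K) -> exists y, `|y - q| <= t /\ F y = z.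
  move=> zt; pose h y := `|(F y - z) *m invmx A|.
  pose C := [set y | `|y - q| <= t].
  have CE : C = closed_ball q t.
    by rewrite closed_ballE //; apply/seteqP; split=> y; rewrite /C /closed_ball_ /= distrC.
  have Cc : compact C.
    apply: bounded_closed_compact; last by rewrite CE; exact: closed_ball_closed.
    exists (`|q| + t); split=> [|M]; first exact: num_real.
    move=> M1 y yC; rewrite -(subrK q y).
    by rewrite /= (le_trans (ler_normD _ _)) // (le_trans _ (ltW M1)) // addrC lerD2l.
  have hc : {within C, continuous h}.
    apply: continuous_in_subspaceT => y; rewrite inE => yC.
    apply/continuous_normP => e e0.
    have ys : `|y - q| < s by apply: le_lt_trans yC ts.
    exists (Num.min (s - `|y - q|) (e / 2)); first by rewrite lt_min subr_gt0 ys divr_gt0.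
    move=> x; rewrite lt_min => /andP[xy xe].
    have xs : `|x - q| < s.
      rewrite (_ : x - q = (x - y) + (y - q)); last by rewrite addrA subrK.
      by rewrite (le_lt_trans (ler_normD _ _)) // -ltrBrDr.
    have c1 := contr _ _ xs ys.
    rewrite (le_lt_trans (ler_dist_dist _ _)) // -mulmxBl opprB addrA subrK.
    have c2 := ler_normB (x - y) (((x - y) *m A - (F x - F y)) *m invmx A).
    move: c2; rewrite [X in `|_ - X|]mulmxBl mulmxK // subKr.
    lra.
  have Cq : C q by rewrite /C /= q0 ltW.
  have [y Cy ymin] := EVT_min_rV (ex_intro _ q Cq) Cc hc.
  rewrite inE in Cy.
  exists y; split=> //; apply/eqP; rewrite -subr_eq0; apply/negPn/negP => nz.
  have ys : `|y - q| < s by apply: le_lt_trans Cy ts.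
  (* The Newton step. It stays in the ball, [t / 2] coming from the contraction and [t / 2] from the
     distance of [z] to [F q]; its residual is the contraction defect between [y] and [y']. *)
  pose y' := y - (F y - z) *m invmx A.
  have Tq : `|y' - q| <= t.
    have -> : y' - q = ((y - q) *m A - (F y - F q)) *m invmx A + (z - F q) *m invmx A.
      rewrite -mulmxDl /y' -{1}(mulmxK Au y) -{1}(mulmxK Au q) -!mulmxBl; congr (_ *m _).
      rewrite mulmxBl !opprB !addrA; apply/rowP => i; rewrite !mxE; ring.
    rewrite (le_trans (ler_normD _ _)) // (splitr t) lerD //.
      rewrite (le_trans (contr _ _ ys _)) ?q0 // mulrC ler_wpM2r //.
    rewrite (le_trans (KP _)) // mulrC -ler_pdivlMr // (le_trans (ltW zt)) //.
    by rewrite invfM mulrA.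
  have ys' : `|y' - q| < s by apply: le_lt_trans Tq ts.
  have := ymin y'; rewrite inE => /(_ Tq); apply/negP; rewrite -ltNge.
  have -> : h y' = `|((y - y') *m A - (F y - F y')) *m invmx A|.
    rewrite /h; congr (`|_ *m _|).
    rewrite {2}/y' subKr -mulmxA mulVmx // mulmx1.
    by apply/rowP => i; rewrite !mxE; ring.
  apply: (le_lt_trans (contr _ _ ys ys')).
  rewrite {1}/y' subKr -/(h y).
  have h0 : 0 < h y.
    rewrite normr_gt0; apply: contraNneq nz => /(congr1 (mulmxr A)).
    by rewrite /= mulmxKV // mul0mx => ->.
  lra.
pose psi z := xget q [set y | `|y - q| <= t /\ F y = z].
have psiP z : `|z - F q| < t / (2 * K) -> `|psi z - q| <= t /\ F (psi z) = z.
  by move=> /solve yP; exact: (xgetPex q yP).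
have tK : 0 < t / (2 * K) by rewrite divr_gt0 // mulr_gt0.
exists psi; exists (t / (2 * K)) => //; split.
- by move=> z /psiP[h1 h2]; split=> //; apply: le_lt_trans h1 trho.
- move=> z zt; apply/continuous_normP => e e0.
  exists (Num.min (t / (2 * K) - `|z - F q|) (e / (2 * K))).
    by rewrite lt_min subr_gt0 zt divr_gt0 // mulr_gt0.
  move=> x; rewrite lt_min => /andP[xz xe].
  have xt : `|x - F q| < t / (2 * K).
    rewrite (_ : x - F q = (x - z) + (z - F q)); last by rewrite addrA subrK.
    by rewrite (le_lt_trans (ler_normD _ _)) // -ltrBrDr.
  have [xs xF] := psiP _ xt; have [zs zF] := psiP _ zt.
  have := explip _ _ (le_lt_trans xs ts) (le_lt_trans zs ts); rewrite xF zF => H.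
  by rewrite (le_lt_trans H) // mulrC -ltr_pdivlMr // mulr_gt0.
- apply/near_normP.
  have [M M0 MP] := mulmx_norm_le A.
  have L0 : 0 < M + (2 * K)^-1 by rewrite addr_gt0.
  exists (Num.min t (t / (2 * K) / (M + (2 * K)^-1))).
    by rewrite lt_min t0 divr_gt0.
  move=> y; rewrite lt_min => /andP[yt yK].
  have ys := lt_trans yt ts.
  have Fy : `|F y - F q| < t / (2 * K).
    have -> : F y - F q = (y - q) *m A + (F y - F q - (y - q) *m A) by rewrite [RHS]addrC subrK.
    rewrite (le_lt_trans (ler_normD _ _)) //.
    rewrite (@le_lt_trans _ _ (M * `|y - q| + (2 * K)^-1 * `|y - q|)) //.
      by rewrite lerD // sP // q0.
    by rewrite -mulrDl mulrC -ltr_pdivlMr.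
  have [h1 h2] := psiP _ Fy.
  apply/eqP; rewrite -subr_eq0 -normr_le0.
  have := explip _ _ (le_lt_trans h1 ts) ys; rewrite h2 subrr normr0 mulr0 //.
Qed.

End InverseFunction.

(** * Curves with a height function *)

Section Continuity.
Context {R : realType} {E E' : normedModType R}.

Definition cont_on (A : set E) (f : E -> E') := forall x, A x ->
  forall e : R, 0 < e -> exists2 r : R, 0 < r &
  forall y, A y -> `|y - x| < r -> `|f y - f x| < e.

Lemma cont_onP (A : set E) (f : E -> E') :
  cont_on A f <-> {within A, continuous f}.
Proof.
rewrite subspace_continuousP; split=> [fc x xA|fc x xA e e0].
- apply/cvgrPdist_lt => e e0; have [r r0 rP] := fc _ xA _ e0.
  apply: (proj2 (@near_normP R E x (fun y => A y -> `|f x - f y| < e))).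
  by exists r => // y yx yA; rewrite distrC; apply: rP.
- have /cvgrPdist_lt/(_ _ e0) := fc x xA.
  move=> /(proj1 (@near_normP R E x (fun y => A y -> `|f x - f y| < e))).
  by move=> [r r0 rP]; exists r => // y yA yx; rewrite distrC; apply: rP.
Qed.

Lemma cont_onS (A B : set E) (f : E -> E') : A `<=` B -> cont_on B f -> cont_on A f.
Proof.
move=> AB fc x xA e e0; have [r r0 rP] := fc x (AB _ xA) e e0.
by exists r => // y yA; apply: rP; apply: AB.
Qed.

(** The two local conditions make the predicate relatively open and closed. Uniqueness of lifts and
    absorption of connected sets by an edge are both proved in this form. *)
Lemma connected_ind (A : set E) (P : E -> Prop) :
  connected A -> (exists2 x, A x & P x) ->
  (forall x, A x -> P x -> exists2 r : R, 0 < r & forall y, A y -> `|y - x| < r -> P y) ->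
  (forall x, A x -> ~ P x ->
     exists2 r : R, 0 < r & forall y, A y -> `|y - x| < r -> ~ P y) ->
  forall x, A x -> P x.
Proof.
move=> cA [x0 Ax0 Px0] openP openNP.
have aux (Q : E -> Prop) :
    (forall x, A x -> Q x -> exists2 r : R, 0 < r & forall y, A y -> `|y - x| < r -> Q y) ->
    exists2 C, open C & A `&` [set x | Q x] = A `&` C.
  move=> oQ; exists [set z | exists x (r : R), [/\ 0 < r, forall y, A y -> `|y - x| < r -> Q y & `|z - x| < r]].
    rewrite openE => z [x [r [r0 rQ zx]]]; apply/near_normP.
    exists (r - `|z - x|); first by rewrite subr_gt0.
    move=> y yz; exists x, r; split=> //.
    rewrite (_ : y - x = (y - z) + (z - x)); last by rewrite addrA subrK.
    by rewrite (le_lt_trans (ler_normD _ _)) // -ltrBrDr.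
  apply/seteqP; split=> x [Ax] => [Qx|[z [r [r0 rQ xz]]]]; split=> //.
    have [r r0 rQ] := oQ _ Ax Qx.
    by exists x, r; split=> //; rewrite subrr normr0.
  exact: rQ.
have [C Co CE] := aux _ openP; have [C' C'o C'E] := aux (fun x => ~ P x) openNP.
have <- // : A `&` [set x | P x] = A.
  apply: cA; first by exists x0.
    by exists C.
  exists (~` C'); first by rewrite closedC.
  apply/seteqP; split=> x [Ax].
    move=> Px; split=> // C'x; have : (A `&` C') x by [].
    by rewrite -C'E => -[].
  move=> nC'x; split=> //; apply: contrapT => nPx; apply: nC'x.
  by have [] : (A `&` C') x by rewrite -C'E; split.
by move=> x [].
Qed.

End Continuity.

(** * Lifting the height interval to arcs of the curve *)

Section Graph.
Context {R : realType} {E : normedModType R}.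
Variables (X V : set E).
Hypothesis Xc : compact X.
Hypothesis Vfin : finite_set V.
Hypothesis VX : V `<=` X.

(* [h] is a local coordinate of the curve [X] at [q]. *)
Definition regular_chart (h : E -> R) (q : E) := exists2 e : R, 0 < e &
  exists c : R -> E,
  [/\ cont_on [set x | `|x - h q| < e] c,
      forall x, `|x - h q| < e -> X (c x) /\ h (c x) = x &
      exists2 r : R, 0 < r & forall y, X y -> `|y - q| < r -> c (h y) = y].

(** [V] plays the role of the vertex set, off which [h] must be a local coordinate. Boundedness of
    [h] keeps the domains of lifts bounded. *)
Definition height (h : E -> R) := [/\ cont_on X h, forall x, X x -> `|h x| <= 1 &
  forall q, X q -> ~ V q -> regular_chart h q].

(** An arc off the vertices, parametrized by its own height: a continuous section of [h] over
    [I]. *)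
Definition hlift (h : E -> R) (I : set R) (g : R -> E) :=
  cont_on I g /\ forall x, I x -> [/\ X (g x), ~ V (g x) & h (g x) = x].

Definition oitv (u v : R) : set R := [set x | u < x < v].
Definition citv (u v : R) : set R := [set x | u <= x <= v].

Lemma connected_oitv u v : connected (oitv u v).
Proof.
apply/connected_intervalP => x y /= /andP[ux xv] /andP[uy yv] z /andP[xz zy].
by rewrite /oitv /= (lt_le_trans ux) // (le_lt_trans zy).
Qed.

Lemma connected_image (I : set R) (g : R -> E) :
  connected I -> cont_on I g -> connected (g @` I).
Proof. by move=> cI /cont_onP; exact: connected_continuous_connected. Qed.

Lemma finite_gap (v : E) : exists2 r : R, 0 < r & forall w, V w -> `|w - v| < r -> w = v.
Proof.
have /(finite_setD [set v]) : finite_set (V `\` [set v]) by apply: finite_setD.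
have fs : finite_set (V `\` [set v]) by apply: finite_setD.
have cs : closed (V `\` [set v]).
  by apply: compact_closed => //; exact: finite_compact.
have : (~` (V `\` [set v])) v by move=> [_]; apply.
have : open (~` (V `\` [set v])) by rewrite openC.
rewrite openE => /(_ v) /[apply] /near_normP[r r0 rP] _.
exists r => // w Vw wv; apply: contrapT => nwv.
by have := rP _ wv; apply.
Qed.

Lemma finite_away (q : E) : ~ V q -> exists2 r : R, 0 < r & forall w, `|w - q| < r -> ~ V w.
Proof.
move=> nVq; have [r r0 rP] := finite_gap q; exists r => // w wq Vw.
by apply: nVq; rewrite -(rP _ Vw wq).
Qed.

Lemma regular_lift h q : height h -> X q -> ~ V q -> exists2 e : R, 0 < e &
  exists c, [/\ hlift h (oitv (h q - e) (h q + e)) c, c (h q) = q &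
    exists2 r : R, 0 < r & forall y, X y -> `|y - q| < r -> c (h y) = y].
Proof.
move=> [_ _ hch] Xq nVq; have [e e0 [c [cc cP [r r0 rP]]]] := hch _ Xq nVq.
have cq : c (h q) = q by apply: rP => //; rewrite subrr normr0.
have [s s0 sP] := finite_away nVq.
have hq : `|h q - h q| < e by rewrite subrr normr0.
have [t t0 tP] := cc _ hq s s0.
have m0 : 0 < Num.min e t by rewrite lt_min e0.
have inm x : oitv (h q - Num.min e t) (h q + Num.min e t) x -> `|x - h q| < e /\ `|x - h q| < t.
  by rewrite /oitv /= -ltr_distl lt_min => /andP[].
exists (Num.min e t) => //; exists c; split=> //; last by exists r.
split.
  by apply: cont_onS cc => x /inm[].
move=> x /inm[xe xt]; have [h1 h2] := cP _ xe; split=> //.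
by apply: sP; have := tP _ xe xt; rewrite cq.
Qed.

(** Agreement is open because a chart recovers a point from its height, and disagreement is open by
    continuity. *)
Lemma lift_unique h (I : set R) g1 g2 x0 : height h -> connected I ->
  hlift h I g1 -> hlift h I g2 -> I x0 -> g1 x0 = g2 x0 ->
  forall x, I x -> g1 x = g2 x.
Proof.
move=> hh cI [g1c g1P] [g2c g2P] Ix0 e0.
apply: (connected_ind (P := fun x => g1 x = g2 x) cI).
- by exists x0.
- move=> x Ix gx; have [X1 nV1 h1] := g1P _ Ix.
  have [e _ [c [_ _ [r r0 rP]]]] := regular_lift hh X1 nV1.
  have [s s0 sP] := g1c _ Ix _ r0; have [t t0 tP] := g2c _ Ix _ r0.
  exists (Num.min s t); first by rewrite lt_min s0.
  move=> y Iy; rewrite lt_min => /andP[ys yt].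
  have [X1y _ h1y] := g1P _ Iy; have [X2y _ h2y] := g2P _ Iy.
  rewrite -(rP _ X1y (sP _ Iy ys)) h1y -[RHS](rP _ X2y) ?h2y //.
  by rewrite gx; apply: tP.
- move=> x Ix gx; pose d := `|g1 x - g2 x| / 2.
  have d0 : 0 < d by rewrite divr_gt0 // normr_gt0 subr_eq0; exact/eqP.
  have [s s0 sP] := g1c _ Ix _ d0; have [t t0 tP] := g2c _ Ix _ d0.
  exists (Num.min s t); first by rewrite lt_min s0.
  move=> y Iy; rewrite lt_min => /andP[ys yt] gy.
  have := ler_normD (g1 x - g1 y) (g2 y - g2 x); rewrite gy addrA subrK -{1}gy.
  have := sP _ Iy ys; have := tP _ Iy yt; rewrite gy (distrC (g2 y) (g1 x)) /d; lra.
Qed.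

(** Let the height tend to [v]. A cluster point of the arc outside [V] has a chart that prolongs the
    lift. Otherwise all cluster points lie in the finite set [V], and the arc converges to one of
    them: moving away and back infinitely often, it would cross a small sphere that misses [V] and
    accumulate on it. *)
Lemma lift_right_end h g u v : height h -> u < v -> hlift h (oitv u v) g ->
  (exists2 w, V w & forall e : R, 0 < e -> exists2 x0 : R, x0 < v &
     forall x, u < x < v -> x0 < x -> `|g x - w| < e) \/
  (exists v' g', [/\ v < v', hlift h (oitv u v') g' & forall x, oitv u v x -> g' x = g x]).
Proof.
move=> hh uv [gc gP].
(* The filter of left neighbourhoods of [v] inside the interval. *)
pose F := within (oitv u v) (nbhs v).
have FF (A : set R) : F A <-> exists2 x0 : R, x0 < v & forall x, u < x < v -> x0 < x -> A x.
  rewrite /F /within /=; split.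
    move=> /near_normP[r r0 rP]; exists (v - r); first by rewrite ltrBlDr ltrDl.
    move=> x /andP[ux xv] rx; apply: rP => //; last by rewrite /oitv /= ux.
    by rewrite distrC gtr0_norm ?subr_gt0 // ltrBlDr -ltrBlDl.
  move=> [x0 x0v xP]; apply: (proj2 (@near_normP R _ v (fun x => oitv u v x -> A x))).
  exists (v - x0); first by rewrite subr_gt0.
  move=> x xv1 /andP[ux xv]; apply: xP; first by rewrite ux.
  by move: xv1; rewrite distrC gtr0_norm ?subr_gt0 // ltrD2l ltrN2.
have Fp : ProperFilter F.
  apply: Build_ProperFilter.
  move=> /FF[x0 x0v xP].
  pose m := Num.max u x0; have mv : m < v by rewrite gt_max uv.
  have mm : m < (m + v) / 2 < v by rewrite ltr_pdivlMr // ltr_pdivrMr //; lra.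
  case/andP: mm => mm1 mm2; apply: (xP ((m + v) / 2)).
    by rewrite mm2 (le_lt_trans _ mm1) // le_max lexx.
  by rewrite (le_lt_trans _ mm1) // le_max lexx orbT.
have clusterP (G : set_system R) w : ProperFilter G -> F `<=` G -> X w -> cluster (g @ G) w ->
    forall (e : R) x0, 0 < e -> x0 < v -> exists x, [/\ u < x < v, x0 < x & `|g x - w| < e].
  move=> PG FG Xw cw e x0 e0 x0v.
  have := cw [set y | exists x, [/\ u < x < v, x0 < x & y = g x]] [set y | `|y - w| < e].
  case.
  - apply: FG; apply/FF; exists x0 => // x uxv x0x; by exists x.
  - by apply/near_normP; exists e.
  - by move=> y [[x [h1 h2 ->]] h3]; exists x.
have hcl (G : set_system R) w : ProperFilter G -> F `<=` G -> X w -> cluster (g @ G) w -> h w = v.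
  move=> PG FG Xw cw; have cP := clusterP G w PG FG Xw cw.
  apply/eqP; rewrite -subr_eq0 -normr_le0; apply/ler_addgt0Pl => e e0; rewrite addr0.
  have e20 : 0 < e / 2 by rewrite divr_gt0.
  case: hh => hc _ _; have [r r0 rP] := hc _ Xw _ e20.
  have [x [uxv xe xw]] := cP r (v - e / 2) r0 (ltac:(by rewrite ltrBlDr ltrDl)).
  have [Xg _ hg] := gP _ uxv.
  have := rP _ Xg xw; rewrite hg => H.
  rewrite (_ : h w - v = (h w - x) + (x - v)); last by rewrite addrA subrK.
  rewrite (le_trans (ler_normD _ _)) // (splitr e) lerD //; first by rewrite distrC ltW.
  by case/andP: uxv => _ xv; rewrite ltr0_norm ?subr_lt0 // opprB; lra.
have FX : (g @ F) X.
  by apply/FF; exists u => // x uxv _; have [] := gP _ uxv.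
have [[w [Xw [cw nVw]]]|allV] := pselect (exists w, X w /\ cluster (g @ F) w /\ ~ V w).
  right; have hw := hcl F w Fp (fun _ => id) Xw cw.
  have [e e0 [c [cl cw' [r r0 rP]]]] := regular_lift hh Xw nVw.
  rewrite hw in cl cw'.
  have [x [uxv xe xw]] := clusterP F w Fp (fun _ => id) Xw cw r (v - e) r0 (ltac:(by rewrite ltrBlDr ltrDl)).
  have [Xg nVg hg] := gP _ uxv.
  have cg : c x = g x by rewrite -{1}hg; apply: rP.
  case/andP: (uxv) => ux xv.
  pose m := Num.max u (v - e).
  have mv : m < v by rewrite gt_max uv ltrBlDr ltrDl.
  have agree y : m < y < v -> c y = g y.
    apply: (@lift_unique h (oitv m v) c g x) => //.
    - exact: connected_oitv.
    - case: cl => cc cP; split; first apply: cont_onS cc => z.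
        by rewrite /oitv /m /= gt_max => /andP[/andP[_ ->] zv] /=; rewrite (lt_trans zv) // ltrDl.
      move=> z zI; apply: cP; move: zI.
      by rewrite /oitv /m /= gt_max => /andP[/andP[_ ->] zv] /=; rewrite (lt_trans zv) // ltrDl.
    - split; first apply: cont_onS gc => z.
        by rewrite /oitv /m /= gt_max => /andP[/andP[-> _] ->].
      move=> z zI; apply: gP; move: zI.
      by rewrite /oitv /m /= gt_max => /andP[/andP[-> _] ->].
    - by rewrite /oitv /m /= gt_max ux xe.
  (* The old lift and the chart agree on an interval ending at [v], by uniqueness from the common
     point over [x], so they can be glued at [v]. *)
  exists (v + e), (fun y => if y < v then g y else c y); split.
  - by rewrite ltrDl.
  - case: cl => cc cP.
    have cE y : m < y -> (if y < v then g y else c y) = c y.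
      by move=> my; case: ltP => // yv; rewrite agree // my.
    split=> [y /andP[uy ye] d d0|y /andP[uy ye]].
      have [yv|vy] := ltP y v.
        have yI : oitv u v y by rewrite /oitv /= uy.
        have [s s0 sP] := gc _ yI _ d0.
        exists (Num.min s (v - y)); first by rewrite lt_min s0 subr_gt0.
        move=> z /andP[uz ze]; rewrite lt_min => /andP[zs zv].
        have zv' : z < v by move: zv; rewrite ltr_distl; lra.
        by rewrite zv'; apply: sP => //; rewrite /oitv /= uz.
      have my : m < y by apply: lt_le_trans vy.
      have yI : oitv (v - e) (v + e) y.
        by rewrite /oitv /= ye (le_lt_trans _ my) // /m le_max lexx orbT.
      have [s s0 sP] := cc _ yI _ d0.
      exists (Num.min s (y - m)); first by rewrite lt_min s0 subr_gt0.
      move=> z /andP[uz ze]; rewrite lt_min => /andP[zs zv].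
      have mz : m < z by move: zv; rewrite ltr_distl; lra.
      rewrite cE //; apply: sP => //.
      by rewrite /oitv /= ze (le_lt_trans _ mz) // /m le_max lexx orbT.
    have [yv|vy] := ltP y v; first by apply: gP; rewrite /oitv /= uy.
    apply: cP; rewrite /oitv /= ye (lt_le_trans _ vy) // ltrBlDr ltrDl //.
  - by move=> y /andP[_ ->].
left.
have [w [Xw cw]] := Xc (fmap_proper_filter g Fp) FX.
have clV (G : set_system R) w' : ProperFilter G -> F `<=` G -> X w' -> cluster (g @ G) w' -> V w'.
  move=> PG FG Xw' cw'; apply: contrapT => nVw'; apply: allV; exists w'; split=> //; split=> //.
  by move=> A B FA; apply: cw'; apply: FG.
have Vw := clV F w Fp (fun _ => id) Xw cw.
exists w => // e e0.
have [rho rho0 rhoP] := finite_gap w.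
(* The sphere of radius [d] about [w] misses [V] since [d] is below the gap [rho]. *)
pose d := Num.min e rho / 2.
have d0 : 0 < d by rewrite divr_gt0 // lt_min e0.
have de : d < e.
  by rewrite /d ltr_pdivrMr // mulr_natr mulr2n (@le_lt_trans _ _ e) ?ge_min ?lexx // ltrDl.
have drho : d < rho.
  by rewrite /d ltr_pdivrMr // mulr_natr mulr2n (@le_lt_trans _ _ rho) ?ge_min ?lexx ?orbT // ltrDl.
apply: contrapT => nlim.
(* The arc is closer to [w] than [d] and farther than [e] at heights arbitrarily close to [v]; the
   intermediate value theorem puts it on the sphere in between. *)
have freq x0 : x0 < v -> exists x, [/\ u < x < v, x0 < x & `|g x - w| = d].
  move=> x0v.
  have [x1 [ux1 x01 gx1]] := clusterP F w Fp (fun _ => id) Xw cw d x0 d0 x0v.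
  have [x2 [ux2 x12 gx2]] : exists x, [/\ u < x < v, x1 < x & e <= `|g x - w|].
    apply: contrapT => nx; apply: nlim; exists x1; first by case/andP: ux1.
    move=> x uxv x1x; rewrite ltNge; apply/negP => ge; apply: nx; exists x; split=> //.
  have cc : {within `[x1, x2], continuous (fun x => `|g x - w|)}.
    apply/cont_onP => x; rewrite /= in_itv /= => xI t t0.
    have xuv z : x1 <= z <= x2 -> oitv u v z.
      move=> /andP[z1 z2]; case/andP: ux1 => ux1 _; case/andP: ux2 => _ ux2.
      by rewrite /oitv /= (lt_le_trans ux1) // (le_lt_trans z2).
    have [s s0 sP] := gc _ (xuv _ xI) _ t0; exists s => // y; rewrite in_itv /= => yI yx.
    rewrite (le_lt_trans (ler_dist_dist _ _)) // opprB addrA subrK.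
    by apply: sP => //; apply: xuv.
  have [|x] := @IVT R _ x1 x2 d (ltW x12) cc.
    rewrite ge_min le_max (ltW gx1) /=; apply/orP; right.
    by rewrite (le_trans (ltW de)).
  rewrite in_itv /= => /andP[h1 h2] gx; exists x; split=> //.
    case/andP: ux1 => ux1 _; case/andP: ux2 => _ ux2.
    by rewrite (lt_le_trans ux1) // (le_lt_trans h2).
  exact: lt_le_trans h1.
(* Restricting the filter to the heights where the arc is on the sphere forces a cluster point
   there. *)
pose G := within [set x | `|g x - w| = d] F.
have FG : F `<=` G by move=> A; apply: cvg_within.
have Gp : ProperFilter G.
  apply: Build_ProperFilter.
  by move=> /FF[x0 x0v xP]; have [x [h1 h2 h3]] := freq _ x0v; exact: (xP x).
have GX : (g @ G) X by apply: FG.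
have [w' [Xw' cw']] := Xc (fmap_proper_filter g Gp) GX.
have Vw' := clV G w' Gp FG Xw' cw'.
have ww' : `|w' - w| = d.
  apply/eqP; rewrite -subr_eq0 -normr_le0; apply/ler_addgt0Pl => t t0; rewrite addr0.
  have [y [/= yd yw']] : [set y | `|y - w| = d] `&` [set y | `|y - w'| < t] !=set0.
    apply: cw'; last by apply/near_normP; exists t.
    by rewrite /= /G /within /=; apply/FF; exists u.
  rewrite -yd (le_trans (ler_dist_dist _ _)) // opprB addrA subrK distrC ltW //.
have : w' = w by apply: rhoP => //; rewrite ww'.
by move=> ww; move: ww'; rewrite ww subrr normr0 => /esym/eqP; rewrite gt_eqF.
Qed.

Lemma height_opp h : height h -> height (fun x => - h x).
Proof.
move=> [hc hb hch]; split=> [x Xx e e0|x Xx|q Xq nVq].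
- have [r r0 rP] := hc _ Xx _ e0; exists r => // y Xy yx.
  by rewrite -opprD normrN; apply: rP.
- by rewrite normrN; apply: hb.
- have [e e0 [c [cc cP [r r0 rP]]]] := hch _ Xq nVq.
  have sgn x : `|x - - h q| < e -> `|- x - h q| < e by rewrite -normrN opprB addrC.
  exists e => //; exists (fun x => c (- x)); split.
  + move=> x /= xe d d0; have [s s0 sP] := cc _ (sgn _ xe) _ d0.
    exists s => // y ye yx; apply: sP; first exact: sgn.
    by rewrite -opprD normrN.
  + by move=> x /sgn/cP[h1 h2]; rewrite h2 opprK.
  + by exists r => // y Xy yq; rewrite opprK; apply: rP.
Qed.

Lemma lift_opp h g u v : hlift h (oitv u v) g ->
  hlift (fun x => - h x) (oitv (- v) (- u)) (fun x => g (- x)).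
Proof.
have sgn x : oitv (- v) (- u) x -> oitv u v (- x).
  by rewrite /oitv /= ltrNl ltrNr => /andP[-> ->].
move=> [gc gP]; split=> [x xI e e0|x xI].
  have [r r0 rP] := gc _ (sgn _ xI) _ e0; exists r => // y yI yx.
  by apply: rP; [exact: sgn|rewrite -opprD normrN].
by have [h1 h2 h3] := gP _ (sgn _ xI); split=> //; rewrite h3 opprK.
Qed.

Lemma lift_left_end h g u v : height h -> u < v -> hlift h (oitv u v) g ->
  (exists2 w, V w & forall e : R, 0 < e -> exists2 x0 : R, u < x0 &
     forall x, u < x < v -> x < x0 -> `|g x - w| < e) \/
  (exists u' g', [/\ u' < u, hlift h (oitv u' v) g' & forall x, oitv u v x -> g' x = g x]).
Proof.
move=> hh uv gl; have uv' : - v < - u by rewrite ltrN2.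
have [[w Vw wP]|[v' [g' [vv' gl' gg']]]] := lift_right_end (height_opp hh) uv' (lift_opp gl).
  left; exists w => // e e0; have [x0 x0u xP] := wP _ e0.
  exists (- x0); first by rewrite ltrNr.
  move=> x /andP[ux xv] xx0; rewrite -(opprK x); apply: xP; first by rewrite !ltrN2 xv.
  by rewrite ltrNr.
right; exists (- v'), (fun x => g' (- x)); split; first by rewrite ltrNl.
  have := lift_opp gl'; rewrite opprK /hlift.
  by under [X in _ /\ (forall x, _ -> [/\ _, _ & X x = _])]eq_fun do rewrite opprK.
by move=> x /andP[ux xv]; rewrite gg' ?opprK // /oitv /= !ltrN2 xv.
Qed.

Definition iedge (h : E -> R) (g : R -> E) (u v : R) :=
  [/\ u < v, hlift h (oitv u v) g, cont_on (citv u v) g, V (g u) & V (g v)].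

Lemma iedge_ends h g u v : height h -> iedge h g u v -> h (g u) = u /\ h (g v) = v.
Proof.
move=> [hc _ _] [uv [gc gP] gcc Vu Vv].
have lim z : citv u v z -> (forall s : R, 0 < s -> exists2 x, oitv u v x & `|x - z| < s) ->
    h (g z) = z.
  move=> zI zP; have Xz : X (g z).
    have [z_in|z_out] := pselect (oitv u v z); first by have [] := gP _ z_in.
    have : z = u \/ z = v.
      case/andP: zI; rewrite le_eqVlt => /orP[/eqP->|uz]; first by left.
      rewrite le_eqVlt => /orP[/eqP->|zv]; first by right.
      by case: z_out; rewrite /oitv /= uz.
    by case=> ->; exact: VX.
  apply/eqP; rewrite -subr_eq0 -normr_le0; apply/ler_addgt0Pl => e e0; rewrite addr0.
  have e20 : 0 < e / 2 by rewrite divr_gt0.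
  have [r r0 rP] := hc _ Xz _ e20; have [s s0 sP] := gcc _ zI _ r0.
  have m0 : 0 < Num.min s (e / 2) by rewrite lt_min s0.
  have [x xI] := zP _ m0; rewrite lt_min => /andP[xs xe].
  have [Xg _ hg] := gP _ xI.
  have xI' : citv u v x by case/andP: xI => /ltW ux /ltW xv; rewrite /citv /= ux.
  have := rP _ Xg (sP _ xI' xs); rewrite hg => H.
  rewrite (_ : h (g z) - z = (h (g z) - x) + (x - z)); last by rewrite addrA subrK.
  by rewrite (le_trans (ler_normD _ _)) // (splitr e) lerD // ltW // distrC.
have mid (s : R) : 0 < s -> exists d, [/\ 0 < d, d < s & d < v - u].
  move=> s0; exists (Num.min s (v - u) / 2).
  have m0 : 0 < Num.min s (v - u) by rewrite lt_min s0 subr_gt0.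
  have : Num.min s (v - u) / 2 < Num.min s (v - u) by rewrite ltr_pdivrMr // ltr_pMr // ltr1n.
  by move=> md; move: (md); rewrite lt_min => /andP[-> ->]; rewrite divr_gt0.
split; apply: lim.
- by rewrite /citv /= lexx ltW.
- move=> s /mid[d [d0 ds duv]]; exists (u + d).
    by rewrite /oitv /= ltrDl d0 addrC -ltrBrDr.
  by rewrite addrC addKr gtr0_norm.
- by rewrite /citv /= lexx ltW.
- move=> s /mid[d [d0 ds duv]]; exists (v - d).
    by rewrite /oitv /= ltrBlDr ltrDl d0 ltrBrDr -ltrBrDl duv.
  by rewrite addrC addrA addNr add0r normrN gtr0_norm.
Qed.

(** All lifts through [q] agree where they overlap, so they glue to a maximal one over the interval
    from [inf D] to [sup D]. Neither end can be prolonged, hence the arc converges to a vertex at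
    both. *)
Lemma iedge_exists h q : height h -> X q -> ~ V q ->
  exists g u v, [/\ iedge h g u v, u < h q < v & g (h q) = q].
Proof.
move=> hh Xq nVq.
pose P a b g := [/\ a < h q < b, hlift h (oitv a b) g & g (h q) = q].
pose D := [set x | exists a b g, P a b g /\ a < x < b].
have Puniq a b g a' b' g' x : P a b g -> P a' b' g' -> a < x < b -> a' < x < b' -> g x = g' x.
  move=> [q1 l1 e1] [q2 l2 e2] /andP[ax xb] /andP[a'x xb'].
  have sub1 : oitv (Num.max a a') (Num.min b b') `<=` oitv a b.
    by move=> z; rewrite /oitv /= gt_max lt_min => /andP[/andP[-> _] /andP[->]].
  have sub2 : oitv (Num.max a a') (Num.min b b') `<=` oitv a' b'.
    by move=> z; rewrite /oitv /= gt_max lt_min => /andP[/andP[_ ->] /andP[_ ->]].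
  case: l1 => l1c l1P; case: l2 => l2c l2P.
  apply: (@lift_unique h (oitv (Num.max a a') (Num.min b b')) g g' (h q)) => //.
  - exact: connected_oitv.
  - by split; [apply: cont_onS l1c|move=> z /sub1; apply: l1P].
  - by split; [apply: cont_onS l2c|move=> z /sub2; apply: l2P].
  - case/andP: q1 => ? ?; case/andP: q2 => ? ?; rewrite /oitv /= gt_max lt_min; apply/andP; split; apply/andP; split => //.
  - by rewrite e1 e2.
  - by rewrite /oitv /= gt_max lt_min ax a'x xb xb'.
have Db x : D x -> `|x| <= 1.
  move=> [a [b [g [[_ [_ gP] _] xI]]]]; have [Xg _ <-] := gP _ xI.
  by case: hh => _ hb _; apply: hb.
have [e e0 [c [cl cq _]]] := regular_lift hh Xq nVq.
have P0 : P (h q - e) (h q + e) c.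
  by split=> //; rewrite ltrBlDr ltrDl e0.
have Dq : D (h q) by exists (h q - e), (h q + e), c; split=> //; case: P0.
have supD : has_sup D.
  by split; [exists (h q)|exists 1 => x /Db; rewrite ler_norml => /andP[]].
have infD : has_inf D.
  by split; [exists (h q)|exists (-1) => x /Db; rewrite ler_norml => /andP[]].
pose v := sup D; pose u := inf D.
have supP x : x < v -> exists2 y, D y & x < y by move=> /(sup_gt supD.1).
have infP x : u < x -> exists2 y, D y & y < x by move=> /(inf_lt infD.1).
have Dv x : D x -> x < v.
  move=> [a [b [g [Pg /andP[ax xb]]]]].
  have m1 : x < (x + b) / 2 < b by rewrite ltr_pdivlMr // ltr_pdivrMr //; lra.
  case/andP: m1 => m1 m2; apply: (lt_le_trans m1); apply: (sup_upper_bound supD).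
  by exists a, b, g; split=> //; rewrite m2 (lt_trans ax).
have Du x : D x -> u < x.
  move=> [a [b [g [Pg /andP[ax xb]]]]].
  have m1 : a < (a + x) / 2 < x by rewrite ltr_pdivlMr // ltr_pdivrMr //; lra.
  case/andP: m1 => m1 m2; apply: (le_lt_trans _ m2); apply: (ge_inf infD.2).
  by exists a, b, g; split=> //; rewrite m1 (lt_trans m2).
have qI : u < h q < v by rewrite Du // Dv.
have DI x : u < x < v -> D x.
  move=> /andP[ux xv]; have [xq|qx] := leP x (h q).
    have [y [a [b [g [Pg /andP[ay yb]]]]] yx] := infP _ ux.
    exists a, b, g; split=> //; rewrite (lt_trans ay) //=.
    by case: Pg => /andP[_ qb] _ _; apply: le_lt_trans qb.
  have [y [a [b [g [Pg /andP[ay yb]]]]] xy] := supP _ xv.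
  exists a, b, g; split=> //; rewrite (lt_trans xy yb) andbT.
  by case: Pg => /andP[aq _] _ _; apply: lt_trans qx.
pose G x := xget q [set w | exists a b g, [/\ P a b g, a < x < b & g x = w]].
have GP a b g x : P a b g -> a < x < b -> G x = g x.
  move=> Pg xI.
  have : [set w | exists a b g, [/\ P a b g, a < x < b & g x = w]] (G x).
    by apply: xgetPex; exists (g x), a, b, g.
  by move=> [a' [b' [g' [Pg' xI' <-]]]]; apply: (Puniq _ _ _ _ _ _ _ Pg' Pg).
have Gl : hlift h (oitv u v) G.
  split=> [x xI d d0|x xI]; have [a [b [g [Pg xab]]]] := DI _ xI; case: (Pg) => _ [gc gP] _.
    have [r r0 rP] := gc _ xab _ d0; case/andP: (xab) => ax xb.
    exists (Num.min r (Num.min (x - a) (b - x))); first by rewrite !lt_min r0 !subr_gt0 ax.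
    move=> y _; rewrite !lt_min => /andP[yr /andP[ya yb]].
    have yI : a < y < b by move: ya yb; rewrite !ltr_distl => /andP[? _] /andP[_ ?]; lra.
    by rewrite (GP _ _ _ _ Pg yI) (GP _ _ _ _ Pg xab); apply: rP.
  by rewrite (GP _ _ _ _ Pg xab); apply: gP.
have Gq : G (h q) = q by rewrite (GP _ _ _ _ P0) //; case: P0.
have uv : u < v by case/andP: qI; exact: lt_trans.
have [[wv Vwv limv]|[v' [g' [vv' gl' gg']]]] := lift_right_end hh uv Gl; last first.
  have : D ((v + v') / 2).
    have m1 : v < (v + v') / 2 < v' by rewrite ltr_pdivlMr // ltr_pdivrMr //; lra.
    case/andP: m1 => m1 m2; exists u, v', g'; rewrite m2 (lt_trans uv) //; split=> //.
    split=> //; last by rewrite gg'.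
    by case/andP: qI => -> qv; rewrite (lt_trans qv).
  by move=> /Dv; rewrite ltr_pdivrMr //; lra.
have [[wu Vwu limu]|[u' [g' [uu' gl' gg']]]] := lift_left_end hh uv Gl; last first.
  have : D ((u + u') / 2).
    have m1 : u' < (u + u') / 2 < u by rewrite ltr_pdivlMr // ltr_pdivrMr //; lra.
    case/andP: m1 => m1 m2; exists u', v, g'; rewrite m1 (lt_trans m2) //; split=> //.
    split=> //; last by rewrite gg'.
    by case/andP: qI => uq ->; rewrite (lt_trans uu').
  by move=> /Du; rewrite ltr_pdivlMr //; lra.
(* Closing up the maximal lift by its two limits. *)
pose g x := if x == u then wu else if x == v then wv else G x.
have gE x : oitv u v x -> g x = G x.
  by move=> /andP[ux xv]; rewrite /g gt_eqF // lt_eqF.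
have gu : g u = wu by rewrite /g eqxx.
have gv : g v = wv by rewrite /g eqxx (gt_eqF uv).
have cI x : citv u v x -> [\/ x = u, x = v | oitv u v x].
  rewrite /citv /oitv /= => /andP[]; rewrite le_eqVlt => /orP[/eqP->|ux]; first by constructor 1.
  by rewrite le_eqVlt => /orP[/eqP->|xv]; [constructor 2|constructor 3; rewrite ux].
exists g, u, v; split=> //; last by rewrite gE.
split=> //; rewrite ?gu ?gv //.
  case: Gl => Gc Gp; split=> [x xI d d0|x xI].
    by have [r r0 rP] := Gc _ xI _ d0; exists r => // y yI yx; rewrite !gE //; apply: rP.
  by rewrite gE //; apply: Gp.
move=> x /cI xI d d0; case: xI => [->|->|xI].
- have [x0 ux0 xP] := limu _ d0.
  exists (Num.min (x0 - u) (v - u)); first by rewrite lt_min !subr_gt0 ux0.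
  move=> y /cI[->|->|yI]; rewrite lt_min => /andP[y0 yv].
  + by rewrite subrr normr0.
  + by move: yv; rewrite gtr0_norm ?ltxx // subr_gt0.
  + rewrite gu gE //; apply: xP => //; case/andP: yI => uy _.
    by move: y0; rewrite gtr0_norm ?subr_gt0 // ltrD2r.
- have [x0 x0v xP] := limv _ d0.
  exists (Num.min (v - x0) (v - u)); first by rewrite lt_min !subr_gt0 x0v.
  move=> y /cI[->|->|yI]; rewrite lt_min => /andP[y0 yv].
  + by move: yv; rewrite ltr0_norm ?subr_lt0 // opprB ltxx.
  + by rewrite subrr normr0.
  + rewrite gv gE //; apply: xP => //; case/andP: yI => _ yv'.
    by move: y0; rewrite ltr0_norm ?subr_lt0 // opprB ltrD2l ltrN2.
- case: Gl => Gc _; have [r r0 rP] := Gc _ xI _ d0; case/andP: (xI) => ux xv.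
  exists (Num.min r (Num.min (x - u) (v - x))); first by rewrite !lt_min r0 !subr_gt0 ux.
  move=> y _; rewrite !lt_min => /andP[yr /andP[ya yb]].
  have yI : oitv u v y.
    by rewrite /oitv /=; move: ya yb; rewrite !ltr_distl => /andP[? _] /andP[_ ?]; lra.
  by rewrite !gE //; apply: rP.
Qed.

(** The open arc is relatively open and closed in the complement of [V]: being on it is open by the
    charts, and a limit of its points is a point of the closed arc, whose ends are in [V]. *)
Lemma iedge_absorbs h g u v (A : set E) x : height h -> iedge h g u v ->
  connected A -> A `<=` X `\` V -> A x -> (g @` oitv u v) x ->
  forall y, A y -> oitv u v (h y) /\ g (h y) = y.
Proof.
move=> hh ge cA AXV Ax [x0 x0I gx0]; case: (ge) => uv [gc gP] gcc Vu Vv.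
case: (hh) => hc _ _.
apply: (connected_ind (P := fun y => oitv u v (h y) /\ g (h y) = y) cA).
- by exists x => //; rewrite -gx0; have [_ _ ->] := gP _ x0I.
- move=> y Ay [hyI gy]; have [Xy nVy] := AXV _ Ay.
  have [e _ [c [_ _ [r r0 rP]]]] := regular_lift hh Xy nVy.
  have [s s0 sP] := gc _ hyI _ r0; case/andP: (hyI) => uy yv.
  have m0 : 0 < Num.min s (Num.min (h y - u) (v - h y)) by rewrite !lt_min s0 !subr_gt0 uy.
  have [t t0 tP] := hc _ Xy _ m0.
  exists (Num.min t r); first by rewrite lt_min t0.
  move=> z Az; rewrite lt_min => /andP[zt zr]; have [Xz nVz] := AXV _ Az.
  have := tP _ Xz zt; rewrite !lt_min => /andP[h1 /andP[h2 h3]].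
  have hzI : oitv u v (h z).
    by rewrite /oitv /=; move: h2 h3; rewrite !ltr_distl => /andP[? _] /andP[_ ?]; lra.
  split=> //; have [Xg _ hg] := gP _ hzI.
  rewrite -[RHS](rP _ Xz zr) -[LHS](rP _ Xg) ?hg //.
  by rewrite -[in `|_ - y|]gy; apply: sP.
- move=> y Ay nP; have [Xy nVy] := AXV _ Ay.
  have [hyI|hyI] := pselect (citv u v (h y)); last first.
    have [t t0 tP] : exists2 t : R, 0 < t & forall z, `|z - h y| < t -> ~ oitv u v z.
      have [hu|uh] := ltP (h y) u.
        exists (u - h y); first by rewrite subr_gt0.
        by move=> z; rewrite ltr_distl => /andP[_ h1] /andP[h2 _]; move: h1 h2; lra.
      exists (h y - v).
        by rewrite subr_gt0 ltNge; apply/negP => hv; apply: hyI; rewrite /citv /= uh.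
      by move=> z; rewrite ltr_distl => /andP[h1 _] /andP[_ h2]; move: h1 h2; lra.
    have [r r0 rP] := hc _ Xy _ t0; exists r => // z Az zy [hz _].
    by have [Xz _] := AXV _ Az; exact: (tP _ (rP _ Xz zy)).
  have ngy : g (h y) <> y.
    move=> gy; apply: nP; split=> //; case/andP: hyI => uh hv.
    rewrite /oitv /= !lt_neqAle uh hv !andbT; apply/andP; split; apply: contra_notN nVy => /eqP E0.
      by rewrite -gy -E0.
    by rewrite -gy E0.
  pose d := `|g (h y) - y| / 2.
  have d0 : 0 < d by rewrite divr_gt0 // normr_gt0 subr_eq0; exact/eqP.
  have [s s0 sP] := gcc _ hyI _ d0; have [t t0 tP] := hc _ Xy _ s0.
  exists (Num.min t d); first by rewrite lt_min t0.
  move=> z Az; rewrite lt_min => /andP[zt zd] [/andP[uz zv] gz]; have [Xz _] := AXV _ Az.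
  have hzI : citv u v (h z) by rewrite /citv /= !ltW.
  have := sP _ hzI (tP _ Xz zt); rewrite gz => H.
  have := ler_normD (g (h y) - z) (z - y); rewrite addrA subrK.
  by move: H zd; rewrite distrC /d; lra.
Qed.

End Graph.

(** * Edges between vertices *)

Section Edges.
Context {R : realType} {E : normedModType R}.
Variables (X V : set E) (h : E -> R).
Hypothesis Xc : compact X.
Hypothesis Vfin : finite_set V.
Hypothesis VX : V `<=` X.
Hypothesis hh : height X V h.

(** [K] is the open arc. Either end may be named first, because the tracer follows arcs with
    increasing or decreasing height. *)
Definition edge (K : set E) (v w : E) := exists g a b,
  [/\ iedge X V h g a b, K = g @` oitv a b & (v = g a /\ w = g b) \/ (v = g b /\ w = g a)].

Lemma edge_sym K v w : edge K v w -> edge K w v.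
Proof.
move=> [g [a [b [ge KE vw]]]]; exists g, a, b; split=> //.
by case: vw => -[-> ->]; [right|left].
Qed.

Lemma edge_vertex K v w : edge K v w -> V v.
Proof. by move=> [g [a [b [[_ _ _ Va Vb] _ [[-> _]|[-> _]]]]]]. Qed.

Lemma edge_sub K v w : edge K v w -> K `<=` X `\` V.
Proof.
by move=> [g [a [b [[_ [_ gP] _ _ _] -> _]]]] _ [x xI <-]; have [] := gP _ xI.
Qed.

(** The Rolle step: an edge is parametrized by its height, so two vertices of equal height are never
    joined. *)
Lemma edge_height_neq K v w : edge K v w -> h v <> h w.
Proof.
move=> [g [a [b [ge _ vw]]]]; have [ha hb] := iedge_ends VX hh ge.
case: ge => ab _ _ _ _ H.
by case: vw H => -[-> ->]; rewrite ha hb => H; move: ab; rewrite H ltxx.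
Qed.

Lemma edge_nonempty K v w : edge K v w -> exists x, K x.
Proof.
move=> [g [a [b [[ab _ _ _ _] -> _]]]].
exists (g ((a + b) / 2)); exists ((a + b) / 2) => //.
by rewrite /oitv /= ltr_pdivlMr // ltr_pdivrMr //; move: ab; lra.
Qed.

Lemma iedge_connected g a b : iedge X V h g a b -> connected (g @` oitv a b).
Proof. by move=> [_ [gc _] _ _ _]; apply: connected_image gc; exact: connected_oitv. Qed.

Lemma iedge_image_sub g a b : iedge X V h g a b -> g @` oitv a b `<=` X `\` V.
Proof. by move=> [_ [_ gP] _ _ _] _ [x xI <-]; have [] := gP _ xI. Qed.

Lemma cont_on_eq_at (D : set R) (f f' : R -> E) x :
  cont_on D f -> cont_on D f' -> D x ->
  (forall r : R, 0 < r -> exists y, [/\ D y, `|y - x| < r & f y = f' y]) -> f x = f' x.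
Proof.
move=> fc fc' Dx H; apply/eqP; rewrite -subr_eq0 -normr_le0.
apply/ler_addgt0Pl => e e0; rewrite addr0.
have e20 : 0 < e / 2 by rewrite divr_gt0.
have [r r0 rP] := fc _ Dx _ e20; have [s s0 sP] := fc' _ Dx _ e20.
have m0 : 0 < Num.min r s by rewrite lt_min r0.
have [y [Dy]] := H _ m0; rewrite lt_min => /andP[yr ys] yE.
rewrite (_ : f x - f' x = (f x - f y) + (f' y - f' x)); last by rewrite yE addrA subrK.
rewrite (le_trans (ler_normD _ _)) // (splitr e) lerD // ltW //; last exact: sP.
by rewrite distrC rP.
Qed.

Lemma near_left_end (a b r : R) : a < b -> 0 < r -> exists y,
  [/\ citv a b y, `|y - a| < r & oitv a b y].
Proof.
move=> ab r0; have m0 : 0 < Num.min r (b - a) by rewrite lt_min r0 subr_gt0.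
have md : Num.min r (b - a) / 2 < Num.min r (b - a) by rewrite ltr_pdivrMr // ltr_pMr // ltr1n.
have d0 : 0 < Num.min r (b - a) / 2 by rewrite divr_gt0.
move: md d0; set d := _ / 2; rewrite lt_min => /andP[dr db] d0.
exists (a + d); rewrite addrC addrK gtr0_norm // /citv /oitv /=; split=> //; lra.
Qed.

Lemma near_right_end (a b r : R) : a < b -> 0 < r -> exists y,
  [/\ citv a b y, `|y - b| < r & oitv a b y].
Proof.
move=> ab r0; have m0 : 0 < Num.min r (b - a) by rewrite lt_min r0 subr_gt0.
have md : Num.min r (b - a) / 2 < Num.min r (b - a) by rewrite ltr_pdivrMr // ltr_pMr // ltr1n.
have d0 : 0 < Num.min r (b - a) / 2 by rewrite divr_gt0.
move: md d0; set d := _ / 2; rewrite lt_min => /andP[dr db] d0.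
exists (b - d); rewrite addrAC subrr add0r normrN gtr0_norm // /citv /oitv /=; split=> //; lra.
Qed.

(** Each of two arcs with a common point absorbs the other; the values at the ends then agree by
    continuity. *)
Lemma iedge_eq g a b g' a' b' x : iedge X V h g a b -> iedge X V h g' a' b' ->
  (g @` oitv a b) x -> (g' @` oitv a' b') x ->
  [/\ a = a', b = b', forall y, oitv a b y -> g y = g' y, g a = g' a & g b = g' b].
Proof.
move=> ge ge' gx gx'.
have sub g1 a1 b1 g2 a2 b2 : iedge X V h g1 a1 b1 -> iedge X V h g2 a2 b2 ->
    (g1 @` oitv a1 b1) x -> (g2 @` oitv a2 b2) x ->
    [/\ a2 <= a1, b1 <= b2 & forall y, oitv a1 b1 y -> g1 y = g2 y].
  move=> ge1 ge2 x1 x2.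
  have ab := iedge_absorbs Vfin hh ge2 (iedge_connected ge1) (iedge_image_sub ge1) x1 x2.
  have key y : oitv a1 b1 y -> oitv a2 b2 y /\ g2 y = g1 y.
    move=> yI; have := ab (g1 y); case: (ge1) => _ [_ g1P] _ _ _.
    by have [_ _ ->] := g1P _ yI; apply; exists y.
  case: ge1 => ab1 _ _ _ _; split.
  - rewrite leNgt; apply/negP => a12; have a120 : 0 < a2 - a1 by rewrite subr_gt0.
    have [y [_ y1 /key[/andP[a2y _] _]]] := near_left_end ab1 a120.
    by move: y1; rewrite ltr_distl; lra.
  - rewrite leNgt; apply/negP => b12; have b120 : 0 < b1 - b2 by rewrite subr_gt0.
    have [y [_ y1 /key[/andP[_ yb2] _]]] := near_right_end ab1 b120.
    by move: y1; rewrite ltr_distl; lra.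
  - by move=> y /key[_ ->].
have [h1 h2 h3] := sub _ _ _ _ _ _ ge ge' gx gx'.
have [h4 h5 h6] := sub _ _ _ _ _ _ ge' ge gx' gx.
have aa : a = a' by apply/le_anti; rewrite h1 h4.
have bb : b = b' by apply/le_anti; rewrite h2 h5.
subst a' b'; case: ge => ab _ gc _ _; case: ge' => _ _ gc' _ _; split=> //.
- apply: (cont_on_eq_at gc gc') => [|r r0]; first by rewrite /citv /= lexx ltW.
  by have [y [y1 y2 y3]] := near_left_end ab r0; exists y; split=> //; apply: h3.
- apply: (cont_on_eq_at gc gc') => [|r r0]; first by rewrite /citv /= lexx ltW.
  by have [y [y1 y2 y3]] := near_right_end ab r0; exists y; split=> //; apply: h3.
Qed.

Lemma edge_eq K v w K' v' w' x : edge K v w -> edge K' v' w' -> K x -> K' x ->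
  K = K' /\ ((v = v' /\ w = w') \/ (v = w' /\ w = v')).
Proof.
move=> [g [a [b [ge -> vw]]]] [g' [a' [b' [ge' -> vw']]]] Kx K'x.
have [ea eb eg ega egb] := iedge_eq ge ge' Kx K'x.
subst a' b'; split.
  by apply/seteqP; split=> _ [y yI <-]; exists y => //; rewrite eg.
by case: vw => -[-> ->]; case: vw' => -[-> ->]; rewrite ega egb; [left|right|right|left].
Qed.

Lemma edge_other_end K v w w' : edge K v w -> edge K v w' -> w = w'.
Proof.
move=> e1 e2; have [x Kx] := edge_nonempty e1.
have [_ [[_ ->]|[vw' wv]]] := edge_eq e1 e2 Kx Kx; first by [].
by have := edge_height_neq e1; rewrite wv.
Qed.

Definition half_branch (c : R -> E) (e : R) (v : E) :=
  [/\ 0 < e, cont_on [set x | 0 <= x < e] c, c 0 = v, V v &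
      forall x, 0 < x < e -> X (c x) /\ ~ V (c x)].

(** A branch leaving a vertex is connected and avoids [V], so it lies on one edge. Letting the
    parameter tend to 0 shows that [v] lies on the closed edge, and being a vertex it is one of the
    ends. *)
Lemma half_branch_edge c e v : half_branch c e v -> exists K w, edge K v w /\
  forall x, 0 < x < e -> K (c x).
Proof.
move=> [e0 cc c0 Vv cP].
have e2 : 0 < e / 2 < e by rewrite divr_gt0 //= ltr_pdivrMr // ltr_pMr // ltr1n.
have [Xq nVq] := cP _ e2.
have [g [a [b [ge qI gq]]]] := iedge_exists Xc Vfin hh Xq nVq.
have cA : connected (c @` oitv 0 e).
  apply: connected_image; first exact: connected_oitv.
  by apply: cont_onS cc => x /andP[/ltW x0 xe]; rewrite /= x0.
have AXV : c @` oitv 0 e `<=` X `\` V by move=> _ [x xI <-]; exact: cP.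
have ab x : 0 < x < e -> oitv a b (h (c x)) /\ g (h (c x)) = c x.
  move=> xI; apply: (iedge_absorbs Vfin hh ge cA AXV (x := c (e / 2))).
  - by exists (e / 2).
  - by exists (h (c (e / 2))).
  - by exists x.
case: (ge) => ltab [_ gP] gc Va Vb; case: (hh) => hc _ _.
have Xv := VX Vv.
have cI0 : [set x | 0 <= x < e] (0 : R) by rewrite /= lexx.
have small (r : R) : 0 < r -> exists x, [/\ 0 < x < e, `|c x - v| < r & `|h (c x) - h v| < r].
  move=> r0; have [s s0 sP] := hc _ Xv _ r0.
  have m0 : 0 < Num.min r s by rewrite lt_min r0.
  have [t t0 tP] := cc _ cI0 _ m0.
  have [x [/andP[x0 xe] xt xI]] := near_left_end e0 t0.
  have xI' : [set x | 0 <= x < e] x by case/andP: xI => /ltW/= -> ->.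
  have := tP x xI' xt; rewrite c0 lt_min.
  move=> /andP[xr xs]; exists x; split=> //; apply: sP => //; exact: (cP _ xI).1.
have hvI : citv a b (h v).
  rewrite /citv /= !leNgt; apply/andP; split; apply/negP => lt.
    have d0 : 0 < a - h v by rewrite subr_gt0.
    have [x [xI _ +]] := small _ d0; have [/andP[h1 _] _] := ab _ xI.
    by rewrite ltr_distl; move: h1; lra.
  have d0 : 0 < h v - b by rewrite subr_gt0.
  have [x [xI _ +]] := small _ d0; have [/andP[_ h1] _] := ab _ xI.
  by rewrite ltr_distl; move: h1; lra.
have gv : g (h v) = v.
  apply/eqP; rewrite -subr_eq0 -normr_le0; apply/ler_addgt0Pl => d d0; rewrite addr0.
  have d20 : 0 < d / 2 by rewrite divr_gt0.
  have [r r0 rP] := gc _ hvI _ d20.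
  have m0 : 0 < Num.min r (d / 2) by rewrite lt_min r0.
  have [x [xI]] := small _ m0; rewrite !lt_min => /andP[_ xd] /andP[xr _].
  have [/andP[h1 h2] h3] := ab _ xI.
  have := rP (h (c x)) (ltac:(by rewrite /citv /= !ltW)) xr; rewrite h3.
  rewrite (_ : g (h v) - v = (g (h v) - c x) + (c x - v)); last by rewrite addrA subrK.
  by move=> H; rewrite (le_trans (ler_normD _ _)) // (splitr d) lerD // ltW // distrC.
exists (g @` oitv a b), (if h v == a then g b else g a); split; last first.
  by move=> x xI; have [h1 h2] := ab _ xI; exists (h (c x)).
exists g, a, b; split=> //; case: eqVneq => [ha|nha]; first by left; rewrite -gv ha.
right; split=> //; rewrite -{1}gv; congr g.
case/andP: hvI => hva; rewrite le_eqVlt => /orP[/eqP//|hvb].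
have [_ + _] := gP (h v) (ltac:(by rewrite /oitv /= lt_neqAle eq_sym nha hva)).
by rewrite gv.
Qed.

(** On a single edge both branches would start from the same end and, by the intermediate value
    theorem, reach a common height close to [h v]. A point of an edge is determined by its height,
    so the branches would meet. *)
Lemma half_branches_separate c1 c2 e v K w : half_branch c1 e v -> half_branch c2 e v ->
  (forall x y, 0 < x < e -> 0 < y < e -> c1 x <> c2 y) ->
  edge K v w -> (forall x, 0 < x < e -> K (c1 x)) -> ~ (forall x, 0 < x < e -> K (c2 x)).
Proof.
move=> hb1 hb2 sep [g [a [b [ge KE vw]]]] K1 K2.
have [e0 _ _ Vv _] := hb1; have Xv := VX Vv.
have [ha hb] := iedge_ends VX hh ge.
have e2 : 0 < e / 2 < e by rewrite divr_gt0 //= ltr_pdivrMr // ltr_pMr // ltr1n.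
have hI c : (forall x, 0 < x < e -> K (c x)) -> forall x, 0 < x < e ->
    oitv a b (h (c x)) /\ g (h (c x)) = c x.
  move=> Kc x /Kc; rewrite KE => -[y yI <-].
  by case: ge => _ [_ gP] _ _ _; have [_ _ ->] := gP _ yI.
have attains c m : half_branch c e v -> Num.min (h v) (h (c (e / 2))) <= m <=
    Num.max (h v) (h (c (e / 2))) -> m != h v -> exists2 x, 0 < x < e & h (c x) = m.
  move=> [_ cc c0 _ cP] mI mv; case/andP: e2 => e20 e2e.
  have cc' : {within `[0, e / 2], continuous (fun x => h (c x))}.
    apply/cont_onP => x; rewrite /= in_itv /= => /andP[x0 xe] d d0.
    have xI : [set x | 0 <= x < e] x by rewrite /= x0 (le_lt_trans xe).
    have Xcx y : 0 <= y <= e / 2 -> X (c y).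
      case/andP; rewrite le_eqVlt => /orP[/eqP<-|y0] ye; first by rewrite c0.
      by apply: (cP _ _).1; rewrite y0 (le_lt_trans ye).
    case: hh => hc _ _.
    have [r r0 rP] := hc _ (Xcx x (ltac:(by rewrite x0))) _ d0.
    have [s s0 sP] := cc _ xI _ r0; exists s => // y; rewrite in_itv /= => /andP[y0 ye] yx.
    apply: rP; first by apply: Xcx; rewrite y0.
    by apply: sP => //; rewrite /= y0 (le_lt_trans ye).
  have [|x] := @IVT R _ _ _ m (ltW e20) cc'; first by rewrite c0.
  rewrite in_itv /= => /andP[x0 xe] hx; exists x => //.
  rewrite (le_lt_trans xe) // andbT lt_neqAle x0 andbT.
  by apply: contraNneq mv => x00; rewrite -hx -x00 c0.
have [/andP[h1a h1b] _] := hI _ K1 _ e2; have [/andP[h2a h2b] _] := hI _ K2 _ e2.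
(* Of the two heights at parameter [e / 2], the one nearer to [h v] is reached by both branches. *)
have [m [m1 m2 mv]] : exists m, [/\ Num.min (h v) (h (c1 (e / 2))) <= m <=
      Num.max (h v) (h (c1 (e / 2))), Num.min (h v) (h (c2 (e / 2))) <= m <=
      Num.max (h v) (h (c2 (e / 2))) & m != h v].
  case: vw => -[-> _]; rewrite ?ha ?hb.
    exists (Num.min (h (c1 (e / 2))) (h (c2 (e / 2)))).
    rewrite !ge_min !le_max !le_min !lexx !(ltW h1a) !(ltW h2a) ?orbT /= ?ge_min ?lexx ?orbT.
    by split=> //; rewrite gt_eqF // lt_min h1a.
  exists (Num.max (h (c1 (e / 2))) (h (c2 (e / 2)))).
  rewrite !ge_min !le_max !ge_max !lexx !(ltW h1b) !(ltW h2b) ?orbT /= ?le_max ?lexx ?orbT.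
  by split=> //; rewrite lt_eqF // gt_max h1b.
have [x xI hx] := attains _ _ hb1 m1 mv; have [y yI hy] := attains _ _ hb2 m2 mv.
apply: (sep _ _ xI yI).
have [_ <-] := hI _ K1 _ xI; have [_ <-] := hI _ K2 _ yI.
by rewrite hx hy.
Qed.

Lemma edge_near_end K v w (r : R) : edge K v w -> 0 < r -> exists2 x, K x & `|x - v| < r.
Proof.
move=> [g [a [b [[ab _ gc _ _] -> vw]]]] r0.
case: vw => -[-> _].
  have [s s0 sP] := gc a (ltac:(by rewrite /citv /= lexx ltW)) _ r0.
  by have [y [y1 y2 y3]] := near_left_end ab s0; exists (g y); [exists y|apply: sP].
have [s s0 sP] := gc b (ltac:(by rewrite /citv /= lexx ltW)) _ r0.
by have [y [y1 y2 y3]] := near_right_end ab s0; exists (g y); [exists y|apply: sP].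
Qed.

Definition chart_dom (two : bool) (e : R) : set R := [set x | `|x| < e /\ (two \/ 0 <= x)].

(* [X] is an arc near [v], with [v] in its interior ([two]) or as an end point. *)
Definition chart_at (two : bool) (v : E) := exists2 e : R, 0 < e & exists c : R -> E,
  [/\ cont_on (chart_dom two e) c,
      forall x y, chart_dom two e x -> chart_dom two e y -> c x = c y -> x = y,
      c 0 = v, forall x, chart_dom two e x -> X (c x) &
      forall eta : R, 0 < eta -> exists2 r : R, 0 < r & forall y, X y -> `|y - v| < r ->
        exists x, [/\ chart_dom two e x, `|x| < eta & y = c x]].

Lemma chart_branches two v : V v -> chart_at two v -> exists2 e : R, 0 < e & exists c : R -> E,
  [/\ half_branch c e v, two -> half_branch (fun x => c (- x)) e v,
      forall x y, chart_dom two e x -> chart_dom two e y -> c x = c y -> x = y &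
      exists2 r : R, 0 < r & forall y, X y -> `|y - v| < r -> y <> v ->
        (exists2 x, 0 < x < e & y = c x) \/ (two /\ exists2 x, 0 < x < e & y = c (- x))].
Proof.
move=> Vv [e e0 [c [cc cinj c0 cX cnear]]].
have [rho rho0 rhoP] := finite_gap Vfin v.
have D0 : chart_dom two e 0 by rewrite /chart_dom /= normr0; split=> //; right.
have [t t0 tP] := cc _ D0 _ rho0.
pose d := Num.min e t.
have d0 : 0 < d by rewrite lt_min e0.
have dD x : chart_dom two d x -> chart_dom two e x /\ `|x| < t.
  by move=> [+ x2]; rewrite lt_min => /andP[xe xt].
have nV x : chart_dom two d x -> x != 0 -> ~ V (c x).
  move=> /dD[xD xt] x0 Vx; have : c x = v.
    by apply: rhoP => //; rewrite -c0; apply: tP => //; rewrite subr0.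
  by rewrite -c0 => /(cinj _ _ xD D0) x00; rewrite x00 eqxx in x0.
have pos x : 0 <= x < d -> chart_dom two d x.
  by move=> /andP[x0 xd]; split; [rewrite ger0_norm|right].
have neg x : two -> 0 <= x < d -> chart_dom two d (- x).
  by move=> tw /andP[x0 xd]; split; [rewrite normrN ger0_norm|left].
exists d => //; exists c; split.
- split=> //; first by apply: cont_onS cc => x /pos/dD[].
  move=> x /andP[x0 xd]; have xD := pos x (ltac:(by rewrite ltW)).
  by split; [exact: cX (dD _ xD).1|apply: nV; rewrite // gt_eqF].
- move=> tw; split=> //; last 2 first.
  + by rewrite oppr0.
  + move=> x /andP[x0 xd]; have xD := neg x tw (ltac:(by rewrite ltW)).
    by split; [exact: cX (dD _ xD).1|apply: nV; rewrite // oppr_eq0 gt_eqF].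
  + move=> x xI s s0.
    have [r r0 rP] := cc _ (dD _ (neg _ tw xI)).1 _ s0; exists r => // y yI yx.
    by apply: rP; [exact: (dD _ (neg _ tw yI)).1|rewrite -opprD normrN].
- by move=> x y /dD[xD _] /dD[yD _]; exact: cinj.
- have [r r0 rP] := cnear _ d0; exists r => // y Xy yv nyv.
  have [x [[_ x2] xd yE]] := rP _ Xy yv.
  have x0 : x != 0 by apply: contra_notN nyv => /eqP x0; rewrite yE x0 c0.
  have [xpos|xneg] := ltP 0 x.
    by left; exists x => //; rewrite xpos; move: xd; rewrite gtr0_norm.
  right; have xlt : x < 0 by rewrite lt_neqAle x0.
  split; first by case: x2 => // xge; move: xlt; rewrite ltNge xge.
  exists (- x); last by rewrite opprK.
  by rewrite oppr_gt0 xlt; move: xd; rewrite ltr0_norm.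
Qed.

(** Every edge at [v] has points arbitrarily near [v]. These lie on the only branch of the chart,
    hence the edge is the one containing that branch. *)
Lemma end_edge v : V v -> chart_at false v ->
  exists K w, edge K v w /\ forall K' w', edge K' v w' -> K' = K /\ w' = w.
Proof.
move=> Vv /(chart_branches Vv)[e e0 [c [hb _ _ [r r0 rP]]]].
have [K [w [eK Kc]]] := half_branch_edge hb.
exists K, w; split=> // K' w' eK'.
have [x K'x xv] := edge_near_end eK' r0.
have [Xx nVx] := edge_sub eK' K'x.
have xnv : x <> v by move=> xv'; apply: nVx; rewrite xv'.
have [[y yI xE]|[]//] := rP _ Xx xv xnv.
have [KK' _] := edge_eq eK' eK K'x (ltac:(by rewrite xE; exact: Kc)).
by subst K'; split=> //; apply: edge_other_end eK' eK.
Qed.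

Lemma through_edges v : V v -> chart_at true v ->
  exists K1 w1 K2 w2, [/\ K1 <> K2, edge K1 v w1, edge K2 v w2 &
    forall K' w', edge K' v w' -> (K' = K1 /\ w' = w1) \/ (K' = K2 /\ w' = w2)].
Proof.
move=> Vv /(chart_branches Vv)[e e0 [c [hb1 hb2 cinj [r r0 rP]]]].
have {}hb2 := hb2 isT.
have [K1 [w1 [eK1 Kc1]]] := half_branch_edge hb1.
have [K2 [w2 [eK2 Kc2]]] := half_branch_edge hb2.
exists K1, w1, K2, w2; split=> //.
  move=> K12; move: Kc2; rewrite -K12; apply: half_branches_separate hb1 hb2 _ eK1 Kc1.
  move=> x y /andP[x0 xe] /andP[y0 ye] cxy.
  have : x = - y.
    apply: cinj cxy; split; try by left.
      by rewrite gtr0_norm.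
    by rewrite normrN gtr0_norm.
  by move=> xy; move: x0; rewrite xy oppr_gt0 ltNge ltW.
move=> K' w' eK'.
have [x K'x xv] := edge_near_end eK' r0.
have [Xx nVx] := edge_sub eK' K'x.
have xnv : x <> v by move=> xv'; apply: nVx; rewrite xv'.
have [[y yI xE]|[_ [y yI xE]]] := rP _ Xx xv xnv.
  left; have [KK' _] := edge_eq eK' eK1 K'x (ltac:(by rewrite xE; exact: Kc1)).
  by subst K'; split=> //; apply: edge_other_end eK' eK1.
right; have [KK' _] := edge_eq eK' eK2 K'x (ltac:(by rewrite xE; exact: Kc2)).
by subst K'; split=> //; apply: edge_other_end eK' eK2.
Qed.

Lemma edge_path K v w : edge K v w -> exists g : R -> E,
  [/\ {within `[0, 1], continuous g}, {in `[0, 1[ &, injective g},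
      g 0 = v, g @` `]0, 1[ = K & g 1 = w].
Proof.
move=> [g [a [b [ge -> vw]]]]; have [ha hb] := iedge_ends VX hh ge.
case: ge => ab [_ gP] gc Va Vb.
have ba0 : 0 < b - a by rewrite subr_gt0.
have ginj x y : citv a b x -> citv a b y -> g x = g y -> x = y.
  have hg z : citv a b z -> h (g z) = z.
    move=> /andP[]; rewrite le_eqVlt => /orP[/eqP<-|az]; first by [].
    rewrite le_eqVlt => /orP[/eqP->|zb]; first by [].
    by have [] := gP z (ltac:(by rewrite /oitv /= az)).
  by move=> xI yI gxy; rewrite -(hg _ xI) gxy hg.
(* [s] is the sign of the direction of travel along the height axis. *)
have main (s o : R) : s != 0 -> `|s| = b - a -> (forall x, citv 0 1 x -> citv a b (o + s * x)) ->
    (forall z, oitv a b z -> oitv 0 1 ((z - o) / s)) ->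
    (forall x, oitv 0 1 x -> oitv a b (o + s * x)) ->
    [/\ {within `[0, 1], continuous (fun x => g (o + s * x))},
      {in `[0, 1[ &, injective (fun x => g (o + s * x))} &
      (fun x => g (o + s * x)) @` `]0, 1[ = g @` oitv a b].
  move=> s0 sn cI oI oI'; split.
  - apply/cont_onP => x; rewrite /= in_itv /= => xI d d0.
    have [r r0 rP] := gc _ (cI _ xI) _ d0; exists (r / (b - a)); first by rewrite divr_gt0.
    move=> y; rewrite in_itv /= => yI yx; apply: rP; first exact: cI.
    by rewrite opprD addrACA subrr add0r -mulrBr normrM sn mulrC -ltr_pdivlMr.
  - move=> x y; rewrite !in_itv /= => /andP[x0 x1] /andP[y0 y1] /ginj H.
    apply: (mulfI s0); apply: (addrI o); apply: H; apply: cI.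
      by rewrite /citv /= x0 ltW.
    by rewrite /citv /= y0 ltW.
  - apply/seteqP; split=> [_ [x + <-]|_ [z zI <-]].
      by rewrite /= in_itv /= => xI; exists (o + s * x) => //; exact: oI'.
    exists ((z - o) / s); first by rewrite /= in_itv /=; exact: oI.
    by rewrite mulrC divfK // addrC subrK.
case: vw => -[-> ->].
  exists (fun x => g (a + (b - a) * x)).
  have [||x|z|x|h1 h2 h3] := main (b - a) a.
  - by rewrite gt_eqF.
  - by rewrite gtr0_norm.
  - rewrite /citv /= => /andP[x0 x1]; rewrite lerDl mulr_ge0 ?(ltW ba0) //=.
    by rewrite -lerBrDl ler_piMr // ltW.
  - by rewrite /oitv /= ltr_pdivlMr // ltr_pdivrMr // mul0r mul1r subr_gt0 ltrD2r.
  - rewrite /oitv /= => /andP[x0 x1]; rewrite ltrDl mulr_gt0 //=.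
    by rewrite -ltrBrDl gtr_pMr.
  - by split; rewrite ?mulr0 ?addr0 ?mulr1 // addrC subrK.
exists (fun x => g (b + (a - b) * x)).
have [||x|z|x|h1 h2 h3] := main (a - b) b.
- by rewrite subr_eq0 lt_eqF.
- by rewrite distrC gtr0_norm.
- rewrite /citv /= => /andP[x0 x1]; have : 0 <= (b - a) * x <= b - a.
    by rewrite mulr_ge0 ?(ltW ba0) //= ler_piMr // ltW.
  by rewrite -opprB mulNr; lra.
- rewrite /oitv /= => /andP[az zb].
  rewrite -[z - b]opprB -[a - b]opprB invrN mulrNN.
  by rewrite ltr_pdivlMr // ltr_pdivrMr // mul0r mul1r; lra.
- rewrite /oitv /= => /andP[x0 x1]; have : 0 < (b - a) * x < b - a.
    by rewrite mulr_gt0 //= gtr_pMr.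
  by rewrite -opprB mulNr; lra.
- by split; rewrite ?mulr0 ?addr0 ?mulr1 // addrC subrK.
Qed.

(** The converse of [edge_path]: the open path is absorbed by one edge and fills it by the
    intermediate value theorem. This identifies the arcs of the tracer with edges. *)
Lemma path_edge (g : R -> E) : {within `[0, 1], continuous g} ->
  {in `[0, 1[ &, injective g} -> g @` `]0, 1[ `<=` X `\` V -> V (g 0) -> V (g 1) ->
  edge (g @` `]0, 1[) (g 0) (g 1).
Proof.
move=> /cont_onP gc ginj gXV V0 V1.
have gc' : cont_on (citv 0 1) g by apply: cont_onS gc => x; rewrite /= in_itv.
have AE : g @` `]0, 1[ = g @` oitv 0 1.
  by apply/seteqP; split=> _ [x xI <-]; exists x => //; move: xI; rewrite /= in_itv.
rewrite AE in gXV *.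
have cA : connected (g @` oitv 0 1).
  apply: connected_image; first exact: connected_oitv.
  by apply: cont_onS gc' => x /andP[/ltW x0 /ltW x1]; rewrite /citv /= x0.
have half : oitv 0 1 (2^-1 : R) by rewrite /oitv /= invr_gt0 ltr0n invf_lt1 // ltr1n.
have [Xq nVq] := gXV _ (imageP g half).
have [f [a [b [fe qI fq]]]] := iedge_exists Xc Vfin hh Xq nVq.
have ab x : oitv 0 1 x -> oitv a b (h (g x)) /\ f (h (g x)) = g x.
  move=> xI; apply: (iedge_absorbs Vfin hh fe cA gXV (x := g 2^-1)).
  - by exists 2^-1.
  - by exists (h (g 2^-1)).
  - by exists x.
have [ha hb] := iedge_ends VX hh fe.
case: (fe) => ltab [_ fP] fc Va Vb; case: (hh) => hc _ _.
have Xg x : citv 0 1 x -> X (g x).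
  move=> /andP[]; rewrite le_eqVlt => /orP[/eqP<- _|x0]; first exact: VX.
  rewrite le_eqVlt => /orP[/eqP->|x1]; first exact: VX.
  by apply: (gXV _ _).1; exists x => //; rewrite /oitv /= x0.
have hgc : cont_on (citv 0 1) (fun x => h (g x)).
  move=> x xI d d0; have [r r0 rP] := hc _ (Xg _ xI) _ d0.
  have [s s0 sP] := gc' _ xI _ r0; exists s => // y yI yx.
  by apply: rP; [exact: Xg|exact: sP].
have end_near z (r : R) : z = 0 \/ z = 1 -> 0 < r -> exists y, [/\ citv 0 1 y, `|y - z| < r & oitv 0 1 y].
  by case=> -> r0; [apply: near_left_end|apply: near_right_end].
have oc (x : R) : citv 0 1 x -> oitv 0 1 x \/ (x = 0 \/ x = 1).
  move=> /andP[]; rewrite le_eqVlt => /orP[/eqP<- _|x0]; first by right; left.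
  rewrite le_eqVlt => /orP[/eqP->|x1]; first by right; right.
  by left; rewrite /oitv /= x0.
have hI z : citv 0 1 z -> citv a b (h (g z)).
  move=> zI; have [zO|z01] := oc _ zI.
    by have [/andP[h1 h2] _] := ab _ zO; rewrite /citv /= !ltW.
  rewrite /citv /= !leNgt; apply/andP; split; apply/negP => lt.
    have d0 : 0 < a - h (g z) by rewrite subr_gt0.
    have [s s0 sP] := hgc _ zI _ d0; have [y [yI yz yO]] := end_near _ _ z01 s0.
    have [/andP[h1 _] _] := ab _ yO; have := sP _ yI yz.
    by rewrite ltr_distl; move: h1; lra.
  have d0 : 0 < h (g z) - b by rewrite subr_gt0.
  have [s s0 sP] := hgc _ zI _ d0; have [y [yI yz yO]] := end_near _ _ z01 s0.
  have [/andP[_ h1] _] := ab _ yO; have := sP _ yI yz.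
  by rewrite ltr_distl; move: h1; lra.
have fhg z : citv 0 1 z -> f (h (g z)) = g z.
  move=> zI; have [/ab[]//|z01] := oc _ zI.
  apply: (@cont_on_eq_at (citv 0 1) (fun x => f (h (g x))) g) => //.
    move=> x xI d d0; have [r r0 rP] := fc _ (hI _ xI) _ d0.
    have [s s0 sP] := hgc _ xI _ r0; exists s => // y yI yx.
    by apply: rP; [exact: hI|exact: sP].
  move=> r r0; have [y [yI yz /ab[_ yE]]] := end_near _ _ z01 r0.
  by exists y; split.
have I0 : citv 0 1 (0 : R) by rewrite /citv /= lexx ler01.
have I1 : citv 0 1 (1 : R) by rewrite /citv /= lexx ler01.
have hend z : V (g z) -> citv 0 1 z -> h (g z) = a \/ h (g z) = b.
  move=> Vz zI; have /andP[] := hI _ zI; rewrite le_eqVlt => /orP[/eqP<-|az]; first by left.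
  rewrite le_eqVlt => /orP[/eqP->|zb]; first by right.
  have [_ + _] := fP (h (g z)) (ltac:(by rewrite /oitv /= az)).
  by rewrite fhg.
have ivt x y m : 0 <= x -> x <= y -> y <= 1 ->
    Num.min (h (g x)) (h (g y)) <= m <= Num.max (h (g x)) (h (g y)) ->
    exists2 z, x <= z <= y & h (g z) = m.
  move=> x0 xy y1 mI; have cc : {within `[x, y], continuous (fun x => h (g x))}.
    apply/cont_onP; apply: cont_onS hgc => z; rewrite /= in_itv /= /citv /= => /andP[xz zy].
    by rewrite (le_trans x0) // (le_trans zy).
  by have [z] := IVT xy cc mI; rewrite in_itv /= => zI hz; exists z.
have full : h (g 0) != h (g 1) -> g @` oitv 0 1 = f @` oitv a b.
  move=> h01; apply/seteqP; split=> [_ [x xI <-]|_ [t tI <-]].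
    by have [h1 h2] := ab _ xI; exists (h (g x)).
  have [|x xI hx] := ivt 0 1 t (lexx _) ler01 (lexx _).
    case/andP: tI => /ltW at' /ltW tb.
    have [h0|h0] := hend _ V0 I0; have [h1|h1] := hend _ V1 I1; move: h01; rewrite h0 h1 ?eqxx // => _.
      by rewrite ge_min le_max at' tb orbT.
    by rewrite ge_min le_max at' tb orbT.
  have [xO|x01] := oc _ xI.
    by exists x => //; rewrite -hx; have [_] := ab _ xO.
  have : h (g x) = a \/ h (g x) = b by case: x01 => ->; apply: hend.
  by rewrite hx => -[] E0; move: tI; rewrite E0 /oitv /= ltxx ?andbF.
have [h01|h01] := eqVneq (h (g 0)) (h (g 1)); last first.
  exists f, a, b; split=> //; first exact: full.
  rewrite -(fhg _ I0) -(fhg _ I1).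
  have [h0|h0] := hend _ V0 I0; have [h1|h1] := hend _ V1 I1; move: h01; rewrite h0 h1 ?eqxx // => _.
    by left.
  by right.
(* Injectivity on [[0, 1[] alone would allow a closed loop. With equal heights at both ends, the
   height [m] is attained in each half of the parameter interval, and a point of the edge is
   determined by its height. *)
exfalso; have [/andP[ah hb'] _] := ab _ half.
have hne : h (g 0) != h (g 2^-1).
  by have [->|->] := hend _ V0 I0; rewrite ?(lt_eqF ah) ?(gt_eqF hb').
pose m := (h (g 0) + h (g 2^-1)) / 2.
have mne0 : m != h (g 0) by apply: contraNneq hne; rewrite /m => H; apply/eqP; lra.
have mne2 : m != h (g 2^-1) by apply: contraNneq hne; rewrite /m => H; apply/eqP; lra.
have hm : Num.min (h (g 0)) (h (g 2^-1)) <= m <= Num.max (h (g 0)) (h (g 2^-1)).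
  rewrite ge_min le_max /m; case: (ltP (h (g 0)) (h (g 2^-1))) => lt.
    by apply/andP; split; apply/orP; [left|right]; lra.
  by apply/andP; split; apply/orP; [right|left]; lra.
have [h20 h21] : (0 : R) <= 2^-1 /\ (2^-1 : R) <= 1 by case/andP: half => /ltW ? /ltW ?.
have [x /andP[x0 x2] hx] := ivt 0 2^-1 m (lexx _) h20 h21 hm.
have [y /andP[y2 y1] hy] : exists2 z, 2^-1 <= z <= 1 & h (g z) = m.
  by apply: ivt => //; rewrite -h01 minC maxC.
have y_lt1 : y < 1.
  by rewrite lt_neqAle y1 andbT; apply: contraNneq mne0 => y11; rewrite -hy y11 h01.
have gxy : g x = g y.
  rewrite -(fhg x) ?hx -?hy ?(fhg y) //; rewrite /citv /=; last by rewrite x0 (le_trans x2).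
  by rewrite y1 (le_trans h20).
have xy : x = y.
  apply: ginj gxy; rewrite in_itv /=; first by rewrite x0 (le_lt_trans x2) // invf_lt1 // ltr1n.
  by rewrite y_lt1 (le_trans h20).
have xhalf : x = 2^-1 by apply/le_anti; rewrite x2 xy.
by move: mne2; rewrite -hx xhalf eqxx.
Qed.

End Edges.

(** * Charts of C_k in the interior *)

Section PolynomialFunctions.
Context {R : realType} {m : nat}.
Implicit Types (q : mpoly m R) (y : 'rV[R]_m).

Lemma peval0 y : peval (0 : mpoly m R) y = 0. Proof. exact: meval0. Qed.
Lemma peval1 y : peval (1 : mpoly m R) y = 1. Proof. exact: meval1. Qed.
Lemma pevalD q q' y : peval (q + q') y = peval q y + peval q' y. Proof. exact: mevalD. Qed.
Lemma pevalM q q' y : peval (q * q') y = peval q y * peval q' y. Proof. exact: mevalM. Qed.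
Lemma pevalZ c q y : peval (c *: q) y = c * peval q y. Proof. exact: mevalZ. Qed.
Lemma pevalXn q k y : peval (q ^+ k) y = peval q y ^+ k. Proof. exact: rmorphXn. Qed.
Lemma peval_prod (I : Type) (s : seq I) (P : pred I) (F : I -> mpoly m R) y :
  peval (\prod_(i <- s | P i) F i) y = \prod_(i <- s | P i) peval (F i) y.
Proof. exact: rmorph_prod. Qed.

Lemma sdiff_peval q y : sdiff (peval q) (fun a => peval (mderiv a q) y) y.
Proof.
pose Q q := forall y, sdiff (peval q) (fun a => peval (mderiv a q) y) y.
have QD q1 q2 : Q q1 -> Q q2 -> Q (q1 + q2).
  move=> h1 h2 z; rewrite (_ : peval _ = fun w => peval q1 w + peval q2 w); last first.
    by apply/funext => w; rewrite pevalD.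
  by apply: eq_sdiff (sdiffD (h1 z) (h2 z)) => a; rewrite mderivD pevalD.
have QM q1 q2 : Q q1 -> Q q2 -> Q (q1 * q2).
  move=> h1 h2 z; rewrite (_ : peval _ = fun w => peval q1 w * peval q2 w); last first.
    by apply/funext => w; rewrite pevalM.
  by apply: eq_sdiff (sdiffM (h1 z) (h2 z)) => a; rewrite mderivM pevalD !pevalM.
have QC c : Q (mpolyC m c).
  move=> z; rewrite (_ : peval _ = fun=> c); last by apply/funext => w; rewrite /peval mevalC.
  by apply: eq_sdiff (sdiff_cst _ _) => a; rewrite mderivC peval0.
have QX i : Q (mpolyX R (mnm1 i)).
  move=> z; rewrite (_ : peval _ = fun w => w 0 i); last first.
    by apply/funext => w; rewrite /peval mevalXU.
  apply: eq_sdiff (sdiff_coord i z) => a; rewrite mderivX mnm1E pevalZ eq_sym.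
  case: eqVneq => [->|_]; last by rewrite mul0r.
  rewrite mul1r (_ : mnm_sub _ _ = @mnm0 m) ?mpolyX0 ?peval1 //.
  by apply/mnmP => j; rewrite mnmBE mnm0E subnn.
suff : Q q by [].
elim/mpolyind: q => [|c k p _ _ IH]; first by rewrite -mpolyC0.
apply: QD IH; rewrite -mul_mpolyC; apply: (QM) => //.
rewrite mpolyXE_id; apply: (big_ind Q) => [|q1 q2|i _]; [by rewrite -mpolyC1|exact: QM|].
elim: (k i) => [|j IHj]; first by rewrite expr0 -mpolyC1.
by rewrite exprS; apply: QM.
Qed.

Lemma peval_continuous q y : {for y, continuous (peval q)}.
Proof. exact: sdiff_continuous (sdiff_peval q y). Qed.

Lemma dmpolyE q y v : dmpoly q y v = dot (fun a => peval (mderiv a q) y) v.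
Proof. by []. Qed.

Definition grad (f : 'rV[R]_m -> R) y : 'I_m -> R :=
  fun b => 'D_(delta_mx 0 b : 'rV[R]_m) f y.

Lemma sdiff_grad f g y : sdiff f g y -> sdiff f (grad f y) y.
Proof. by move=> fd; apply: (eq_sdiff _ fd) => b; rewrite /grad (sdiff_derive b fd). Qed.

End PolynomialFunctions.

(** * Local parametrization of an implicit curve, and the bounded height *)

Section LocalCurve.
Context {R : realType} {l : nat}.
Implicit Types (q y v : 'rV[R]_l).

(** The chart is the local inverse of [F] along the [k]-th coordinate axis. The last clause says
    that it covers every nearby point of the curve, with small parameter. *)
Lemma curve_chart (F : 'rV[R]_l -> 'rV[R]_l) (G : 'I_l -> 'I_l -> R) q (k : 'I_l) (rho : R) :
  0 < rho -> F q = 0 ->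
  (forall a, sdiff (fun y => F y 0 a) (G a) q) ->
  (forall v, (forall a, dot (G a) v = 0) -> v = 0) ->
  exists2 e : R, 0 < e & exists c : R -> 'rV[R]_l,
  [/\ cont_on [set x : R | `|x| < e] c,
      forall x, `|x| < e -> `|c x - q| < rho /\ F (c x) = x *: delta_mx 0 k, c 0 = q &
      forall eta : R, 0 < eta -> exists2 r : R, 0 < r & forall y, `|y - q| < r ->
        (forall a, a != k -> F y 0 a = 0) -> `|F y 0 k| < eta /\ c (F y 0 k) = y].
Proof.
move=> rho0 Fq Fd Ginj.
have [psi [r r0 [psiP psic psiK]]] := inverse_function rho0 Fd Ginj.
have nE (x : R) : `|x *: (delta_mx 0 k : 'rV[R]_l)| <= `|x|.
  rewrite normrZ ler_piMr //.
  rewrite [leLHS]/Num.norm /= mx_normrE; apply/bigmax_leP; split=> // -[i j] _ /=.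
  by rewrite mxE; case: (_ && _); rewrite ?normr1 ?normr0.
have psiP' x : `|x| < r -> `|x *: (delta_mx 0 k : 'rV[R]_l) - F q| < r.
  by rewrite Fq subr0; apply: le_lt_trans.
exists r => //; exists (fun x => psi (x *: delta_mx 0 k)); split.
- move=> x /= xr e e0.
  have /continuous_normP/(_ _ e0)[s s0 sP] := psic _ (psiP' _ xr).
  exists s => // y _ yx; apply: sP; rewrite -scalerBl; exact: le_lt_trans yx.
- by move=> x /psiP'/psiP.
- rewrite scale0r -Fq; have /near_normP[s s0 sP] := psiK.
  by apply: sP; rewrite subrr normr0.
- move=> eta eta0; have /near_normP[s s0 sP] := psiK.
  have /continuous_normP/(_ _ eta0)[t t0 tP] := sdiff_continuous (Fd k).
  exists (Num.min s t); first by rewrite lt_min s0.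
  move=> y; rewrite lt_min => /andP[ys yt] Fy; split.
    by have := tP _ yt; rewrite Fq mxE subr0.
  rewrite -[RHS](sP _ ys); congr psi; apply/rowP => a; rewrite !mxE eqxx /=.
  by case: eqVneq => [->|/Fy->]; rewrite ?mulr1 ?mulr0.
Qed.

(* Turns the divergence of [phi_k] at a corner into a limit [1] or [-1]. *)
Definition squash (x : R) : R := x / (1 + `|x|).
Definition unsquash (x : R) : R := x / (1 - `|x|).

Lemma squash_lt1 x : `|squash x| < 1.
Proof.
have x1 : 0 < 1 + `|x| by rewrite ltr_pwDl.
by rewrite /squash normrM normfV (gtr0_norm x1) ltr_pdivrMr // mul1r ltrDr.
Qed.

Lemma unsquashK x : `|x| < 1 -> squash (unsquash x) = x.
Proof.
move=> x1; have n0 : 0 < 1 - `|x| by rewrite subr_gt0.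
rewrite /squash /unsquash normrM normfV (gtr0_norm n0).
by field; rewrite !gt_eqF //= subrK.
Qed.

Lemma squashK x : unsquash (squash x) = x.
Proof.
have x1 : 0 < 1 + `|x| by rewrite ltr_pwDl.
rewrite /unsquash /squash normrM normfV (gtr0_norm x1).
by field; rewrite !gt_eqF //= addrK.
Qed.

Lemma squash_continuous : continuous squash.
Proof.
move=> x; apply: (@cvgM _ _ _ _ id (fun x : R => (1 + `|x|)^-1)); first exact: cvg_id.
apply: cvgV; first by rewrite gt_eqF // ltr_pwDl.
by apply: cvgD; [exact: cvg_cst|apply: cvg_norm; exact: cvg_id].
Qed.

Lemma unsquash_continuous x : `|x| < 1 -> {for x, continuous unsquash}.
Proof.
move=> x1; apply: (@cvgM _ _ _ _ id (fun x : R => (1 - `|x|)^-1)); first exact: cvg_id.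
apply: cvgV; first by rewrite gt_eqF // subr_gt0.
by apply: cvgB; [exact: cvg_cst|apply: cvg_norm; exact: cvg_id].
Qed.

End LocalCurve.

(** * The functions of the Gale dual system and the charts of its curves *)

Section Gale.
Context {R : realType} {l n : nat}.
Local Notation pt := 'rV[R]_l.
Variables (p : 'I_(l + n).+1 -> mpoly l R) (beta : 'I_(l + n).+1 -> 'I_l -> R).
Variable J : 'I_l -> mpoly l R.
Hypothesis Jc : cleared p beta J.

(** An entry once replaced is not touched by later stages, and when the entry [k] is replaced the
    current family is [mixed k.+1], as in [tildeJ]. *)
Lemma mixedE (j : nat) (k : 'I_l) : (j <= l)%N ->
  mixed p beta j k = if (k < j)%N then phi p beta k else tildeJ p beta k.
Proof.
move=> jl; rewrite /mixed.
have H m : (m <= l)%N -> replace_last p beta m k =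
    if (k < l - m)%N then phi p beta k else tildeJ p beta k.
  elim: m => [|m IH] ml; first by rewrite subn0 ltn_ord.
  rewrite /=; case: eqP => [km|/eqP km].
    rewrite km ltnn /tildeJ /mixed km; congr (Jdet (replace_last _ _ _)); lia.
  rewrite IH ?(ltnW ml) // (_ : (k < l - m)%N = (k < l - m.+1)%N) //.
    by apply/idP/idP; move: km ml => /eqP; lia.
by rewrite H ?leq_subr // subKn.
Qed.

Lemma Delta_open y : Delta p y -> exists2 r : R, 0 < r & forall z, `|z - y| < r -> Delta p z.
Proof.
move=> yD.
have /choice[r rP] : forall i, exists r : R, 0 < r /\ forall z, `|z - y| < r -> 0 < peval (p i) z.
  move=> i; have /continuous_normP/(_ _ (yD i))[r r0 rP] := @peval_continuous _ _ (p i) y.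
  by exists r; split=> // z /rP; rewrite ltr_distl subrr => /andP[].
exists (\big[Num.min/1]_i r i); first by apply/bigmin_gtP; split=> // i _; case: (rP i).
by move=> z /bigmin_gtP[_ zr] i; apply: (rP i).2; apply: zr.
Qed.

Definition pprod (y : pt) : R := \prod_i peval (p i) y.

Lemma pprod_gt0 y : Delta p y -> 0 < pprod y.
Proof. by move=> yD; apply: prodr_gt0 => i _. Qed.

Lemma phi_sdiff k y : Delta p y ->
  sdiff (phi p beta k) (fun b => \sum_i beta i k * ((peval (p i) y)^-1 * peval (mderiv b (p i)) y)) y.
Proof.
move=> yD; apply: sdiff_sum => i _; apply: sdiffZ.
by apply: sdiff_comp (sdiff_peval _ _) (sdiff1_ln (yD i)).
Qed.

Lemma tildeJE k y : Delta p y ->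
  tildeJ p beta k y = peval (J k) y * (pprod y ^+ (2 ^ (l - k.+1)))^-1.
Proof. by move=> yD; rewrite (Jc k yD) mulfK // expf_neq0 // gt_eqF // pprod_gt0. Qed.

Lemma tildeJ_eq0 k y : Delta p y -> tildeJ p beta k y = 0 <-> peval (J k) y = 0.
Proof.
move=> yD; rewrite (Jc k yD); split=> [->|/eqP]; first by rewrite mul0r.
by rewrite mulf_eq0 (negPf (expf_neq0 _ _)) ?orbF => [/eqP//|]; rewrite gt_eqF // pprod_gt0.
Qed.

(** Differentiability is read off the cleared form, a polynomial over a power of [pprod]; no
    iterated derivatives of [phi] have to be controlled. *)
Lemma tildeJ_sdiff k y : Delta p y -> exists g, sdiff (tildeJ p beta k) g y.
Proof.
move=> yD; set e := (2 ^ (l - k.+1))%N.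
have P0 : peval ((\prod_i p i) ^+ e) y != 0.
  by rewrite pevalXn peval_prod expf_neq0 // gt_eqF // pprod_gt0.
have h := sdiffM (sdiff_peval (J k) y)
  (sdiff_comp (sdiff_peval ((\prod_i p i) ^+ e) y) (sdiff1_inv P0)).
eexists; apply: near_sdiff h; apply/near_normP.
have [r r0 rP] := Delta_open yD; exists r => // z /rP zD.
by rewrite tildeJE // pevalXn peval_prod.
Qed.

Lemma mixed_sdiff (j : nat) (a : 'I_l) y : (j <= l)%N -> Delta p y ->
  sdiff (mixed p beta j a) (grad (mixed p beta j a) y) y.
Proof.
move=> jl yD; rewrite mixedE //; case: ifP => _; first exact: sdiff_grad (phi_sdiff a yD).
by have [g gP] := tildeJ_sdiff a yD; exact: sdiff_grad gP.
Qed.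

Lemma dot_grad_row (F : 'I_l -> pt -> R) a y v :
  dot (grad (F a) y) v = \sum_b Defs.jacobian F y a b * v 0 b.
Proof. by apply: eq_bigr => b _; rewrite mxE. Qed.

Lemma jacobian_inj (F : 'I_l -> pt -> R) y v : Jdet F y != 0 ->
  (forall a, dot (grad (F a) y) v = 0) -> v = 0.
Proof.
move=> J0 H; apply: trmx_inj; rewrite trmx0.
have Ju : Defs.jacobian F y \in unitmx by rewrite unitmxE unitfE.
rewrite -(mulKmx Ju v^T) (_ : Defs.jacobian F y *m v^T = 0) ?mulmx0 //.
apply/colP => a; rewrite mxE [RHS]mxE -[RHS](H a) dot_grad_row.
by apply: eq_bigr => b _; congr (_ * _); rewrite mxE.
Qed.

Lemma mixed_last (k a : 'I_l) : a = k -> mixed p beta k.+1 a = phi p beta k.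
Proof. by move=> ->; rewrite mixedE // ltnS leqnn. Qed.

(** [tildeJ k] is the Jacobian determinant of [mixed k.+1]. Where it is nonzero this family is a
    local coordinate system whose [k]-th coordinate [phi k] parametrizes the curve; [unsquash]
    converts height to [phi]. *)
Lemma Cset_regular_chart (X : set pt) (h : pt -> R) (k : 'I_l) q :
  (forall y, Delta p y -> X y <-> Cset p beta k y) ->
  (forall y, Delta p y -> h y = squash (phi p beta k y)) ->
  Cset p beta k q -> tildeJ p beta k q != 0 -> regular_chart X h q.
Proof.
move=> XC hE [qD qC] J0.
have [rho rho0 rhoP] := Delta_open qD.
pose F (y : pt) : pt := \row_a (mixed p beta k.+1 a y - (if a == k then phi p beta k q else 0)).
have Fd a : sdiff (fun y => F y 0 a) (grad (mixed p beta k.+1 a) q) q.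
  have h1 := sdiffD (mixed_sdiff a (ltn_ord k) qD) (sdiff_cst (- (if a == k then phi p beta k q else 0)) q).
  under [X in sdiff X]eq_fun do rewrite mxE.
  by apply: eq_sdiff h1 => b; rewrite addr0.
have Fq : F q = 0.
  apply/rowP => a; rewrite !mxE; case: eqVneq => [ak|ak]; last by rewrite qC // subr0.
  by rewrite mixed_last // subrr.
have [e e0 [c [cc cP c0 cnear]]] := curve_chart k rho0 Fq Fd (fun v => jacobian_inj J0).
have Fk y : F y 0 k = phi p beta k y - phi p beta k q by rewrite mxE eqxx mixed_last.
have phic x : `|x| < e -> phi p beta k (c x) = phi p beta k q + x.
  move=> /cP[_ /rowP/(_ k)]; rewrite Fk !mxE !eqxx mulr1 => H; by rewrite -{2}H addrC subrK.
have hq : h q = squash (phi p beta k q) by apply: hE.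
have hq1 : `|h q| < 1 by rewrite hq squash_lt1.
have uhq : unsquash (h q) = phi p beta k q by rewrite hq squashK.
have /continuous_normP/(_ _ e0)[t t0 tP] := @unsquash_continuous _ _ hq1.
pose d := Num.min t (1 - `|h q|).
have d0 : 0 < d by rewrite lt_min t0 subr_gt0.
have dP x : `|x - h q| < d -> `|unsquash x - phi p beta k q| < e /\ `|x| < 1.
  rewrite lt_min => /andP[xt x1]; split; first by rewrite -uhq; exact: tP.
  by rewrite -(subrK (h q) x) (le_lt_trans (ler_normD _ _)) // -ltrBrDr.
exists d => //; exists (fun x => c (unsquash x - phi p beta k q)); split.
- move=> x /= /dP[xe x1] s s0.
  have [r r0 rP] := cc _ xe _ s0.
  have /continuous_normP/(_ _ r0)[w w0 wP] := @unsquash_continuous _ _ x1.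
  exists w => // y /dP[ye _] yx; apply: rP => //.
  by rewrite opprB addrA subrK; apply: wP.
- move=> x /dP[xe x1]; have [cq cF] := cP _ xe; have cD := rhoP _ cq.
  split; last by rewrite hE // phic // addrC subrK unsquashK.
  apply/XC => //; split=> // a ak; have /rowP/(_ a) := cF.
  by rewrite !mxE (negPf ak) subr0 andbF mulr0.
- have [r r0 rP] := cnear _ e0; exists (Num.min r rho); first by rewrite lt_min r0.
  move=> y Xy; rewrite lt_min => /andP[yr yrho]; have yD := rhoP _ yrho.
  have [_ yC] := (XC _ yD).1 Xy.
  have [_ cE] := rP _ yr (fun a ak => ltac:(by rewrite mxE (negPf ak) subr0; exact: yC)).
  by rewrite hE // squashK -Fk.
Qed.

(** The [l - 1] independent rows cannot span all coordinate forms, so one of these completes them to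
    a basis. *)
Lemma row_free_completion (M : 'M[R]_(l.-1, l)) (k : 'I_l) : row_free M ->
  exists b : 'I_l, forall v : pt, (forall i, \sum_j M i j * v 0 j = 0) -> v 0 b = 0 -> v = 0.
Proof.
move=> Mf.
have [b bM] : exists b, ~~ ((delta_mx 0 b : 'rV[R]_l) <= M)%MS.
  apply/existsP; rewrite -negb_forall; apply/negP => /forallP allb.
  have : (1%:M <= M)%MS.
    by apply/row_subP => i; rewrite row1.
  move/mxrankS; rewrite mxrank1 (eqP Mf) => H.
  by have := ltn_ord k; lia.
exists b => v Mv vb; pose A := col_mx M (delta_mx 0 b : 'rV[R]_l).
have Afull : (1%:M <= A)%MS.
  rewrite sub1mx /row_full eqn_leq rank_leq_col /=.
  have lt : (M < A)%MS.
    rewrite ltmxE -addsmxE addsmxSl /=; apply: contra bM; apply: submx_trans.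
    by rewrite /A -addsmxE addsmxSr.
  have := rank_ltmx lt; rewrite (eqP Mf); have := ltn_ord k; lia.
have : A *m v^T = 0.
  rewrite mul_col_mx; apply/eqP; rewrite col_mx_eq0; apply/andP; split; apply/eqP/colP => i.
    by rewrite mxE [RHS]mxE -[RHS](Mv i); apply: eq_bigr => j _; congr (_ * _); rewrite mxE.
  by rewrite -rowE !mxE vb.
case/submxP: Afull => B BE /(congr1 (mulmx B)); rewrite mulmxA -BE mul1mx mulmx0 => vT.
by apply: trmx_inj; rewrite vT trmx0.
Qed.

(** Serves also at zeros of [tildeJ k], where the height is no coordinate: a suitable coordinate
    [y 0 b] takes the place of [phi k] as parameter. *)
Lemma Cset_chart (X : set pt) (k : 'I_l) q :
  (forall y, Delta p y -> X y <-> Cset p beta k y) ->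
  smooth_curve p beta k -> Cset p beta k q -> chart_at X true q.
Proof.
move=> XC sm [qD qC].
have [b bP] := row_free_completion k (sm q (conj qD qC)).
have [rho rho0 rhoP] := Delta_open qD.
pose F (y : pt) : pt := \row_a (if a == k then y 0 b - q 0 b else mixed p beta k.+1 a y).
pose G a := if a == k then fun j => (j == b)%:R else grad (mixed p beta k.+1 a) q.
have Fd a : sdiff (fun y => F y 0 a) (G a) q.
  under [X in sdiff X]eq_fun do rewrite mxE.
  rewrite /G; case: eqVneq => [_|ak]; last exact: mixed_sdiff.
  by apply: eq_sdiff (sdiffD (sdiff_coord b q) (sdiff_cst (- q 0 b) q)) => j; rewrite addr0.
have Fq : F q = 0.
  by apply/rowP => a; rewrite !mxE; case: eqVneq => [_|/qC//]; rewrite subrr.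
have Ginj v : (forall a, dot (G a) v = 0) -> v = 0.
  move=> H; apply: bP => [i|].
    have := H (lift k i); rewrite /G eq_sym (negPf (neq_lift _ _)) dot_grad_row => Hi.
    by rewrite -[RHS]Hi; apply: eq_bigr => j _; congr (_ * _); rewrite [LHS]mxE.
  have := H k; rewrite /G eqxx /dot (bigD1 b) //= eqxx mul1r big1 ?addr0 //.
  by move=> j /negPf ->; rewrite mul0r.
have [e e0 [c [cc cP c0 cnear]]] := curve_chart k rho0 Fq Fd Ginj.
have dom x : chart_dom true e x <-> `|x| < e.
  by split=> [[]//|xe]; split=> //; left.
have Fc x : `|x| < e -> F (c x) 0 k = x.
  by move=> /cP[_ /rowP/(_ k)]; rewrite !mxE !eqxx mulr1.
exists e => //; exists c; split=> //.
- by apply: cont_onS cc => x /dom.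
- by move=> x y /dom xe /dom ye cxy; rewrite -(Fc _ xe) cxy Fc.
- move=> x /dom xe; have [cq cF] := cP _ xe; have cD := rhoP _ cq.
  apply/XC => //; split=> // a ak; have /rowP/(_ a) := cF.
  by rewrite !mxE (negPf ak) andbF mulr0.
- move=> eta eta0; have m0 : 0 < Num.min e eta by rewrite lt_min e0.
  have [r r0 rP] := cnear _ m0; exists (Num.min r rho); first by rewrite lt_min r0.
  move=> y Xy; rewrite lt_min => /andP[yr yrho]; have yD := rhoP _ yrho.
  have [_ yC] := (XC _ yD).1 Xy.
  have [] := rP _ yr (fun a ak => ltac:(by rewrite mxE (negPf ak); exact: yC)).
  rewrite lt_min => /andP[ye yeta] cE; exists (F y 0 k); split=> //.
  exact/dom.
Qed.

End Gale.

(** * Corners of the closure of C_k *)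

Section Corners.
Context {R : realType} {l n : nat}.
Local Notation pt := 'rV[R]_l.
Variables (p : 'I_(l + n).+1 -> mpoly l R) (beta : 'I_(l + n).+1 -> 'I_l -> R).
Variable J : 'I_l -> mpoly l R.
Hypothesis Jc : cleared p beta J.
Hypothesis minors : forall m (le_m_l : (m <= l)%N) (r : 'I_m -> 'I_(l + n).+1), injective r ->
  \det (\matrix_(a, b) beta (r a) (widen_ord le_m_l b)) != 0.

(** On [Delta] the first [m] equations are linear in the logarithms, and the minor of [beta] on the
    rows [r] is invertible. The last clause is the elimination identity that later evaluates the
    next [phi] on the curve. *)
Lemma log_solve m (r : nat -> 'I_(l + n).+1) : (m <= l)%N -> uniq (mkseq r m) ->
  exists gam : nat -> 'I_(l + n).+1 -> R,
  (forall y, Delta p y -> (forall b : 'I_l, (b < m)%N -> phi p beta b y = 0) <->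
     (forall a, (a < m)%N -> ln (peval (p (r a)) y) =
        \sum_(i | i \notin mkseq r m) gam a i * ln (peval (p i) y))) /\
  (forall i (b : 'I_l), (b < m)%N -> beta i b + \sum_(a < m) gam a i * beta (r a) b = 0).
Proof.
move=> ml ur; pose B : 'M[R]_m := \matrix_(a, b) beta (r a) (widen_ord ml b).
have rinj : injective (fun a : 'I_m => r a).
  move=> a b rab; apply/val_inj/eqP; rewrite -(nth_uniq (r 0) _ _ ur) ?size_mkseq ?ltn_ord //.
  by rewrite !nth_mkseq ?ltn_ord //= rab.
have Bu : B \in unitmx by rewrite unitmxE unitfE; exact: (minors ml rinj).
pose w i : 'rV[R]_m := \row_b beta i (widen_ord ml b).
pose g i : 'rV[R]_m := - (w i *m invmx B).
(* Indices [a] are natural numbers; those not below [m] get the coefficient 0. *)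
exists (fun a i => if insub a is Some b then g i 0 b else 0).
have gamE (a : 'I_m) i : (if insub (val a) is Some b then g i 0 b else 0) = g i 0 a.
  by rewrite valK.
have wE i (b : 'I_l) (bm : (b < m)%N) : w i 0 (Ordinal bm) = beta i b.
  by rewrite mxE; congr beta; apply: val_inj.
split=> [y yD|i b bm]; last first.
  rewrite (eq_bigr (fun a : 'I_m => g i 0 a * B a (Ordinal bm))); last first.
    by move=> a _; rewrite gamE [B _ _]mxE; congr (_ * beta _ _); apply: val_inj.
  have -> : \sum_(a < m) g i 0 a * B a (Ordinal bm) = (g i *m B) 0 (Ordinal bm) by rewrite [RHS]mxE.
  by rewrite /g mulNmx mulmxKV // mxE wE subrr.
pose x : 'rV[R]_m := \row_a ln (peval (p (r a)) y).
pose S : 'rV[R]_m := \sum_(i | i \notin mkseq r m) ln (peval (p i) y) *: w i.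
have phiE (b : 'I_l) (bm : (b < m)%N) : phi p beta b y = (x *m B + S) 0 (Ordinal bm).
  rewrite mxE summxE /phi (bigID (mem (mkseq r m))) /=; congr (_ + _); last first.
    by apply: eq_bigr => i _; rewrite mxE wE mulrC.
  rewrite -(big_uniq _ ur) /= /mkseq big_map -[m in iota 0 m]subn0 -/(index_iota 0 m) big_mkord mxE.
  apply: eq_bigr => a _; rewrite !mxE mulrC; congr (_ * beta _ _); exact: val_inj.
have solE : (x *m B + S = 0) <-> (x = - (S *m invmx B)).
  split=> [/eqP|->]; last by rewrite mulNmx mulmxKV // addNr.
  rewrite addr_eq0 => /eqP H; by rewrite -mulNmx -H mulmxK.
have SE (a : 'I_m) : (- (S *m invmx B)) 0 a = \sum_(i | i \notin mkseq r m) g i 0 a * ln (peval (p i) y).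
  rewrite mulmx_suml -sumrN summxE; apply: eq_bigr => i _.
  by rewrite -scalemxAl -scalerN -/(g i) mxE mulrC.
split=> [H a am|H b bm].
  have /solE/rowP/(_ (Ordinal am)) : x *m B + S = 0.
    apply/rowP => b; have bl := leq_trans (ltn_ord b) ml.
    have bm : (Ordinal bl < m)%N := ltn_ord b.
    rewrite [RHS]mxE -(H _ bm) (phiE _ bm).
    by congr (fun_of_matrix _ _ _); apply: val_inj.
  rewrite SE mxE /= => ->; apply: eq_bigr => i _; congr (_ * _).
  by rewrite -(gamE (Ordinal am)).
rewrite phiE; suff -> : x *m B + S = 0 by rewrite mxE.
apply/solE/rowP => a; rewrite SE mxE H //.
by apply: eq_bigr => i _; rewrite gamE.
Qed.

Lemma log_sum_sdiff (P : pred 'I_(l + n).+1) (w : 'I_(l + n).+1 -> R) (y : pt) :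
  (forall i, P i -> 0 < peval (p i) y) ->
  exists g, sdiff (fun z => \sum_(i | P i) w i * ln (peval (p i) z)) g y.
Proof.
move=> Py; exists (fun b => \sum_(i | P i) w i * ((peval (p i) y)^-1 * peval (mderiv b (p i)) y)).
apply: sdiff_sum => i Pi; apply: sdiffZ.
by apply: sdiff_comp (sdiff_peval _ _) (sdiff1_ln (Py i Pi)).
Qed.

(** Logarithms of the factors positive at [y] stay bounded, while by [near_small] that of a
    vanishing factor tends to minus infinity. The arguments at corners play these two facts against
    each other. *)
Lemma log_sum_bounded (P : pred 'I_(l + n).+1) (w : 'I_(l + n).+1 -> R) (y : pt) :
  (forall i, P i -> 0 < peval (p i) y) ->
  exists M : R, exists2 r : R, 0 < r & forall z, `|z - y| < r ->
    `|\sum_(i | P i) w i * ln (peval (p i) z)| <= M.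
Proof.
move=> /log_sum_sdiff-/(_ w)[g /sdiff_continuous/continuous_normP/(_ 1 ltr01)[r r0 rP]].
pose f z := \sum_(i | P i) w i * ln (peval (p i) z).
exists (`|f y| + 1), r => // z /rP H.
rewrite -/(f z) -(subrK (f y) (f z)) (le_trans (ler_normD _ _)) // addrC lerD2l.
exact: ltW.
Qed.

Lemma near_small (i : 'I_(l + n).+1) (y : pt) (M : R) : peval (p i) y = 0 ->
  exists2 r : R, 0 < r & forall z, `|z - y| < r -> 0 < peval (p i) z ->
    ln (peval (p i) z) < M.
Proof.
move=> py; have M0 := expR_gt0 M.
have /continuous_normP/(_ _ M0)[r r0 rP] := @peval_continuous _ _ (p i) y.
exists r => // z /rP; rewrite py subr0 => H pz.
by rewrite -(expRK M) ltr_ln ?posrE // (le_lt_trans (ler_norm _)).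
Qed.

Lemma closure_normP (A : set pt) (y : pt) :
  closure A y <-> forall r : R, 0 < r -> exists2 z, A z & `|z - y| < r.
Proof.
split=> [cA r r0|H B By].
  have [|z [Az zr]] := cA [set z | `|z - y| < r]; first by apply/nbhs_normP; exists r.
  by exists z.
have /nbhs_normP[r r0 rP] := By; have [z Az zr] := H _ r0.
by exists z; split=> //; exact: rP.
Qed.

Lemma closure_Delta_ge0 (y : pt) i : closure (Delta p) y -> 0 <= peval (p i) y.
Proof.
move=> /closure_normP cy; rewrite leNgt; apply/negP => py.
have d0 : 0 < - peval (p i) y by rewrite oppr_gt0.
have /continuous_normP/(_ _ d0)[r r0 rP] := @peval_continuous _ _ (p i) y.
have [z zD /rP] := cy _ r0; have := zD i; rewrite ltr_distl; lra.
Qed.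

Lemma closure_Cset_Delta k : closure (Cset p beta k) `<=` closure (Delta p).
Proof. by apply: closure_subset => y []. Qed.

Lemma closed_eq0 (A : set pt) (f : pt -> R) (y : pt) :
  {for y, continuous f} -> (forall z, A z -> f z = 0) -> closure A y -> f y = 0.
Proof.
move=> fc fA /closure_normP cy; apply/eqP; rewrite -normr_le0.
apply/ler_addgt0Pl => e e0; rewrite addr0.
have /continuous_normP/(_ _ e0)[r r0 rP] := fc.
by have [z /fA fz /rP] := cy _ r0; rewrite fz sub0r normrN => /ltW.
Qed.

Lemma CsetP (k : 'I_l) y : Delta p y -> Cset p beta k y <->
  (forall a : 'I_l, (a < k)%N -> phi p beta a y = 0) /\
  (forall a : 'I_l, (k < a)%N -> peval (J a) y = 0).
Proof.
move=> yD; split=> [[_ yC]|[h1 h2]].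
  split=> a ak.
    by have := yC a; rewrite mixedE // ltnS (ltnW ak) => -> //; rewrite -val_eqE neq_ltn ak.
  apply/(tildeJ_eq0 Jc a yD).
  by have := yC a; rewrite mixedE // ltnS leqNgt ak /= => -> //; rewrite -val_eqE neq_ltn ak orbT.
split=> // a; rewrite mixedE // ltnS -val_eqE neq_ltn => /orP[ak|ak].
  by rewrite (ltnW ak) h1.
by rewrite leqNgt ak; apply/(tildeJ_eq0 Jc a yD)/h2.
Qed.

Lemma closure_Cset_Delta_eq k y : Delta p y -> closure (Cset p beta k) y <-> Cset p beta k y.
Proof.
move=> yD; split=> [cy|]; last exact: subset_closure.
split=> // a ak; apply: (closed_eq0 (f := mixed p beta k.+1 a) _ _ cy).
  exact: sdiff_continuous (mixed_sdiff Jc a (ltn_ord k) yD).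
by move=> z [_ zC]; exact: zC.
Qed.

Lemma closure_Cset_J (k a : 'I_l) y : closure (Cset p beta k) y -> (k < a)%N -> peval (J a) y = 0.
Proof.
move=> cy ka; apply: (closed_eq0 (f := peval (J a)) _ _ cy); first exact: peval_continuous.
by move=> z zC; have zD := zC.1; have [_ ->] := (CsetP k zD).1 zC.
Qed.

Lemma enumerate_set (I : {set 'I_(l + n).+1}) : exists r : nat -> 'I_(l + n).+1,
  uniq (mkseq r #|I|) /\ mkseq r #|I| =i I.
Proof.
exists (nth ord0 (enum I)); rewrite cardE mkseq_nth; split; first exact: enum_uniq.
by move=> i; rewrite mem_enum.
Qed.

Hypothesis gen3 : forall (I : {set 'I_(l + n).+1}) y, (#|I| <= l)%N -> retained p J I y ->
  (forall i, i \notin I -> 0 < peval (p i) y) /\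
  (forall v : pt, (forall i, i \in I -> dmpoly (p i) y v = 0) ->
     (forall k : 'I_l, (#|I| <= k)%N -> dmpoly (J k) y v = 0) -> v = 0).

(** If at most [k] of the [p i] vanished at [y], [log_solve] would express the logarithm of a
    vanishing one by logarithms that remain bounded. So at least [k.+1] vanish, and any [k.+1] of
    them give an auxiliary system solved by [y]. *)
Lemma closure_Cset_found_T (k : 'I_l) y :
  closure (Cset p beta k) y -> ~ Delta p y -> found_T p J k y.
Proof.
move=> cy nyD; have cD := closure_Cset_Delta cy.
pose I : {set 'I_(l + n).+1} := finset.finset (fun i => peval (p i) y == 0).
have Ipos i : i \notin I -> 0 < peval (p i) y.
  by rewrite finset.inE => p0; rewrite lt_neqAle eq_sym p0 closure_Delta_ge0.
have [i1 i1I] : exists i, i \in I.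
  apply: contrapT => nI; apply: nyD => i; apply: Ipos; apply/negP => iI; apply: nI; by exists i.
have kI : (k < #|I|)%N.
  rewrite ltnNge; apply/negP => Ik.
  have [r [ur rI]] := enumerate_set I.
  have Il : (#|I| <= l)%N by apply: leq_trans (ltnW (ltn_ord k)).
  have [gam [gamP _]] := log_solve Il ur.
  have [a aI ra] : exists2 a, (a < #|I|)%N & r a = i1.
    by move: i1I; rewrite -rI => /mapP[a]; rewrite mem_iota /= => aI ->; exists a.
  have [M [s s0 sP]] := log_sum_bounded (P := fun i => i \notin mkseq r #|I|) (gam a)
    (fun i iI => Ipos i ltac:(by rewrite -rI)).
  have pa : peval (p (r a)) y = 0 by move: i1I; rewrite ra finset.inE => /eqP.
  have [t t0 tP] := near_small (- M) pa.
  have [|z zC] := (closure_normP _ _).1 cy (Num.min s t); first by rewrite lt_min s0.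
  rewrite lt_min => /andP[zs zt]; have zD := zC.1.
  have [zphi _] := (CsetP k zD).1 zC.
  have := (gamP _ zD).1 (fun b bI => zphi b (leq_trans bI Ik)) a aI.
  have := sP _ zs; have := tP _ zt (zD _); rewrite ler_norml => H1 /andP[H2 _] H3.
  by move: H1; rewrite H3; lra.
have [I' I'I cI'] : exists2 I' : {set 'I_(l + n).+1}, I' \subset I & #|I'| = k.+1.
  exists (finset.finset (fun i => i \in take k.+1 (enum I))).
    by apply/fintype.subsetP => i; rewrite finset.inE => /mem_take; rewrite mem_enum.
  rewrite cardsE; rewrite (card_uniqP (take_uniq _ (enum_uniq _))) size_takel //.
  by rewrite -cardE.
exists I'; split=> //; split.
  split=> [i /(fintype.subsetP I'I)|a]; first by rewrite finset.inE => /eqP.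
  by rewrite /= cI' => ka; apply: closure_Cset_J cy ka.
rewrite ifF; first by move=> i /=; apply: closure_Delta_ge0.
by apply/negbTE; rewrite -card_gt0 cI'.
Qed.

Lemma found_T_not_Delta (k : 'I_l) y : found_T p J k y -> ~ Delta p y.
Proof.
move=> [I [cI [[yI _] _]]] yD.
have [i iI] : exists i, i \in I by apply/set0Pn; rewrite -card_gt0 cI.
by have := yD i; rewrite yI // ltxx.
Qed.

Lemma powR_cont_on (b : R) : 0 < b -> cont_on [set x : R | 0 <= x] (fun x => x `^ b).
Proof.
move=> b0 x /=; rewrite le_eqVlt => /orP[/eqP<-|x0] e e0.
  exists (e `^ b^-1); first exact: powR_gt0.
  move=> y y0; rewrite subr0 (ger0_norm y0) powR0 ?gt_eqF // subr0 (ger0_norm (powR_ge0 _ _)) => ye.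
  rewrite -[ltRHS](powRr1 (ltW e0)) -(mulVf (lt0r_neq0 b0)) powRrM.
  by rewrite gt0_ltr_powR // ?nnegrE // powR_ge0.
have c : {for x, continuous (fun x => expR (b * ln x))}.
  apply: (@continuous_comp _ _ _ (fun x : R => b * ln x) expR); last exact: continuous_expR.
  by apply: cvgMr => //; exact: continuous_ln.
have /continuous_normP/(_ _ e0)[r r0 rP] := c.
exists (Num.min r x); first by rewrite lt_min r0.
move=> y _; rewrite lt_min => /andP[yr]; rewrite ltr_distl subrr => /andP[y0 _].
by rewrite /powR !gt_eqF //; apply: rP.
Qed.

(** With positive exponents only, the product stays continuous up to the boundary; this is why
    [fdiff] replaces [phi] there. *)
Lemma psi_part_cont_on (P : pred 'I_(l + n).+1) (w : 'I_(l + n).+1 -> R) :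
  (forall i, P i -> 0 < w i) ->
  cont_on (closure (Delta p)) (fun y : pt => \prod_(i | P i) (peval (p i) y `^ w i)).
Proof.
move=> Pw; apply/cont_onP.
elim: (index_enum _) => [|i s IH].
  by rewrite (_ : (fun y : pt => _) = cst 1) ?funeqE => [|y]; [exact: cst_continuous|rewrite big_nil].
case: (boolP (P i)) => Pi; last first.
  rewrite (_ : (fun y : pt => _) = fun y => \big[GRing.mul/1]_(i <- s | P i) (peval (p i) y `^ w i)) //.
  by apply/funext => y; rewrite big_cons (negPf Pi).
rewrite (_ : (fun y : pt => _) = fun y => (peval (p i) y `^ w i) *
    \big[GRing.mul/1]_(i <- s | P i) (peval (p i) y `^ w i)); last first.
  by apply/funext => y; rewrite big_cons Pi.
apply/subspace_continuousP => x0 x0D; apply: cvgM; last by move/subspace_continuousP: IH; apply.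
suff /cont_onP/subspace_continuousP : cont_on (closure (Delta p)) (fun y => peval (p i) y `^ w i) by apply.
move=> {x0 x0D} x xD e e0.
have [r r0 rP] := powR_cont_on (Pw _ Pi) (closure_Delta_ge0 i xD) e0.
have /continuous_normP/(_ _ r0)[t t0 tP] := @peval_continuous _ _ (p i) x.
exists t => // y yD yx; apply: rP; first exact: closure_Delta_ge0.
exact: tP.
Qed.

Lemma fdiff_eq0 (a : 'I_l) (y : pt) : Delta p y -> phi p beta a y = 0 -> fdiff p beta a y = 0.
Proof.
move=> yD ph0.
have partE (P : pred 'I_(l + n).+1) (w : 'I_(l + n).+1 -> R) :
    \prod_(i | P i) (peval (p i) y `^ w i) = expR (\sum_(i | P i) w i * ln (peval (p i) y)).
  by rewrite expR_sum; apply: eq_bigr => i _; rewrite /powR gt_eqF.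
apply/eqP; rewrite subr_eq0 /psi_plus /psi_minus !partE; apply/eqP; congr expR.
apply/eqP; rewrite -subr_eq0; apply/eqP; rewrite -[RHS]ph0 /phi.
rewrite [RHS](bigID (fun i => 0 < beta i a)) /= -sumrN; congr (_ + _).
rewrite [RHS](bigID (fun i => beta i a < 0)) /= [X in _ = _ + X]big1 ?addr0; last first.
  by move=> i /andP[]; rewrite -!leNgt => h1 h2; rewrite (@le_anti _ _ (beta i a) 0) ?h1 ?mul0r.
apply: eq_big => [i|i _]; last by rewrite mulNr opprK.
by case: (ltP (beta i a) 0) => h; rewrite ?andbF // andbT -leNgt ltW.
Qed.

Lemma closure_Cset_Tset (k : 'I_l) y :
  closure (Cset p beta k) y -> boundary_Delta p y -> Tset p beta J k y.
Proof.
move=> cy yb; split=> //; split=> a ak; last exact: closure_Cset_J cy ak.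
have cD := closure_Cset_Delta cy.
have fc : cont_on (closure (Delta p)) (fdiff p beta a).
  have h1 := psi_part_cont_on (P := fun i => 0 < beta i a) (w := fun i => beta i a) (fun i => id).
  have h2 := psi_part_cont_on (P := fun i => beta i a < 0) (w := fun i => - beta i a)
    (fun i h => ltac:(by rewrite oppr_gt0)).
  apply/cont_onP => x; apply: continuousB; [move: x; apply/cont_onP; exact: h1|move: x; apply/cont_onP; exact: h2].
apply/eqP; rewrite -normr_le0; apply/ler_addgt0Pl => e e0; rewrite addr0.
have [r r0 rP] := fc _ cD _ e0.
have [z zC zy] := (closure_normP _ _).1 cy _ r0; have zD := zC.1.
have [zphi _] := (CsetP k zD).1 zC.
have := rP z (subset_closure zD) zy; rewrite fdiff_eq0 ?zphi // sub0r normrN; exact: ltW.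
Qed.

(** The power extended to negative arguments: evenly, except for exponent 1, where the even
    extension would have a kink and the identity is taken. *)
Definition spow (r x : R) : R := if r == 1 then x else `|x| `^ r.

Lemma spow_sdiff r : 1 <= r -> sdiff1 (spow r) (if r == 1 then 1 else 0) 0.
Proof.
rewrite le_eqVlt eq_sym /spow; case: eqVneq => [_ _ e e0|_ /= r1]; last exact: sdiff1_norm_powR.
by exists 1 => // x y _ _; rewrite mul1r subrr normr0 mulr_ge0 // ltW.
Qed.

Lemma spow0 r : 1 <= r -> spow r 0 = 0.
Proof.
move=> r1; rewrite /spow; case: eqP => // _; rewrite normr0 powR0 //.
by rewrite gt_eqF // (lt_le_trans ltr01).
Qed.

Lemma spow_pos r x : 0 < x -> spow r x = expR (r * ln x).
Proof.
move=> x0; rewrite /spow; case: eqP => [->|_]; first by rewrite mul1r lnK.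
by rewrite gtr0_norm // /powR gt_eqF.
Qed.

(** * Equations of the curve at one corner *)

Section Corner.
Variables (k : 'I_l) (t : pt) (I : {set 'I_(l + n).+1}).
Hypothesis cI : #|I| = k.+1.
Hypothesis It : retained p J I t.
Hypothesis ct : closure (Cset p beta k) t.

Let pI i : i \in I -> peval (p i) t = 0. Proof. by case: It => -[h _] _; exact: h. Qed.
Let Il : (#|I| <= l)%N. Proof. by rewrite cI. Qed.
Let pnI i : i \notin I -> 0 < peval (p i) t. Proof. exact: (gen3 Il It).1. Qed.

(** At each curve point some vanishing factor is the largest; by finiteness one index is the largest
    at points arbitrarily close to [t]. *)
Lemma dominant_index : exists2 i0, i0 \in I & forall r : R, 0 < r ->
  exists y, [/\ Cset p beta k y, `|y - t| < r &
    forall j, j \in I -> peval (p j) y <= peval (p i0) y].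
Proof.
apply: contrapT => H.
have /choice[r rP] : forall i, exists r : R, 0 < r /\ (i \in I -> forall y, Cset p beta k y ->
    `|y - t| < r -> ~ forall j, j \in I -> peval (p j) y <= peval (p i) y).
  move=> i; have [iI|niI] := boolP (i \in I); last by exists 1.
  apply: contrapT => H2; apply: H; exists i => // r r0; apply: contrapT => H3.
  by apply: H2; exists r; split=> // _ y yC yt yj; apply: H3; exists y.
have m0 : 0 < \big[Num.min/1]_i r i by apply/bigmin_gtP; split=> // i _; case: (rP i).
have [y yC /bigmin_gtP[_ yr]] := (closure_normP _ _).1 ct _ m0.
have [i1 i1I] : exists i, i \in I by apply/set0Pn; rewrite -card_gt0 cI.
have [i iI imax] := arg_maxP (fun i => peval (p i) y) i1I.
exact: ((rP i).2 iI y yC (yr i isT) imax).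
Qed.

(* Near the corner [t] the curve is given by the equations
   [p_(r a) = p_i0 ^ rho_a * exp (H_a)], where [H_a] is smooth at [t].
   Since [p_i0] is frequently the largest of the [p_i] vanishing at [t], all
   [rho_a] are at least [1], so that these equations are strictly
   differentiable at [t]. *)
Lemma corner_equations : exists i0 (r : nat -> 'I_(l + n).+1) (gam : nat -> 'I_(l + n).+1 -> R),
  [/\ i0 \in I, uniq (mkseq r k), forall i, (i \in mkseq r k) = (i \in I) && (i != i0),
    forall a, (a < k)%N -> 1 <= gam a i0 &
    (forall y, Delta p y -> (forall b : 'I_l, (b < k)%N -> phi p beta b y = 0) <->
      (forall a, (a < k)%N -> ln (peval (p (r a)) y) =
        gam a i0 * ln (peval (p i0) y) + \sum_(i | i \notin I) gam a i * ln (peval (p i) y))) /\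
    (forall i (b : 'I_l), (b < k)%N -> beta i b + \sum_(a < k) gam a i * beta (r a) b = 0)].
Proof.
have [i0 i0I dom] := dominant_index.
have cI0 : #|finset.setD I (finset.set1 i0)| = k by have := cardsD1 i0 I; rewrite i0I cI => -[].
have [r] := enumerate_set (finset.setD I (finset.set1 i0)); rewrite cI0 => -[ur rI].
have rIE i : (i \in mkseq r k) = (i \in I) && (i != i0) by rewrite rI !finset.inE andbC.
have [gam [gamP gamB]] := log_solve (ltnW (ltn_ord k)) ur.
have sumE a y : \sum_(i | i \notin mkseq r k) gam a i * ln (peval (p i) y) =
    gam a i0 * ln (peval (p i0) y) + \sum_(i | i \notin I) gam a i * ln (peval (p i) y).
  rewrite (bigD1 i0) /=; last by rewrite rIE eqxx andbF.
  congr (_ + _); apply: eq_bigl => i; rewrite rIE negb_and negbK.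
  by case: eqVneq => [->|_]; rewrite ?i0I ?andbF ?orbF ?andbT.
have {}gamP y : Delta p y -> (forall b : 'I_l, (b < k)%N -> phi p beta b y = 0) <->
      (forall a, (a < k)%N -> ln (peval (p (r a)) y) =
        gam a i0 * ln (peval (p i0) y) + \sum_(i | i \notin I) gam a i * ln (peval (p i) y)).
  by move=> yD; split=> [h a ak|h]; [rewrite -sumE; exact: (gamP _ yD).1|
    apply/(gamP _ yD) => a ak; rewrite sumE h].
(* With an exponent below 1, [p (r a)] would exceed [p i0] near the corner, against the choice of
   [i0]. The bound [- M / (1 - gam a i0)] is where the power outweighs the bounded part [M]. *)
exists i0, r, gam; split=> // a ak; rewrite leNgt; apply/negP => rho1.
have [M [s s0 sP]] := log_sum_bounded (P := fun i => i \notin I) (gam a) pnI.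
have [w w0 wP] := near_small (- M / (1 - gam a i0)) (pI i0I).
have m0 : 0 < Num.min s w by rewrite lt_min s0.
have [y [yC + ymax]] := dom _ m0; rewrite lt_min => /andP[ys yw]; have yD := yC.1.
have [yphi _] := (CsetP k yD).1 yC.
have raI : r a \in I.
  have : r a \in mkseq r k by apply/mapP; exists a; rewrite // mem_iota.
  by rewrite rIE => /andP[].
have := (gamP _ yD).1 yphi a ak; have := wP _ yw (yD _).
have := ymax _ raI; rewrite -ler_ln ?posrE ?yD // => H1 H2 H3; move: H1; rewrite H3.
move: H2; rewrite ltr_pdivlMr ?subr_gt0 //.
have := sP _ ys; rewrite ler_norml => /andP[H4 _].
lra.
Qed.

(** The curve is parametrized by [p i0], and only the half [p i0 >= 0] of the chart belongs to its
    closure, hence the end point. On the curve [phi k] is a nonzero multiple of [ln (p i0)] plus a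
    bounded function, which gives its limit after squashing. *)
Lemma corner_chart (X : set pt) :
  (forall y, Delta p y -> X y <-> Cset p beta k y) -> X t ->
  (exists2 r : R, 0 < r & forall y, X y -> `|y - t| < r -> y <> t -> Delta p y) ->
  chart_at X false t /\
  exists s : R, `|s| = 1 /\ forall e : R, 0 < e -> exists2 r : R, 0 < r &
    forall y, Cset p beta k y -> `|y - t| < r -> `|squash (phi p beta k y) - s| < e.
Proof.
move=> XC Xt [r1 r10 Xiso].
have [i0 [r [gam [i0I ur rI rho1 [gamP gamB]]]]] := corner_equations.
have rIa a : (a < k)%N -> r a \in I.
  move=> ak; have : r a \in mkseq r k by apply/mapP; exists a; rewrite // mem_iota.
  by rewrite rI => /andP[].
have [_ transv] := gen3 Il It.
pose H a (y : pt) := \sum_(i | i \notin I) gam a i * ln (peval (p i) y).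
have /choice[dH dHP] : forall a : nat, exists g, sdiff (H a) g t.
  by move=> a; exact: log_sum_sdiff pnI.
pose F (y : pt) : pt := \row_a (if (a < k)%N then
    peval (p (r a)) y + (-1) * (spow (gam a i0) (peval (p i0) y) * expR (H a y))
  else if a == k then peval (p i0) y else peval (J a) y).
(* The derivative at the corner of the power factor as a function of [p i0]: only exponent 1
   contributes. *)
pose kap (a : 'I_l) : R := (if gam a i0 == 1 then 1 else 0) * expR (H a t).
pose G (a : 'I_l) : 'I_l -> R := if (a < k)%N then
    fun b => peval (mderiv b (p (r a))) t + - kap a * peval (mderiv b (p i0)) t
  else if a == k then fun b => peval (mderiv b (p i0)) t else fun b => peval (mderiv b (J a)) t.
have Fd a : sdiff (fun y => F y 0 a) (G a) t.
  have -> : (fun y => F y 0 a) = fun y => (if (a < k)%N then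
    peval (p (r a)) y + (-1) * (spow (gam a i0) (peval (p i0) y) * expR (H a y))
    else if a == k then peval (p i0) y else peval (J a) y) by apply/funext => y; rewrite mxE.
  rewrite /G; case: ifP => ak; last by case: ifP => _; exact: sdiff_peval.
  have h1 : sdiff1 (spow (gam a i0)) (if gam a i0 == 1 then 1 else 0) (peval (p i0) t).
    by rewrite pI //; apply: spow_sdiff; exact: rho1.
  have h2 := sdiffM (sdiff_comp (sdiff_peval (p i0) t) h1) (sdiff_comp (dHP a) (sdiff1_expR _)).
  have h3 := sdiffD (sdiff_peval (p (r a)) t) (sdiffZ (-1) h2).
  apply: eq_sdiff h3 => b; rewrite pI // spow0 ?rho1 // mul0r addr0 /kap; ring.
(* Modulo the differential of [p i0] the first [k] rows are the differentials of the [p (r a)], so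
   transversality of the auxiliary system applies. *)
have Ginj v : (forall a, dot (G a) v = 0) -> v = 0.
  move=> Gv; have Gk : dmpoly (p i0) t v = 0.
    by rewrite dmpolyE -(Gv k) /G ltnn eqxx.
  apply: transv => [i iI|a]; last first.
    rewrite cI => ka; rewrite dmpolyE -(Gv a) /G ltnNge (ltnW ka) /= ifF //.
    by apply/negbTE; rewrite -val_eqE neq_ltn ka orbT.
  have [->//|ii0] := eqVneq i i0.
  have : i \in mkseq r k by rewrite rI iI.
  move=> /mapP[a]; rewrite mem_iota /= => ak ->.
  have al : (a < l)%N by apply: ltn_trans (ltn_ord k).
  have := Gv (Ordinal al); rewrite /G /= ak dotD.
  by rewrite (dotZ (- kap (Ordinal al)) (fun b => peval (mderiv b (p i0)) t)) -!dmpolyE Gk mulr0 addr0.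
have Ft : F t = 0.
  apply/rowP => a; rewrite !mxE; case: ifP => ak.
    by rewrite !pI ?rIa // spow0 ?rho1 // mul0r mulr0 addr0.
  case: eqP => [_|/eqP ak']; first by rewrite pI.
  case: It => -[_ h] _; apply: h; rewrite cI.
  by rewrite ltn_neqAle eq_sym val_eqE ak' leqNgt ak.
have [rho rho0 rhoP] : exists2 rho : R, 0 < rho & forall y, `|y - t| < rho ->
    forall i, i \notin I -> 0 < peval (p i) y.
  have /choice[q qP] : forall i, exists q : R, 0 < q /\ (i \notin I -> forall z, `|z - t| < q -> 0 < peval (p i) z).
    move=> i; have [iI|niI] := boolP (i \in I); first by exists 1.
    have /continuous_normP/(_ _ (pnI niI))[q q0 qP] := @peval_continuous _ _ (p i) t.
    by exists q; split=> // _ z /qP; rewrite ltr_distl subrr => /andP[].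
  exists (\big[Num.min/1]_i q i); first by apply/bigmin_gtP; split=> // i _; case: (qP i).
  by move=> z /bigmin_gtP[_ zr] i iI; apply: (qP i).2 => //; apply: zr.
(* Positivity of [p i0] is enough to be in [Delta]: the other vanishing factors are exponentials by
   their equations, and the remaining ones are positive near [t]. *)
have FC y : `|y - t| < rho -> 0 < peval (p i0) y -> (forall a, a != k -> F y 0 a = 0) ->
    Cset p beta k y.
  move=> yrho p0 Fy.
  have pra a : (a < k)%N -> peval (p (r a)) y = expR (gam a i0 * ln (peval (p i0) y) + H a y).
    move=> ak; have al : (a < l)%N by apply: ltn_trans (ltn_ord k).
    have := Fy (Ordinal al); rewrite -val_eqE neq_ltn /= ak => /(_ isT).
    by rewrite mxE /= ak spow_pos // -expRD => H1; apply/eqP; rewrite -subr_eq0 -mulN1r H1.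
  have yD : Delta p y.
    move=> i; have [iI|niI] := boolP (i \in I); last exact: rhoP.
    have [->//|ii0] := eqVneq i i0.
    have : i \in mkseq r k by rewrite rI iI.
    by move=> /mapP[a]; rewrite mem_iota /= => ak ->; rewrite pra // expR_gt0.
  apply/CsetP => //; split.
    by apply/(gamP _ yD) => a ak; rewrite pra // expRK.
  move=> a ka; have := Fy a; rewrite -val_eqE neq_ltn ka orbT => /(_ isT).
  by rewrite mxE ltnNge (ltnW ka) /= ifF // -val_eqE; apply/negbTE; rewrite neq_ltn ka orbT.
have CF y : Cset p beta k y -> forall a, a != k -> F y 0 a = 0.
  move=> yC a ak; have yD := yC.1; have [yphi yJ] := (CsetP k yD).1 yC.
  rewrite mxE (negPf ak); case: ifP => alt.
    by rewrite spow_pos // -expRD -((gamP _ yD).1 yphi a alt) lnK ?posrE // mulN1r subrr.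
  by apply: yJ; rewrite ltn_neqAle eq_sym val_eqE ak leqNgt alt.
have [e e0 [c [cc cP c0 cnear]]] := curve_chart k rho0 Ft Fd Ginj.
have Fk y : F y 0 k = peval (p i0) y by rewrite mxE ltnn eqxx.
have Fc x : `|x| < e -> F (c x) 0 k = x.
  by move=> /cP[_ /rowP/(_ k)]; rewrite [RHS]mxE [X in _ = _ * X]mxE !eqxx mulr1.
have dom x : chart_dom false e x -> `|x| < e /\ 0 <= x by case=> h1 [].
split.
  exists e => //; exists c; split=> //.
  - by apply: cont_onS cc => x /dom[].
  - by move=> x y /dom[xe _] /dom[ye _] cxy; rewrite -(Fc _ xe) cxy Fc.
  - move=> x /dom[xe]; rewrite le_eqVlt => /orP[/eqP<-|x0]; first by rewrite c0.
    have [cq cF] := cP _ xe.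
    have : Cset p beta k (c x).
      apply: FC => //; first by rewrite -Fk Fc.
      move=> a ak; rewrite cF mxE [X in _ * X]mxE (negPf ak) andbF mulr0 //.
    by move=> cC; apply/XC => //; case: cC.
  - move=> eta eta0; have m0 : 0 < Num.min e eta by rewrite lt_min e0.
    have [s s0 sP] := cnear _ m0; exists (Num.min s r1); first by rewrite lt_min s0.
    move=> y Xy; rewrite lt_min => /andP[ys yr1].
    have [->|/eqP yt] := eqVneq y t.
      by exists 0; rewrite c0 normr0; split=> //; split; [rewrite normr0|right].
    have yD := Xiso _ Xy yr1 yt; have yC := (XC _ yD).1 Xy.
    have [] := sP _ ys (CF _ yC); rewrite lt_min => /andP[ye yeta] cE.
    exists (F y 0 k); split=> //; split=> //; right; rewrite Fk; exact: ltW.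
(* The coefficient of [ln (p i0)] in [phi k] along the curve. *)
pose kp := beta i0 k + \sum_(a < k) gam a i0 * beta (r a) k.
have kp0 : kp != 0.
  have [kl k1l] : (k <= l)%N /\ (k < l)%N by split; [apply: ltnW|].
  pose r' (a : 'I_k.+1) := if (a < k)%N then r a else i0.
  have r'inj : injective r'.
    have rin a : (a < k)%N -> r a != i0.
      move=> ak; have : r a \in mkseq r k by apply/mapP; exists a; rewrite // mem_iota.
      by rewrite rI => /andP[].
    move=> a b; rewrite /r'; case: ltnP => ak; case: ltnP => bk E0; apply: val_inj => /=.
    - apply/eqP; rewrite -(nth_uniq i0 _ _ ur) ?size_mkseq //.
      by rewrite !nth_mkseq // E0.
    - by have := rin _ ak; rewrite E0 eqxx.
    - by have := rin _ bk; rewrite -E0 eqxx.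
    - by apply/eqP; rewrite eqn_leq (leq_trans _ bk) ?(leq_trans _ ak) // -ltnS.
  (* If [kp] were 0, the row of the exponents followed by 1 would be in the left kernel of the minor
     on [r] and [i0]: columns below [k] vanish by the elimination identity, column [k] because it
     gives [kp]. *)
  apply: contraNneq (minors k1l r'inj) => kp00; apply/det0P.
  exists (\row_a (if (a < k)%N then gam a i0 else 1)).
    apply/eqP => /rowP/(_ ord_max); rewrite !mxE /= ltnn => /eqP; rewrite oner_eq0 //.
  apply/rowP => b; rewrite !mxE big_ord_recr /= !mxE ltnn mul1r /r' ltnn.
  have bk : (b <= k)%N by rewrite -ltnS.
  set b' := widen_ord _ _.
  rewrite (eq_bigr (fun a : 'I_k => gam a i0 * beta (r a) b')); last first.
    by move=> a _; rewrite !mxE /= ltn_ord.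
  rewrite addrC; move: bk; rewrite leq_eqVlt => /orP[/eqP bk|bk]; last by rewrite gamB.
  by rewrite (_ : b' = k) //; apply: val_inj.
pose W i := beta i k + \sum_(a < k) gam a i * beta (r a) k.
have phiE y : Cset p beta k y -> phi p beta k y =
    kp * ln (peval (p i0) y) + \sum_(i | i \notin I) W i * ln (peval (p i) y).
  move=> yC; have yD := yC.1; have [yphi _] := (CsetP k yD).1 yC.
  have lnr := (gamP _ yD).1 yphi.
  rewrite /phi (bigID (mem I)) /= (bigD1 i0) //=.
  have -> : \sum_(i in I | i != i0) beta i k * ln (peval (p i) y) =
      \sum_(a < k) beta (r a) k * ln (peval (p (r a)) y).
    rewrite (eq_bigl (mem (mkseq r k))) => [|i]; last by rewrite /= rI.
    by rewrite -(big_uniq _ ur) /= /mkseq big_map -[X in iota 0 X]subn0 -/(index_iota 0 k) big_mkord.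
  rewrite (eq_bigr (fun a : 'I_k => gam a i0 * beta (r a) k * ln (peval (p i0) y) +
     \sum_(i | i \notin I) gam a i * beta (r a) k * ln (peval (p i) y))); last first.
    move=> a _; rewrite lnr // mulrDr mulr_sumr; congr (_ + _); first by ring.
    by apply: eq_bigr => i _; ring.
  rewrite big_split /= exchange_big /= /kp mulrDl mulr_suml -!addrA; congr (_ + (_ + _)).
  rewrite addrC -big_split /=; apply: eq_bigr => i _.
  by rewrite /W mulrDl mulr_suml.
exists (- Num.sg kp); split; first by rewrite normrN normr_sg kp0.
move=> d d0.
have [M [s s0 sP]] := log_sum_bounded (P := fun i => i \notin I) W pnI.
have kn0 : 0 < `|kp| by rewrite normr_gt0.
have [w w0 wP] := near_small (- ((d^-1 + M) / `|kp|)) (pI i0I).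
exists (Num.min s w); first by rewrite lt_min s0.
move=> y yC; rewrite lt_min => /andP[ys yw]; have yD := yC.1.
have := wP _ yw (yD _); rewrite ltrNr ltr_pdivrMr // => H1.
have := sP _ ys; rewrite ler_norml => /andP[H2 H3].
have di0 : 0 < d^-1 by rewrite invr_gt0.
have phE := phiE _ yC; move: H2 H3 phE; set S := \sum_(i | _) _; set f := phi _ _ _ _ => H2 H3 phE.
have sqlt x : d^-1 < x -> `|squash x - 1| < d.
  move=> dx; have x0 : 0 < x by apply: lt_trans dx.
  rewrite /squash (gtr0_norm x0) (_ : _ - 1 = - (1 + x)^-1); last first.
    by field; rewrite gt_eqF // addr_gt0.
  rewrite normrN gtr0_norm ?invr_gt0 ?addr_gt0 // invf_plt ?posrE ?addr_gt0 //.
  by rewrite (lt_trans dx) // ltrDr.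
have sqN x : squash (- x) = - squash x by rewrite /squash normrN mulNr.
have [kp_lt|kp_ge] := ltP kp 0.
  rewrite ltr0_sg // opprK; apply: sqlt; rewrite phE.
  by move: H1; rewrite ltr0_norm //; lra.
have kp_gt : 0 < kp by rewrite lt_neqAle eq_sym kp0.
rewrite gtr0_sg // -normrN opprB addrC -sqN; apply: sqlt; rewrite phE.
by move: H1; rewrite gtr0_norm //; lra.
Qed.

End Corner.

End Corners.

(** * Bezout's bound for nondegenerate zeros *)

Section DegreeBounds.
Context {R : realType} {m : nat}.
Implicit Types (q : mpoly m R).

(** [mmeasure] is one more than the degree and 0 for the zero polynomial, which thus satisfies every
    bound. *)
Definition deg_le q (k : nat) := (mmeasure (@mdeg m) q <= k.+1)%N.

Lemma degree_le q k : (degree q <= k)%N -> deg_le q k.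
Proof. by rewrite /degree /deg_le; case: mmeasure. Qed.

Lemma deg_le_degree q k : deg_le q k -> (degree q <= k)%N.
Proof. by rewrite /degree /deg_le; case: mmeasure. Qed.

Lemma deg_leW q k k' : deg_le q k -> (k <= k')%N -> deg_le q k'.
Proof. by move=> qk kk'; apply: leq_trans qk _. Qed.

Lemma deg_leC c k : deg_le (mpolyC m c) k.
Proof. by rewrite /deg_le msizeC; case: (c == 0). Qed.

Lemma deg_le0 k : deg_le 0 k.
Proof. by rewrite /deg_le mmeasure0. Qed.

Lemma deg_le1 k : deg_le 1 k.
Proof. by rewrite -mpolyC1; exact: deg_leC. Qed.

Lemma deg_leD q q' k : deg_le q k -> deg_le q' k -> deg_le (q + q') k.
Proof.
by rewrite /deg_le => qk qk'; apply: leq_trans (mmeasureD_le _ _ _) _; rewrite geq_max qk.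
Qed.

Lemma deg_le_sum (I : Type) (s : seq I) (P : pred I) (F : I -> mpoly m R) k :
  (forall i, P i -> deg_le (F i) k) -> deg_le (\sum_(i <- s | P i) F i) k.
Proof.
move=> Fk; apply: (big_ind (fun q => deg_le q k)) => //; first exact: deg_le0.
by move=> q q'; exact: deg_leD.
Qed.

Lemma deg_leM q q' k k' : deg_le q k -> deg_le q' k' -> deg_le (q * q') (k + k').
Proof.
move=> qk qk'; have [->|q0] := eqVneq q 0; first by rewrite mul0r deg_le0.
have [->|q'0] := eqVneq q' 0; first by rewrite mulr0 deg_le0.
rewrite /deg_le msizeM // -subn1 leq_subLR.
by apply: leq_trans (leq_add qk qk') _; rewrite addSn addnS.
Qed.

Lemma deg_leZ c q k : deg_le q k -> deg_le (c *: q) k.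
Proof. by move=> qk; rewrite -mul_mpolyC -[k]add0n; apply: deg_leM => //; exact: deg_leC. Qed.

Lemma deg_leX q k e : deg_le q k -> deg_le (q ^+ e) (k * e).
Proof.
move=> qk; elim: e => [|e IH]; first by rewrite expr0 deg_le1.
by rewrite exprS mulnS; exact: deg_leM.
Qed.

Lemma deg_le_prod (I : Type) (s : seq I) (P : pred I) (F : I -> mpoly m R) (k : I -> nat) :
  (forall i, P i -> deg_le (F i) (k i)) ->
  deg_le (\prod_(i <- s | P i) F i) (\sum_(i <- s | P i) k i).
Proof.
move=> Fk; elim/big_rec2: _ => [|i k' q Pi IH]; first exact: deg_le1.
by apply: deg_leM => //; exact: Fk.
Qed.

Lemma deg_le_var i : deg_le (mpolyX R (mnm1 i)) 1.
Proof. by rewrite /deg_le msizeX mdeg1. Qed.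

Lemma deg_le_coeff q k a : deg_le q k -> (k < mdeg a)%N -> mcoeff a q = 0.
Proof.
move=> qk ka; apply/eqP; rewrite mcoeff_eq0; apply: msize_mdeg_ge.
exact: leq_trans ka.
Qed.

Lemma deg_leP q k : (forall a, (k < mdeg a)%N -> mcoeff a q = 0) -> deg_le q k.
Proof.
move=> H; rewrite /deg_le mmeasureE; apply/bigmax_leqP_seq => a aq _.
rewrite ltnNge; apply/negP => ka; move: aq.
by rewrite mcoeff_msupp H ?eqxx.
Qed.

(** A coefficient of positive order is, up to a nonzero integer factor, a coefficient of smaller
    order of a partial derivative, and that derivative vanishes everywhere too. *)
Lemma peval_eq0 q : (forall y, peval q y = 0) -> q = 0.
Proof.
move=> q0; apply/mpolyP => a; rewrite mcoeff0.
have [k] := ubnP (mdeg a); elim: k => // k IH in a q q0 *.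
have [->|/eqP a0] := eqVneq a (mnm0 (n := m)).
  move=> _; have Z (b : multinom m) : \prod_(i < m) ((0 : 'rV[R]_m) 0 i) ^+ b i = (b == mnm0)%:R.
    have [->|b0] := eqVneq b mnm0.
      by apply: big1 => i _; rewrite mnm0E expr0.
    have [i bi] : exists i, b i != 0%N.
      apply/existsP; rewrite -negb_forall; apply: contra b0 => /forallP b0.
      by apply/eqP/mnmP => i; rewrite mnm0E; apply/eqP.
    by rewrite (bigD1 i) //= mxE expr0n (negPf bi) mul0r.
  rewrite -(q0 0) /peval mevalE (eq_bigr (fun b => mcoeff b q * (b == mnm0)%:R)); last first.
    by move=> b _; rewrite Z.
  rewrite {1}(mpolyE q) raddf_sum /=; apply: eq_bigr => b _.
  by rewrite mcoeffZ mcoeffX.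
have [i ai] : exists i, a i != 0%N.
  apply/existsP; rewrite -negb_forall; apply/negP => /forallP b0; apply: a0.
  by apply/mnmP => i; rewrite mnm0E; apply/eqP.
have aE : a = mnm_add (mnm_sub a (mnm1 i)) (mnm1 i) by rewrite submK // lep1mP.
rewrite {1}aE mdegD mdeg1 addn1 ltnS => ak.
have dq0 y : peval (mderiv i q) y = 0.
  have h1 := sdiff_derive i (sdiff_peval q y); rewrite -h1.
  have -> : peval q = fun=> 0 by apply/funext.
  by rewrite (sdiff_derive i (sdiff_cst 0 y)).
have := IH _ _ dq0 ak; rewrite mcoeff_deriv -aE => /eqP.
by rewrite mulrn_eq0 /= => /eqP.
Qed.

(** Restriction of [q] to the line through [a] with direction [v], as a polynomial in the parameter
    of the line. *)
Definition along (a v : 'rV[R]_m) q : {poly R} :=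
  mmap (@polyC R) (fun i => (a 0 i)%:P + v 0 i *: 'X) q.

Lemma alongD a v q q' : along a v (q + q') = along a v q + along a v q'.
Proof. exact: rmorphD. Qed.
Lemma alongM a v q q' : along a v (q * q') = along a v q * along a v q'.
Proof. exact: rmorphM. Qed.
Lemma along_sum a v (I : Type) (s : seq I) (P : pred I) (F : I -> mpoly m R) :
  along a v (\sum_(i <- s | P i) F i) = \sum_(i <- s | P i) along a v (F i).
Proof. exact: rmorph_sum. Qed.
Lemma along_prod a v (I : Type) (s : seq I) (P : pred I) (F : I -> mpoly m R) :
  along a v (\prod_(i <- s | P i) F i) = \prod_(i <- s | P i) along a v (F i).
Proof. exact: rmorph_prod. Qed.
Lemma alongXn a v q k : along a v (q ^+ k) = along a v q ^+ k.
Proof. exact: rmorphXn. Qed.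

Lemma alongZ a v c q : along a v (c *: q) = c *: along a v q.
Proof. by rewrite /along mmapZ mul_polyC. Qed.

Lemma along_expansion a v q : exists g : {poly R},
  along a v q = (peval q a)%:P + 'X * g /\ g.[0] = dmpoly q a v.
Proof.
pose Q q := exists g : {poly R},
  along a v q = (peval q a)%:P + 'X * g /\ g.[0] = dmpoly q a v.
have QD q1 q2 : Q q1 -> Q q2 -> Q (q1 + q2).
  move=> [g1 [e1 h1]] [g2 [e2 h2]]; exists (g1 + g2).
  rewrite alongD e1 e2 pevalD polyCD hornerD h1 h2; split; first by ring.
  by rewrite /dmpoly -big_split; apply: eq_bigr => i _; rewrite mderivD pevalD mulrDl.
have QM q1 q2 : Q q1 -> Q q2 -> Q (q1 * q2).
  move=> [g1 [e1 h1]] [g2 [e2 h2]].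
  exists (g1 * (peval q2 a)%:P + (peval q1 a)%:P * g2 + 'X * g1 * g2).
  rewrite alongM e1 e2 pevalM polyCM !hornerE h1 h2; split; first by ring.
  rewrite /dmpoly mulr_suml mulr_sumr -big_split; apply: eq_bigr => i _ /=.
  by rewrite mderivM pevalD !pevalM; ring.
have QC c : Q (mpolyC m c).
  exists 0; rewrite /along mmapC /peval mevalC mulr0 addr0 horner0; split=> //.
  by rewrite /dmpoly big1 // => i _; rewrite mderivC peval0 mul0r.
have QX i : Q (mpolyX R (mnm1 i)).
  exists (v 0 i)%:P; rewrite /along mmapX mmap1U /peval mevalXU hornerC; split.
    by rewrite -mul_polyC mulrC.
  have fE : peval (mpolyX R (mnm1 i)) = fun w : 'rV[R]_m => w 0 i.
    by apply/funext => w; rewrite /peval mevalXU.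
  rewrite dmpolyE -(eq_dot v (g := fun b => (b == i)%:R)) => [|b].
    rewrite /dot (bigD1 i) //= eqxx mul1r big1 ?addr0 // => b /negPf->.
    exact: mul0r.
  have := sdiff_derive b (sdiff_peval (mpolyX R (mnm1 i)) a).
  by rewrite fE (sdiff_derive b (sdiff_coord i a)).
suff : Q q by [].
elim/mpolyind: q => [|c k q _ _ IH]; first by rewrite -mpolyC0.
apply: (QD) IH; rewrite -mul_mpolyC; apply: (QM) => //.
rewrite mpolyXE_id; apply: (big_ind Q) => [|q1 q2|i _]; [by rewrite -mpolyC1|exact: QM|].
elim: (k i) => [|j IHj]; first by rewrite expr0 -mpolyC1.
by rewrite exprS; apply: (QM).
Qed.

End DegreeBounds.

(** * Independent products and the dimension count *)

Section Bezout.
Context {R : realType} {l : nat}.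
Local Notation pt := 'rV[R]_l.

(** Products of affine functions that are 1 at [a] and 0 at another given point, as in Lagrange
    interpolation. *)
Lemma interpolation (s : seq pt) : uniq s -> exists (e : pt -> mpoly l R) (c : nat),
  (forall a, deg_le (e a) c) /\ forall a b, a \in s -> b \in s -> peval (e a) b = (a == b)%:R.
Proof.
move=> us.
have /choice[w wP] : forall ab : pt * pt, exists q : mpoly l R, deg_le q 1 /\
    (ab.1 != ab.2 -> peval q ab.1 = 1 /\ peval q ab.2 = 0).
  move=> [a b]; have [ab|ab] := eqVneq a b; first by exists 0; split; [exact: deg_le0|].
  have [i abi] : exists i, a 0 i != b 0 i.
    apply/existsP; rewrite -negb_forall; apply: contra ab => /forallP H.
    by apply/eqP/rowP => i; apply/eqP.
  exists ((a 0 i - b 0 i)^-1 *: (mpolyX R (mnm1 i) + mpolyC l (- b 0 i))); split.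
    by apply: deg_leZ; apply: deg_leD; [exact: deg_le_var|exact: deg_leC].
  move=> _; rewrite !pevalZ !pevalD /peval !mevalXU !mevalC subrr mulr0 mulVf ?subr_eq0 //.
exists (fun a => \prod_(b <- s | b != a) w (a, b)), (size s); split.
  move=> a; apply: (@deg_leW _ _ _ (\sum_(b <- s | b != a) 1)).
    by apply: deg_le_prod => b _; case: (wP (a, b)).
  by rewrite sum1_count count_size.
move=> a b aS bS; rewrite peval_prod; case: eqVneq => [->|ab].
  rewrite big1_seq // => c /andP[cb _]; rewrite ((wP (b, c)).2 _).1 //= eq_sym //.
rewrite -big_filter (bigD1_seq b) ?filter_uniq ?mem_filter ?bS ?andbT 1?eq_sym //=.
by rewrite ((wP (a, b)).2 ab).2 mul0r.
Qed.

Variables (f : 'I_l -> mpoly l R) (d : 'I_l -> nat).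
Hypothesis d_gt0 : forall a, (0 < d a)%N.
Hypothesis fd : forall a, deg_le (f a) (d a).

(** The degree bound for the monomial [fpow al] in the [f i]. Below, [monos D] counts the monomials
    of degree less than [D], and [light D] selects those of weight less than [D]. *)
Definition wt (al : multinom l) : nat := \sum_i d i * al i.

Definition fpow (al : multinom l) : mpoly l R := \prod_i f i ^+ al i.

Lemma fpow_deg al : deg_le (fpow al) (wt al).
Proof. by apply: deg_le_prod => i _; exact: deg_leX. Qed.

Lemma mdeg_le_wt al : (mdeg al <= wt al)%N.
Proof. by rewrite mdegE; apply: leq_sum => i _; exact: leq_pmull. Qed.

Definition monos (D : nat) : nat := #|{: bmultinom l D}|.

Lemma monos_le D : (monos D <= D ^ l)%N.
Proof.
case: D => [|D].
  by rewrite /monos (eq_card0 (A := {: bmultinom l 0})) // => -[].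
rewrite -[l in X in (_ <= X)%N]card_ord -[X in (_ <= X ^ _)%N]card_ord -card_ffun.
have lt (x : bmultinom l D.+1) i : (x i < D.+1)%N.
  apply: leq_ltn_trans (bmdeg x); rewrite mdegE (bigD1 i) //=; exact: leq_addr.
apply: (@leq_card _ _ (fun x : bmultinom l D.+1 => [ffun i => inord (x i) : 'I_D.+1])).
move=> x y /ffunP xy; apply/val_inj/mnmP => i.
by have := xy i; rewrite !ffunE => /(congr1 val); rewrite /= !inordK.
Qed.

Lemma monos1 : (0 < monos 1)%N.
Proof. by apply/card_gt0P; exists (@BMultinom l 1 mnm0 ltac:(by rewrite mdeg0)). Qed.

Definition light (D : nat) := [pred x : bmultinom l D | (wt x < D)%N].

(** Dividing each exponent by [d i] with remainder is injective: there are [\prod_i d i] tuples of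
    remainders, and the tuple of quotients is light. *)
Lemma monos_light D : (monos D <= (\prod_i d i) * #|light D|)%N.
Proof.
case: D => [|D]; first by rewrite /monos (eq_card0 (A := {: bmultinom l 0})) // => -[].
pose quo (x : bmultinom l D.+1) : multinom l := Multinom [tuple (x i %/ d i)%N | i < l].
have quoE x i : quo x i = (x i %/ d i)%N by rewrite /quo multinomE tnth_mktuple.
have quo_wt x : (wt (quo x) < D.+1)%N.
  apply: leq_ltn_trans (bmdeg x); rewrite mdegE; apply: leq_sum => i _.
  by rewrite quoE mulnC leq_trunc_div.
have quo_lt x : (mdeg (quo x) < D.+1)%N by apply: leq_ltn_trans (mdeg_le_wt _) (quo_wt x).
pose q x : {y : bmultinom l D.+1 | light D.+1 y} :=
  exist _ (BMultinom (quo_lt x)) (quo_wt x).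
pose r (x : bmultinom l D.+1) : {dffun forall i : 'I_l, 'I_(d i)} :=
  [ffun i => Ordinal (ltn_pmod (x i) (d_gt0 i))].
have inj : injective (fun x => (r x, q x)).
  move=> x y [/ffunP rxy qxy]; apply/val_inj/mnmP => i.
  have := rxy i; rewrite !ffunE => /(congr1 val) /= h1.
  have h2 : quo x i = quo y i.
    by rewrite !quoE; have /eq_in_map/(_ i) := qxy; apply; rewrite mem_enum.
  by rewrite (divn_eq (x i) (d i)) h1 -quoE h2 quoE -divn_eq.
have := leq_card _ inj; rewrite card_prod card_sig => H; apply: leq_trans H _.
by rewrite card_dep_ffun foldrE big_map big_enum /= leq_mul2r; apply/orP; right;
  apply: leq_prod => i _; rewrite card_ord.
Qed.

(** Bernoulli's inequality for [(1 + 1 / P) ^ i], raised to the power [l.+1], outgrows a polynomial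
    of degree [l]. *)
Lemma exp_beats_poly (P c : nat) : (0 < P)%N ->
  exists j, (P ^ j * (1 + j * c) ^ l < P.+1 ^ j)%N.
Proof.
move=> P0.
have leX a b k : (a <= b)%N -> (a ^ k <= b ^ k)%N by case: k => // k; rewrite leq_exp2r.
have bern i : (P ^ i * (P + i) <= P * P.+1 ^ i)%N.
  elim: i => [|i IH]; first by rewrite !expn0; lia.
  rewrite !expnS; apply: (@leq_trans (P.+1 * (P ^ i * (P + i)))); last first.
    by rewrite [X in (_ <= X)%N]mulnCA leq_mul2l IH orbT.
  rewrite -mulnA mulnCA [X in (_ <= X)%N]mulnCA leq_mul2l; apply/orP; right; nia.
have h1 i : (P ^ (l.+1 * i) * (P + i) ^ l.+1 <= P ^ l.+1 * P.+1 ^ (l.+1 * i))%N.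
  by rewrite (mulnC l.+1) !expnM -!expnMn leq_exp2r // bern.
(* With this [i] one has [P ^ l.+1 * (K * i) ^ l = i ^ l.+1], which is less than
   [(P + i) ^ l.+1]. *)
pose K := (1 + l.+1 * c)%N; pose i := (P ^ l.+1 * K ^ l)%N.
have i0 : (0 < i)%N by rewrite muln_gt0 !expn_gt0 P0.
exists (l.+1 * i)%N.
have h2 : (1 + l.+1 * i * c <= K * i)%N by rewrite /K; nia.
have h3 : (P ^ l.+1 * (1 + l.+1 * i * c) ^ l < (P + i) ^ l.+1)%N.
  apply: (@leq_ltn_trans (P ^ l.+1 * (K * i) ^ l)); first by rewrite leq_mul2l leX ?orbT.
  rewrite expnMn mulnA -/i -expnS ltn_exp2r //; lia.
have P0' : (0 < P ^ l.+1)%N by rewrite expn_gt0 P0.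
rewrite -(ltn_pmul2l P0'); apply: leq_trans (h1 i).
by rewrite mulnCA ltn_pmul2l // expn_gt0 P0.
Qed.

(* The products [e_a f^al] of an interpolation basis at nondegenerate zeros
   with the monomials in [f] are linearly independent: along a line through
   [a] the part of lowest degree of a relation is a form in [df], which is
   onto. *)
Lemma fpow_independent (s : seq pt) (e : pt -> mpoly l R) (D : nat)
    (c : pt -> bmultinom l D -> R) :
  uniq s -> (forall a b, a \in s -> b \in s -> peval (e a) b = (a == b)%:R) ->
  (forall y, y \in s -> (forall a, peval (f a) y = 0) /\
     forall v, (forall a, dmpoly (f a) y v = 0) -> v = 0) ->
  \sum_(a <- s) \sum_(x : bmultinom l D) c a x *: (e a * fpow x) = 0 ->
  forall a x, a \in s -> c a x = 0.
Proof.
move=> us eP sP rel.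
suff H k a (x : bmultinom l D) : a \in s -> (mdeg x < k)%N -> c a x = 0.
  by move=> a x aS; exact: (H (mdeg x).+1).
elim: k a x => // k IH a x aS; rewrite ltnS leq_eqVlt => /orP[/eqP xk|]; last exact: IH.
pose q : mpoly l R := \sum_(z : bmultinom l D | mdeg z == k) c a z *: mpolyX R z.
suff q0 : q = 0.
  have : mcoeff x q = 0 by rewrite q0 mcoeff0.
  rewrite raddf_sum /= (bigD1 x) ?xk //= mcoeffZ mcoeffX eqxx mulr1 big1 ?addr0 //.
  move=> z /andP[_ zx]; rewrite mcoeffZ mcoeffX.
  by case: eqP => [/val_inj zx'|_]; [rewrite zx' eqxx in zx|rewrite mulr0].
have [fa fnd] := sP _ aS.
(* The differentials of the [f i] are independent at [a], so their values at vectors [v] fill the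
   whole space and [q] vanishes everywhere. *)
suff qv v : peval q (\row_i dmpoly (f i) a v) = 0.
  apply: peval_eq0 => y; pose A : 'M[R]_l := \matrix_(b, i) peval (mderiv b (f i)) a.
  have vA v : v *m A = \row_i dmpoly (f i) a v.
    by apply/rowP => i; rewrite !mxE; apply: eq_bigr => b _; rewrite mxE mulrC.
  have Au : A \in unitmx.
    by apply: inj_unitmx => v vA0; apply: fnd => i; have := vA v; rewrite vA0 => /rowP/(_ i); rewrite !mxE.
  by rewrite -(mulmxKV Au y) vA qv.
have /choice[g gP] : forall i, exists g : {poly R}, along a v (f i) = 'X * g /\ g.[0] = dmpoly (f i) a v.
  by move=> i; have [g [h1 h2]] := along_expansion a v (f i); exists g; rewrite h1 fa add0r.
have fpowE z : along a v (fpow z) = 'X ^+ mdeg z * \prod_i g i ^+ z i.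
  rewrite along_prod mdegE -prodrXr -big_split /=; apply: eq_bigr => i _.
  by rewrite alongXn (gP i).1 exprMn.
have : along a v (\sum_(a <- s) \sum_(x : bmultinom l D) c a x *: (e a * fpow x)) = 0.
  by rewrite rel -[0]mpolyC0 /along mmapC.
rewrite along_sum.
(* The relation along the line divided by its [k]-th power of the parameter. At 0 the interpolation
   factors kill every other zero, and the positive powers kill the terms of degree above [k]; what
   remains is the form [q] at the values of the differentials. *)
pose T : {poly R} := \sum_(b <- s) \sum_(z : bmultinom l D | (k <= mdeg z)%N)
  c b z *: (along a v (e b) * 'X ^+ (mdeg z - k) * \prod_i g i ^+ z i).
have -> : \sum_(b <- s) along a v (\sum_(z : bmultinom l D) c b z *: (e b * fpow z)) = 'X ^+ k * T.
  rewrite mulr_sumr; apply: eq_big_seq => b bS; rewrite along_sum mulr_sumr.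
  rewrite (bigID (fun z : bmultinom l D => (k <= mdeg z)%N)) /= [X in _ + X]big1 ?addr0; last first.
    by move=> z; rewrite -ltnNge => zk; rewrite IH // scale0r -mpolyC0 /along mmapC.
  apply: eq_bigr => z kz; rewrite alongZ -scalerAr; congr (_ *: _).
  by rewrite alongM fpowE -{1}(subnKC kz) exprD; ring.
move/eqP; rewrite mulf_eq0 (negPf (expf_neq0 _ _)) ?polyX_eq0 //= => /eqP T0.
have : T.[0] = 0 by rewrite T0 horner0.
have eb b : b \in s -> (along a v (e b)).[0] = (b == a)%:R.
  move=> bS; have [h [-> _]] := along_expansion a v (e b).
  by rewrite !hornerE eP.
have prod0 (z : bmultinom l D) : (\prod_i g i ^+ z i).[0] = \prod_i (dmpoly (f i) a v) ^+ z i.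
  by rewrite horner_prod; apply: eq_bigr => i _; rewrite horner_exp (gP i).2.
rewrite /T horner_sum (bigD1_seq a) //= [X in _ + X]big1_seq ?addr0; last first.
  move=> b /andP[ba bS]; rewrite horner_sum big1 // => z _.
  by rewrite hornerZ !hornerM eb // (negPf ba) !mul0r mulr0.
rewrite horner_sum (bigID (fun z : bmultinom l D => mdeg z == k)) /= [X in _ + X]big1 ?addr0; last first.
  move=> z /andP[kz zk]; rewrite hornerZ !hornerM hornerXn expr0n subn_eq0 leqNgt.
  by rewrite ltn_neqAle eq_sym zk kz /= mulr0 mul0r mulr0.
move=> <-; rewrite /q /peval raddf_sum /=; apply: eq_big => [z|z /eqP zk].
  by case: eqP => [->|]; rewrite ?leqnn ?andbF.
rewrite hornerZ !hornerM hornerXn eb // eqxx zk subnn expr0 !mul1r prod0 mevalZ mevalX.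
by congr (_ * _); apply: eq_bigr => i _; rewrite mxE.
Qed.

(** With more than [P = \prod_i d i] zeros, independence would give
    [P.+1 * monos D <= P * monos (D + c)] for all [D]. Iterating, [monos] would grow exponentially,
    although [monos D <= D ^ l]. *)
Theorem bezout_nondegenerate (s : seq pt) : uniq s ->
  (forall y, y \in s -> (forall a, peval (f a) y = 0) /\
     forall v, (forall a, dmpoly (f a) y v = 0) -> v = 0) ->
  (size s <= \prod_i d i)%N.
Proof.
move=> us sP; rewrite leqNgt; apply/negP => big.
set P := \prod_i d i in big; have P0 : (0 < P)%N by apply: prodn_gt0.
have [e [c [ec eP]]] := interpolation us.
have key D : (P.+1 * monos D <= P * monos (D + c))%N.
  suff sz : (size s * #|light D| <= monos (D + c))%N.
    apply: (@leq_trans (size s * monos D)); first by rewrite leq_mul2r big orbT.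
    apply: (@leq_trans (size s * (P * #|light D|))); first by rewrite leq_mul2l monos_light orbT.
    by rewrite mulnCA leq_mul2l sz orbT.
  pose U := {: 'I_(size s) * {x : bmultinom l D | light D x}}.
  have cU : #|U| = (size s * #|light D|)%N by rewrite card_prod card_ord card_sig.
  rewrite -cU leqNgt; apply/negP => lt.
  pose pol (u : U) : mpoly l R := e (tnth (in_tuple s) u.1) * fpow (val u.2).
  (* The coefficient matrix of the products. With more products than monomials of degree below
     [D + c] its left kernel contains a nontrivial relation. *)
  pose A : 'M[R]_(#|U|, #|{: bmultinom l (D + c)}|) :=
    \matrix_(i, j) mcoeff (enum_val j : bmultinom l (D + c)) (pol (enum_val i)).
  have : kermx A != 0.
    rewrite kermx_eq0 -row_leq_rank -ltnNge; apply: leq_ltn_trans lt; exact: rank_leq_col.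
  case/rowV0Pn => w /sub_kermxP wA; apply/negP; rewrite negbK; apply/eqP/rowP => i0; rewrite mxE.
  pose C u := w 0 (enum_rank u).
  have CP : \sum_(u : U) C u *: pol u = 0.
    apply/mpolyP => b; rewrite mcoeff0 raddf_sum /=.
    have [bD|bD] := ltnP (mdeg b) (D + c).
      have := congr1 (fun M : 'rV_ _ => M 0 (enum_rank (BMultinom bD))) wA; rewrite !mxE => H.
      rewrite -[RHS]H (reindex (@enum_val _ U)) /=; last first.
        by apply: onW_bij; exact: enum_val_bij.
      by apply: eq_bigr => j _; rewrite mcoeffZ /C enum_valK mxE enum_rankK.
    apply: big1 => u _; rewrite mcoeffZ (deg_le_coeff (k := c + wt (val u.2))) ?mulr0 //.
      by apply: deg_leM; [exact: ec|exact: fpow_deg].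
    apply: leq_trans bD; rewrite addnC ltn_add2r; exact: (valP u.2).
  (* The kernel vector as a coefficient function, with value 0 for heavy exponents and for points
     outside the list. *)
  pose cf (a : pt) (x : bmultinom l D) : R :=
    if (insub (index a s) : option 'I_(size s)) is Some i then
      if insub x is Some x' then C (i, x') else 0 else 0.
  have cfE (u : U) : cf (tnth (in_tuple s) u.1) (val u.2) = C u.
    rewrite /cf (tnth_nth 0) /= index_uniq // valK valK.
    by case: u.
  have rel : \sum_(a <- s) \sum_(x : bmultinom l D) cf a x *: (e a * fpow x) = 0.
    rewrite -[RHS]CP (big_tnth _ _ s) /=.
    rewrite (eq_bigr (fun i : 'I_(size s) => \sum_(x : {x | light D x}) C (i, x) *: pol (i, x))); last first.
      move=> i _; rewrite (bigID (light D)) /= [X in _ + X]big1 ?addr0; last first.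
        move=> x nx; rewrite /cf; case: insub => [j|]; last by rewrite scale0r.
        by rewrite insubN // scale0r.
      rewrite (reindex_omap (val : {x | light D x} -> _) insub) /=; last first.
        by move=> x xl; rewrite insubT.
      apply: eq_big => [x|x _]; first by rewrite valK eqxx (valP x).
      by rewrite -(cfE (i, x)).
    rewrite pair_big /=; apply: eq_bigr => -[] //.
  have := fpow_independent us eP sP rel.
  move=> H; have := H (tnth (in_tuple s) (enum_val i0).1) (val (enum_val i0).2) (mem_tnth _ _).
  by rewrite cfE /C enum_valK.
have iter j : (P.+1 ^ j <= P ^ j * monos (1 + j * c))%N.
  elim: j => [|j IH]; first by rewrite !expn0 mul1n; exact: monos1.
  rewrite !expnS; apply: (@leq_trans (P.+1 * (P ^ j * monos (1 + j * c)))).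
    by rewrite leq_mul2l IH orbT.
  rewrite mulnCA -[X in (_ <= X)%N]mulnA [X in (_ <= X)%N]mulnCA leq_mul2l; apply/orP; right.
  by rewrite (_ : 1 + j.+1 * c = 1 + j * c + c)%N ?key // mulSn; lia.
have [j] := exp_beats_poly c P0.
rewrite ltnNge => /negP; apply; apply: leq_trans (iter j) _.
by rewrite leq_mul2l monos_le orbT.
Qed.

End Bezout.

(** * Tracing one curve *)

Section Structure.
Context {R : realType} {l n : nat}.
Local Notation pt := 'rV[R]_l.
Variables (p : 'I_(l + n).+1 -> mpoly l R) (beta : 'I_(l + n).+1 -> 'I_l -> R).
Variable J : 'I_l -> mpoly l R.
Hypothesis Jc : cleared p beta J.
Hypothesis Dbounded : bounded_set (Delta p).
Hypothesis gen : sufficiently_general p beta J.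

Let hyps k : continuation_hypotheses p beta k. Proof. by case: gen. Qed.
Let minors : forall m (le_m_l : (m <= l)%N) (r : 'I_m -> 'I_(l + n).+1), injective r ->
  \det (\matrix_(a, b) beta (r a) (widen_ord le_m_l b)) != 0.
Proof. by case: gen. Qed.
Let gen3 : forall (I : {set 'I_(l + n).+1}) y, (#|I| <= l)%N -> retained p J I y ->
  (forall i, i \notin I -> 0 < peval (p i) y) /\
  (forall v : pt, (forall i, i \in I -> dmpoly (p i) y v = 0) ->
     (forall k : 'I_l, (#|I| <= k)%N -> dmpoly (J k) y v = 0) -> v = 0).
Proof. by case: gen. Qed.

Lemma SsetP (j : nat) y : (j <= l)%N -> Sset p beta j y <-> Delta p y /\
  forall a : 'I_l, (if (a < j)%N then phi p beta a y else tildeJ p beta a y) = 0.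
Proof.
move=> jl; split=> -[yD H]; split=> // a; first by have := H a; rewrite mixedE //; case: ifP.
by rewrite mixedE //; have := H a; case: ifP.
Qed.

Lemma Sset_Cset (k : 'I_l) y : Sset p beta k y <-> Cset p beta k y /\ tildeJ p beta k y = 0.
Proof.
rewrite (SsetP _ (ltnW (ltn_ord k))); split=> [[yD H]|[[yD H] H0]].
  split; last by have := H k; rewrite ltnn.
  split=> // a ak; rewrite mixedE // ltnS leq_eqVlt (negPf (_ : val a != val k)) //=.
  by have := H a; case: ifP.
split=> // a; have [->|ak] := eqVneq a k; first by rewrite ltnn.
have := H _ ak; rewrite mixedE // ltnS leq_eqVlt (negPf (_ : val a != val k)) //=.
by case: ifP.
Qed.

Lemma Sset_zeroes (k : 'I_l) : Sset p beta k.+1 = zeroes_on_curve p beta k.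
Proof.
apply/seteqP; split=> y.
  rewrite (SsetP _ (ltn_ord k)) => -[yD H]; split; last by have := H k; rewrite ltnSn.
  by split=> // a ak; rewrite mixedE //; have := H a; case: ifP.
move=> [[yD H] phk]; apply/SsetP => //; split=> // a.
have [->|ak] := eqVneq a k; first by rewrite ltnSn.
by have := H _ ak; rewrite mixedE //; case: ifP.
Qed.

(** * The graph of one curve and its edge ends *)

Section Curve.
Variable k : 'I_l.
Hypothesis Sfin : finite_set (Sset p beta k).
Hypothesis Tfin : finite_set (found_T p J k).

Let C := Cset p beta k.
Let X := closure C.
Let Z := zeroes_on_curve p beta k.
Let S := Sset p beta k.
(** Corners are the points of the closed curve outside [Delta]. The set [found_T] only contains
    them: it may have solutions that the curve does not approach. *)
Let V := Z `|` S `|` (X `\` Delta p).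

Let XC y : Delta p y -> X y <-> C y.
Proof. exact: (closure_Cset_Delta_eq Jc). Qed.

Lemma curve_compact : compact X.
Proof.
apply: bounded_closed_compact; last exact: closed_closure.
case: Dbounded => M [Mr MP]; exists M; split=> // M' MM' y Xy.
have /MP DM : M < (M + M') / 2 by rewrite ltr_pdivlMr //; lra.
have m0 : 0 < (M' - M) / 2 by rewrite divr_gt0 // subr_gt0.
have [z [zD _] zy] := (closure_normP _ _).1 Xy _ m0.
have := DM _ zD; rewrite -(subrK z y) /= => H.
rewrite (le_trans (ler_normD _ _)) //; move: H zy; rewrite distrC; lra.
Qed.

Let Vfin : finite_set V.
Proof.
rewrite !finite_setU; split; first by split=> //; case: (hyps k).
apply: (sub_finite_set _ Tfin) => y [Xy nyD].
exact: (closure_Cset_found_T Jc minors Xy nyD).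
Qed.

Let VX : V `<=` X.
Proof.
move=> y [[[yC _]|yS]|[Xy _]] //; first exact: subset_closure.
by apply: subset_closure; case: ((Sset_Cset k y).1 yS).
Qed.

Let isolated t : X t -> exists2 r : R, 0 < r & forall y, X y -> `|y - t| < r -> y <> t -> Delta p y.
Proof.
move=> Xt; have [r r0 rP] := finite_gap Vfin t; exists r => // y Xy yt nyt.
by apply: contrapT => nyD; apply: nyt; apply: rP => //; right.
Qed.

Let corner t : X t -> ~ Delta p t -> chart_at X false t /\
  exists s : R, `|s| = 1 /\ forall e : R, 0 < e -> exists2 r : R, 0 < r &
    forall y, C y -> `|y - t| < r -> `|squash (phi p beta k y) - s| < e.
Proof.
move=> Xt ntD; have [I [cI It]] := closure_Cset_found_T Jc minors Xt ntD.
exact: (corner_chart Jc minors gen3 cI It Xt XC Xt (isolated Xt)).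
Qed.

(** At a corner the height is the limit of the squashed [phi k], of absolute value 1; elsewhere it
    is the squashed [phi k] itself. *)
Let curve_height : exists h : pt -> R, height X V h /\ forall y, Delta p y -> h y = squash (phi p beta k y).
Proof.
have /choice[s sP] : forall t, exists s : R, X t -> ~ Delta p t -> `|s| = 1 /\
    forall e : R, 0 < e -> exists2 r : R, 0 < r &
    forall y, C y -> `|y - t| < r -> `|squash (phi p beta k y) - s| < e.
  move=> t; have [[Xt ntD]|H] := pselect (X t /\ ~ Delta p t).
    by have [_ [s sP]] := corner Xt ntD; exists s.
  by exists 0 => Xt ntD; case: H.
pose h y := if `[< Delta p y >] then squash (phi p beta k y) else s y.
have hE y : Delta p y -> h y = squash (phi p beta k y) by move=> yD; rewrite /h asboolT.
have hN y : ~ Delta p y -> h y = s y by move=> yD; rewrite /h asboolF.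
exists h; split=> //; split.
- move=> y Xy e e0; have [yD|nyD] := pselect (Delta p y).
    have pc := sdiff_continuous (phi_sdiff beta k yD).
    have hc : {for y, continuous (fun z => squash (phi p beta k z))}.
      by apply: continuous_comp => //; exact: squash_continuous.
    have [rho rho0 rhoP] := Delta_open yD.
    have /continuous_normP/(_ _ e0)[r r0 rP] := hc.
    exists (Num.min r rho); first by rewrite lt_min r0.
    move=> z _; rewrite lt_min => /andP[zr zrho]; rewrite !hE //; last exact: rhoP.
    exact: rP.
  have [r1 r10 r1P] := isolated Xy.
  have [_ /(_ _ e0)[r r0 rP]] := sP _ Xy nyD.
  exists (Num.min r r1); first by rewrite lt_min r0.
  move=> z Xz; rewrite lt_min => /andP[zr zr1].
  have [->|/eqP zy] := eqVneq z y; first by rewrite subrr normr0.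
  have zD := r1P _ Xz zr1 zy.
  by rewrite hE // hN //; apply: rP => //; exact/XC.
- move=> y Xy; have [yD|nyD] := pselect (Delta p y); first by rewrite hE // ltW // squash_lt1.
  by rewrite hN // (sP _ Xy nyD).1.
- move=> q Xq nVq.
  have qD : Delta p q by apply: contrapT => nqD; apply: nVq; right.
  have qC := (XC qD).1 Xq.
  apply: (Cset_regular_chart Jc XC hE qC); apply/eqP => J0; apply: nVq; left; right.
  exact/Sset_Cset.
Qed.

(* The edges are the arcs of the curve between consecutive points at which
   the tracer may stop. *)
Lemma curve_edges : exists Ed : set pt -> pt -> pt -> Prop,
  [/\ forall K v w, Ed K v w -> Ed K w v,
      forall a A b, curve_arc p beta k S (found_T p J k) (a, A, b) <->
        (S a \/ (X a /\ ~ Delta p a)) /\ Ed A a b,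
      forall v, Z v \/ S v -> exists K1 w1 K2 w2, [/\ K1 <> K2, Ed K1 v w1, Ed K2 v w2 &
        forall K w, Ed K v w -> (K = K1 /\ w = w1) \/ (K = K2 /\ w = w2)],
      forall t, X t -> ~ Delta p t -> exists K w, Ed K t w /\
        forall K' w', Ed K' t w' -> K' = K /\ w' = w &
      (forall K v w, Ed K v w -> Z v -> ~ Z w /\ (S w \/ (X w /\ ~ Delta p w))) /\
      (forall K v w w', Ed K v w -> Ed K v w' -> w = w')].
Proof.
have [h [hh hE]] := curve_height.
exists (edge X V h); split.
- exact: edge_sym.
- move=> a A b; split=> [[aST AC bstop [g [gc ginj g0 gA g1]]]|[aS Eab]].
    (* A stopping point in [found_T] need not be near the curve; that the two ends of an arc are
       follows from continuity of the path. *)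
    have closed_end x : x = 0 \/ x = 1 -> X (g x).
      move=> x01; apply/closure_normP => r r0.
      move/cont_onP : gc => gc.
      have xI : `[0, 1]%classic (x : R) by case: x01 => ->; rewrite /= in_itv /= lexx ler01.
      have [s s0 sP] := gc _ xI _ r0.
      have [y [yI yx yO]] : exists y, [/\ citv 0 1 y, `|y - x| < s & oitv 0 1 y].
        by case: x01 => ->; [apply: near_left_end|apply: near_right_end].
      exists (g y); last by apply: sP => //; rewrite /= in_itv.
      by apply: (AC _ _).1; rewrite -gA; exists y => //; rewrite /= in_itv.
    have Xa : X a by rewrite -g0; apply: closed_end; left.
    have Xb : X b by rewrite -g1; apply: closed_end; right.
    have aS : S a \/ (X a /\ ~ Delta p a).
      by case: aST => [|/found_T_not_Delta]; [left|right].
    split=> //; rewrite -g0 -g1 -gA; apply: path_edge => //.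
    + exact: curve_compact.
    + rewrite gA => y /AC[yC nstop]; split; first exact: subset_closure.
      move=> [yZS|[_ nyD]]; last by case: yC.
      by apply: nstop; left.
    + by rewrite g0; case: aS => [aS|aX]; [left; right|right].
    + rewrite g1; case: bstop => [bZS|/found_T_not_Delta nbD]; first by left.
      by right.
  have Va := edge_vertex Eab; have Vb := edge_vertex (edge_sym Eab).
  have [g [gc ginj g0 gA g1]] := edge_path VX hh Eab.
  split.
  + by case: aS => [aS|[Xa naD]]; [left|right; exact: (closure_Cset_found_T Jc minors)].
  + move=> y /(edge_sub Eab)[Xy nVy].
    have yD : Delta p y by apply: contrapT => nyD; apply: nVy; right.
    split; first exact/XC.
    by move=> [yZS|/found_T_not_Delta//]; apply: nVy; left.
  + by case: Vb => [bZS|[Xb nbD]]; [left|right; exact: (closure_Cset_found_T Jc minors)].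
  + by exists g.
- move=> v vZS; have Vv : V v by left.
  have Xv := VX Vv.
  have vD : Delta p v by case: vZS => -[] // [].
  apply: (through_edges curve_compact Vfin VX hh Vv).
  by apply: (Cset_chart Jc XC); [case: (hyps k)|exact/XC].
- move=> t Xt ntD; have Vt : V t by right.
  by apply: (end_edge curve_compact Vfin VX hh Vt); case: (corner Xt ntD).
- split=> [K v w Evw Zv|K v w w' E1 E2]; last exact: (edge_other_end Vfin VX hh E1 E2).
  have nZw : ~ Z w.
    move=> Zw; apply: (edge_height_neq VX hh Evw).
    case: Zv => -[vD _] vphi; case: Zw => -[wD _] wphi.
    by rewrite !hE //; move: vphi wphi => /= -> ->.
  split=> //; case: (edge_vertex (edge_sym Evw)) => [[|]|]; by [|left|right].
Qed.

(** An edge at a zero of [phi k] ends at no other such zero, hence at an input point on the closed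
    curve; traversed backwards it is an arc that finds the zero. *)
Lemma curve_step_output : step_output p beta k S (found_T p J k) = Z.
Proof.
have [Ed [Esym Earc Ethr _ [Ezero _]]] := curve_edges.
apply/seteqP; split=> [z []//|z Zz]; split=> //.
have [K1 [w1 [_ [_ [_ E1 _ _]]]]] := Ethr z (or_introl Zz).
exists w1, K1; apply/Earc; split; last exact: Esym.
by case: (Ezero _ _ _ E1 Zz).
Qed.

Lemma curve_arcs_S s : S s -> exists t1 t2 : set pt * pt, t1.1 <> t2.1 /\
  [set t | curve_arc p beta k S (found_T p J k) (s, t.1, t.2)] = [set t1; t2].
Proof.
have [Ed [Esym Earc Ethr _ _]] := curve_edges => Ss.
have [K1 [w1 [K2 [w2 [K12 E1 E2 Eall]]]]] := Ethr s (or_intror Ss).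
exists (K1, w1), (K2, w2); split=> //; apply/seteqP; split=> -[K w] /=.
  by move=> /Earc[_ /Eall[[-> ->]|[-> ->]]]; [left|right].
by move=> [[-> ->]|[-> ->]]; apply/Earc; split=> //; left.
Qed.

Lemma curve_arcs_T t : X t -> ~ Delta p t -> exists t1 : set pt * pt,
  [set u | curve_arc p beta k S (found_T p J k) (t, u.1, u.2)] = [set t1].
Proof.
have [Ed [Esym Earc _ Eend _]] := curve_edges => Xt ntD.
have [K [w [E1 Eall]]] := Eend t Xt ntD.
exists (K, w); apply/seteqP; split=> -[K' w'] /=.
  by move=> /Earc[_ /Eall[-> ->]].
by move=> [-> ->]; apply/Earc; split=> //; right.
Qed.

Lemma curve_arc_start_closure a A b : curve_arc p beta k S (found_T p J k) (a, A, b) -> X a.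
Proof.
have [Ed [_ Earc _ _ _]] := curve_edges => /Earc[[/Sset_Cset[aC _]|[]//] _].
exact: subset_closure.
Qed.

(** Each of the two edges at a zero is sent to its end at the other vertex. This is injective: two
    edges end at a point of [S], told apart by a bit, and only one at a corner. *)
Lemma curve_count (zs ss ts : seq pt) : uniq zs -> (forall z, z \in zs -> Z z) ->
  (forall s, S s -> s \in ss) -> (forall t, found_T p J k t -> t \in ts) ->
  (2 * size zs <= 2 * size ss + size ts)%N.
Proof.
move=> uz zsZ ssS tsT.
have [Ed [Esym Earc Ethr Eend [Ezero Euniq]]] := curve_edges.
have /choice[Kw KwP] : forall v, exists Kw : bool -> set pt * pt, Z v \/ S v ->
    [/\ (Kw true).1 <> (Kw false).1, forall b, Ed (Kw b).1 v (Kw b).2 &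
      forall K w, Ed K v w -> exists b, K = (Kw b).1].
  move=> v; have [vZS|nv] := pselect (Z v \/ S v); last by exists (fun=> (set0, v)).
  have [K1 [w1 [K2 [w2 [K12 E1 E2 Eall]]]]] := Ethr v vZS.
  exists (fun b : bool => if b then (K1, w1) else (K2, w2)) => _; split=> //; first by case.
  by move=> K w /Eall[[-> _]|[-> _]]; [exists true|exists false].
(* The bit records whether [K] is the edge listed at [w] under [true]. *)
pose code (zb : pt * bool) : (pt * bool) + pt :=
  let: (K, w) := Kw zb.1 zb.2 in
  if w \in ss then inl (w, `[< (Kw w true).1 = K >]) else inr w.
pose dom := [seq (z, b) | z <- zs, b <- [:: true; false]].
pose cod : seq ((pt * bool) + pt) :=
  [seq inl (s, b) | s <- ss, b <- [:: true; false]] ++ [seq inr t | t <- ts].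
have udom : uniq dom by apply: allpairs_uniq => // -[? ?] [? ?] _ _.
have sdom : size dom = (2 * size zs)%N by rewrite size_allpairs mulnC.
have scod : size cod = (2 * size ss + size ts)%N by rewrite size_cat size_allpairs size_map mulnC.
have domZ zb : zb \in dom -> Z zb.1 by move=> /allpairsP[[z b] /= [/zsZ Zz _ ->]].
have codeP zb : zb \in dom -> exists K w, [/\ Kw zb.1 zb.2 = (K, w), Ed K zb.1 w &
    S w \/ (X w /\ ~ Delta p w)].
  move=> zD; have Zz := domZ _ zD.
  have [_ E1 _] := KwP _ (or_introl Zz); have := E1 zb.2.
  case: (Kw zb.1 zb.2) => K w /= E; exists K, w; split=> //.
  by case: (Ezero _ _ _ E Zz).
have cin zb : zb \in dom -> code zb \in cod.
  move=> /codeP[K [w [e1 E1 w01]]]; rewrite /code e1 mem_cat.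
  case: ifP => [wss|nwss]; apply/orP; [left|right].
    by apply/allpairsP; exists (w, `[< (Kw w true).1 = K >]); split=> //; rewrite !inE /=; case: asbool.
  apply/mapP; exists w => //; case: w01 => [/ssS|[Xw nwD]]; first by rewrite nwss.
  apply/tsT; exact: (closure_Cset_found_T Jc minors).
have injc : {in dom &, injective code}.
  move=> [z b] [z' b'] zD z'D.
  have [K [w [e1 E1 w1]]] := codeP _ zD; have [K' [w' [e2 E2 w2]]] := codeP _ z'D.
  rewrite /= in e1 e2 E1 E2; rewrite /code /= e1 e2 => ceq.
  suff KK : K = K' /\ w = w'.
    case: KK => KK ww; have zz : z = z'.
      by apply: (Euniq K w); apply: Esym; rewrite ?KK ?ww // -?KK -?ww.
    have [ne _ _] := KwP z (or_introl (domZ _ zD)).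
    subst z'; congr (_, _); case: b b' e1 e2 {zD z'D ceq} => -[] // e1 e2;
      by exfalso; apply: ne; rewrite e1 e2.
  move: ceq; case: ifP => wss; case: ifP => w'ss // [ww].
    subst w' => Keq; split=> //.
    have [Sw|[Xw nwD]] := w1; last first.
      have [K0 [w0 [_ u0]]] := Eend _ Xw nwD.
      by have [-> _] := u0 _ _ (Esym _ _ _ E1); have [-> _] := u0 _ _ (Esym _ _ _ E2).
    have [ne _ all2] := KwP _ (or_intror Sw).
    have [c1 c1E] := all2 _ _ (Esym _ _ _ E1); have [c2 c2E] := all2 _ _ (Esym _ _ _ E2).
    move: Keq c1E c2E; case: c1; case: c2 => Keq c1E c2E; rewrite ?c1E ?c2E //; exfalso.
      by move: Keq; rewrite c1E c2E asboolT // => /esym/asboolP.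
    by move: Keq; rewrite c1E c2E (asboolT (erefl (Kw w true).1)) => /asboolP.
  subst w'; split=> //; have [Sw|[Xw nwD]] := w1; first by rewrite ssS in wss.
  have [K0 [w0 [_ u0]]] := Eend _ Xw nwD.
  by have [-> _] := u0 _ _ (Esym _ _ _ E1); have [-> _] := u0 _ _ (Esym _ _ _ E2).
rewrite -sdom -scod -(size_map code); apply: uniq_leq_size.
  by rewrite map_inj_in_uniq.
by move=> _ /mapP[zb zD ->]; exact: cin.
Qed.

(** An arc is determined by its starting point, together with one bit if that point is in [S]; the
    step therefore traces at most twice the points of [S] plus those of [found_T]. *)
Lemma curve_code : exists code : pt * set pt * pt -> (pt * bool) + pt,
  (forall t, curve_arc p beta k S (found_T p J k) t ->
     (exists s b, S s /\ code t = inl (s, b)) \/ (exists u, found_T p J k u /\ code t = inr u)) /\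
  (forall t t', curve_arc p beta k S (found_T p J k) t -> curve_arc p beta k S (found_T p J k) t' ->
     code t = code t' -> t = t').
Proof.
have [Ed [Esym Earc Ethr Eend [_ Euniq]]] := curve_edges.
have /choice[Kf KfP] : forall v, exists K : set pt, S v ->
    exists K2, forall K' w, Ed K' v w -> K' = K \/ (K' = K2 /\ K2 <> K).
  move=> v; have [vS|nv] := pselect (S v); last by exists set0.
  have [K1 [w1 [K2 [w2 [K12 E1 E2 Eall]]]]] := Ethr v (or_intror vS).
  by exists K1 => _; exists K2 => K' w /Eall[[-> _]|[-> _]]; [left|right; split=> // /esym].
exists (fun t => let: (a, A, b) := t in
  if `[< S a >] then inl (a, `[< A = Kf a >]) else inr a); split.
  move=> [[a A] b] /Earc[aS Ea]; have [Sa|nSa] := pselect (S a).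
    by left; exists a, `[< A = Kf a >]; rewrite asboolT.
  right; exists a; rewrite asboolF //; split=> //.
  by case: aS => [//|[Xa naD]]; exact: (closure_Cset_found_T Jc minors).
move=> [[a A] b] [[a' A'] b'] /Earc[aS Ea] /Earc[aS' Ea'].
have [Sa|nSa] := pselect (S a).
  rewrite asboolT //; case: ifP => // _ [aa] AA; subst a'.
  have [K2 K2P] := KfP _ Sa.
  suff AE : A = A' by subst A'; congr (_, _, _); exact: (Euniq _ _ _ _ Ea Ea').
  have [e1|[e1 n1]] := K2P _ _ Ea; have [e2|[e2 n2]] := K2P _ _ Ea'; rewrite ?e1 ?e2 //; exfalso.
    by move: AA; rewrite e1 e2 asboolT // => /esym/asboolP.
  by move: AA; rewrite e1 e2 (asboolT (erefl (Kf a))) => /asboolP.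
rewrite asboolF //; case: ifP => // _ [aa]; subst a'.
have [//|[Xa naD]] := aS.
have [K0 [w0 [_ u0]]] := Eend _ Xa naD.
by have [-> ->] := u0 _ _ Ea; have [-> ->] := u0 _ _ Ea'.
Qed.

End Curve.

End Structure.

(** * Counting over all steps *)

Lemma card_le_code (T : Type) (U : eqType) (A : set T) (f : T -> U) (s : seq U) :
  (forall t, A t -> f t \in s) -> (forall t t', A t -> A t' -> f t = f t' -> t = t') ->
  A #<= `I_(size s).
Proof.
move=> fA finj; pose g t := index (f t) s.
have gA : g @` A #= A.
  apply: inj_card_eq => t t' /set_mem tA /set_mem t'A gtt; apply: finj => //.
  by rewrite -(nth_index (f t) (fA _ tA)) -/(g t) gtt /g nth_index // fA.
apply: (card_le_trans (B := g @` A)); first by move: gA; rewrite card_eq_sym card_eq_le => /andP[].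
by apply: subset_card_le => _ [t tA <-] /=; rewrite index_mem fA.
Qed.

Lemma card_pair (T : Type) (t1 t2 : T) : t1 <> t2 -> [set t1; t2] #= `I_2.
Proof.
move=> t12; pose f (i : nat) := if i == 0%N then t1 else t2.
have -> : [set t1; t2] = f @` `I_2.
  apply/seteqP; split=> [t [->|->]|_ [[|[|//]] _ <-]]; [by exists 0%N|by exists 1%N|by left|by right].
by apply: inj_card_eq => -[|[|i]] [|[|j]] /set_mem/= i2 /set_mem/= j2 //; rewrite /f /= => // /esym.
Qed.

(** A longest duplicate-free list in [A] exhausts it, so a bound on finite families of solutions
    becomes a finite enumeration. *)
Lemma bounded_enumeration (T : choiceType) (A : set T) (N : nat) :
  (forall s, uniq s -> (forall x, x \in s -> A x) -> (size s <= N)%N) ->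
  exists s : seq T, [/\ uniq s, forall x, A x <-> x \in s & (size s <= N)%N].
Proof.
move=> H; pose P k := `[< exists s : seq T, [/\ uniq s, forall x, x \in s -> A x & size s = k] >].
have P0 : exists k, P k by exists 0%N; apply/asboolP; exists [::].
have PN k : P k -> (k <= N)%N by move=> /asboolP[s [us sA <-]]; exact: H.
case: (ex_maxnP P0 PN) => k /asboolP[s [us sA sk]] kmax; exists s; split=> //; last first.
  exact: H.
move=> x; split=> [Ax|/sA//]; apply/negPn/negP => xs.
have /kmax : P k.+1.
  apply/asboolP; exists (x :: s); rewrite /= xs sk; split=> // z.
  by rewrite inE => /orP[/eqP->|/sA].
by rewrite ltnn.
Qed.

(** The exponents [l - k.+1] for [k >= j] run from [l - j - 1] down to 0 and add up to
    ['C(l - j, 2)]. *)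
Lemma prod_degrees (l j d : nat) : (j <= l)%N ->
  (\prod_(k < l | j <= k) (2 ^ (l - k.+1) * d))%N = bezout_bound l j d.
Proof.
move=> jl; rewrite -(subnKC jl) /bezout_bound addKn; set m := (l - j)%N.
rewrite big_mkcond big_split_ord /= big1 ?mul1n; last by move=> i _; rewrite leqNgt ltn_ord.
under eq_bigr do rewrite leq_addr -addnS subnDl.
rewrite big_split /= prod_nat_const card_ord -expn_sum; congr (2 ^ _ * _)%N.
rewrite -bin2_sum big_mkord (reindex_inj rev_ord_inj) /=; apply: eq_bigr => i _.
by rewrite subnS subKn // ltnW.
Qed.

(** The origin of the weights [l + 1 - j]: corners found for one step influence this and all later
    steps. *)
Lemma sum_prefix_sums (t : nat -> nat) m :
  (\sum_(k < m) \sum_(i < k.+1) t i = \sum_(i < m) (m - i) * t i)%N.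
Proof.
elim: m => [|m IH]; first by rewrite !big_ord0.
rewrite big_ord_recr /= IH [in RHS]big_ord_recr /= [X in (_ + X)%N]big_ord_recr /=.
rewrite subSnn mul1n addnA -big_split /=; congr (_ + _)%N; apply: eq_bigr => i _.
by rewrite subSn ?mulSn 1?addnC // ltnW.
Qed.

(** * Solution counts of the auxiliary systems and the total number of arcs *)

Section Assembly.
Context {R : realType} {l n : nat}.
Local Notation pt := 'rV[R]_l.
Variables (p : 'I_(l + n).+1 -> mpoly l R) (beta : 'I_(l + n).+1 -> 'I_l -> R).
Variables (J : 'I_l -> mpoly l R) (d : nat).
Hypothesis p_deg1 : forall i, degree (p i) = 1%N.
Hypothesis Jc : cleared p beta J.
Hypothesis Dbounded : bounded_set (Delta p).
Hypothesis gen : sufficiently_general p beta J.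
Hypothesis d_gt0 : (0 < d)%N.
Hypothesis Jd : forall k : 'I_l, (degree (J k) <= 2 ^ (l - k.+1) * d)%N.

(** No variable is eliminated here: the [#|I|] affine equations of degree 1 replace the first [#|I|]
    of the [J a], which gives a square system with the same product of degrees. *)
Lemma retained_bound (I : {set 'I_(l + n).+1}) (s : seq pt) : (#|I| <= l)%N ->
  uniq s -> (forall y, y \in s -> retained p J I y) -> (size s <= bezout_bound l #|I| d)%N.
Proof.
move=> Il us sI; have [_ _ gen3] := gen.
pose f (a : 'I_l) := if (a < #|I|)%N then p (nth ord0 (enum I) a) else J a.
pose D (a : 'I_l) := if (a < #|I|)%N then 1%N else (2 ^ (l - a.+1) * d)%N.
have -> : bezout_bound l #|I| d = (\prod_a D a)%N.
  rewrite -prod_degrees // big_mkcond /=; apply: eq_bigr => a _.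
  by rewrite /D leqNgt; case: ltnP.
apply: (@bezout_nondegenerate R l f D) => // [a|a|y /sI yr].
- by rewrite /D; case: ifP => // _; rewrite muln_gt0 expn_gt0.
- by rewrite /f /D; case: ifP => _; apply: degree_le; rewrite ?p_deg1.
have [[yI yJ] _] := yr; have [_ ynd] := gen3 _ _ Il yr; split.
  move=> a; rewrite /f; case: ltnP => aI; last exact: yJ.
  by apply: yI; rewrite -mem_enum mem_nth // -cardE.
move=> v vf; apply: ynd => [i iI|k Ik]; last by have := vf k; rewrite /f ltnNge Ik.
have iE : (index i (enum I) < #|I|)%N by rewrite cardE index_mem mem_enum.
have := vf (Ordinal (leq_trans iE Il)); rewrite /f /= iE nth_index //.
by rewrite mem_enum.
Qed.

Lemma retained_set0 : retained p J finset.set0 = Sset p beta 0.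
Proof.
apply/seteqP; split=> y.
  rewrite /retained eqxx => -[[_ yJ] yD]; apply/SsetP => //; split=> // a.
  by apply/(tildeJ_eq0 Jc) => //; apply: yJ; rewrite cards0.
move=> /SsetP => /(_ (leq0n _))[yD yJ]; rewrite /retained eqxx; split=> //; split.
  by move=> i; rewrite finset.inE.
by move=> k _; apply/(tildeJ_eq0 Jc _ yD); exact: yJ.
Qed.

Let retained_seq : exists Q : {set 'I_(l + n).+1} -> seq pt, forall I : {set 'I_(l + n).+1}, (#|I| <= l)%N ->
  [/\ uniq (Q I), forall y, retained p J I y <-> y \in Q I & (size (Q I) <= bezout_bound l #|I| d)%N].
Proof.
suff /choice[Q QP] : forall I : {set 'I_(l + n).+1}, exists s : seq pt, (#|I| <= l)%N ->
  [/\ uniq s, forall y, retained p J I y <-> y \in s & (size s <= bezout_bound l #|I| d)%N].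
  by exists Q.
move=> I; have [Il|nIl] := leqP #|I| l; last by exists [::].
have [s sP] := bounded_enumeration (fun s => @retained_bound I s Il).
by exists s.
Qed.

Let found_T_seq (k : 'I_l) : exists ts : seq pt,
  (forall t, found_T p J k t -> t \in ts) /\
  (size ts <= 'C(l + n + 1, k.+1) * bezout_bound l k.+1 d)%N.
Proof.
have [Q QP] := retained_seq.
pose Is := enum (finset.finset (fun I : {set 'I_(l + n).+1} => #|I| == k.+1)).
exists (flatten (map Q Is)); split.
  move=> t [I [cI It]]; apply/flattenP; exists (Q I).
    by apply: map_f; rewrite mem_enum finset.inE cI.
  by have [|_ <- _] := QP I; rewrite ?cI.
rewrite size_flatten sumnE !big_map big_enum /=.
apply: (@leq_trans (\sum_(I in finset.finset (fun I : {set 'I_(l + n).+1} => #|I| == k.+1)) bezout_bound l k.+1 d)).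
  apply: leq_sum => I; rewrite finset.inE => /eqP cI.
  by have [|_ _] := QP I; rewrite cI.
by rewrite sum_nat_const card_draws card_ord addn1 -addnS.
Qed.

Lemma finite_found_T k : finite_set (found_T p J k).
Proof.
have [ts [tsP _]] := found_T_seq k.
by apply: (sub_finite_set _ (finite_seq ts)) => t /tsP.
Qed.

Lemma finite_Sset j : (j <= l)%N -> finite_set (Sset p beta j).
Proof.
case: j => [_|j jl]; last first.
  by have [/(_ (Ordinal jl))[_ H _] _ _] := gen; rewrite (Sset_zeroes p beta (Ordinal jl)).
have [Q QP] := retained_seq.
have [|_ H _] := QP finset.set0; first by rewrite cards0.
by rewrite -retained_set0; apply: (sub_finite_set _ (finite_seq (Q finset.set0))) => t /H.
Qed.

Lemma found_SE j : (j <= l)%N -> found_S p beta J j = Sset p beta j.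
Proof.
elim: j => [_|j IH jl]; first exact: retained_set0.
rewrite /=; pose k := Ordinal jl; rewrite (Sset_zeroes p beta k) IH ?(ltnW jl) //.
rewrite -(curve_step_output Jc Dbounded gen (k := k)); last exact: finite_found_T.
  apply/seteqP; split=> y; last by exists k.
  by move=> [k' [kk]]; rewrite (_ : k' = k) //; exact: val_inj.
exact: finite_Sset (ltnW jl).
Qed.

Lemma Sset_solutions : Sset p beta l =
  [set y | Delta p y /\ forall k : 'I_l, \prod_i (peval (p i) y `^ beta i k) = 1].
Proof.
have E k y : Delta p y -> \prod_i (peval (p i) y `^ beta i k) = expR (phi p beta k y).
  move=> yD; rewrite expR_sum; apply: eq_bigr => i _.
  by rewrite /powR gt_eqF // yD.
apply/seteqP; split=> y.
  move=> /SsetP => /(_ (leqnn _))[yD H]; split=> // k.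
  by have := H k; rewrite ltn_ord E // => ->; rewrite expR0.
move=> [yD H]; apply/SsetP => //; split=> // k; rewrite ltn_ord.
by apply: expR_inj; rewrite -E // expR0.
Qed.

Lemma boundary_tracked k :
  closure (Cset p beta k) `&` boundary_Delta p `<=` Tset p beta J k `&` found_T p J k.
Proof.
move=> y [cy yb]; split; first exact: (closure_Cset_Tset Jc).
have [_ minors _] := gen; apply: (closure_Cset_found_T Jc minors cy) => yD.
case: yb => _; apply; have [r r0 rP] := Delta_open yD.
by apply/nbhs_normP; exists r.
Qed.

Lemma arcs_from_S (k : 'I_l) s : found_S p beta J k s -> arcs_from p beta J k s #= `I_2.
Proof.
have kl := ltnW (ltn_ord k); rewrite found_SE // => sS.
have [t1 [t2 [t12 E]]] := curve_arcs_S Jc Dbounded gen (finite_Sset kl) (finite_found_T k) sS.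
by rewrite /arcs_from found_SE // E; apply: card_pair => t12'; apply: t12; rewrite t12'.
Qed.

Lemma arcs_from_T (k : 'I_l) t : found_T p J k t ->
  (closure (Cset p beta k) t -> arcs_from p beta J k t #= `I_1) /\
  (~ closure (Cset p beta k) t -> arcs_from p beta J k t = set0).
Proof.
have kl := ltnW (ltn_ord k) => /found_T_not_Delta tT; rewrite /arcs_from found_SE //; split=> ct.
  have [t1 ->] := curve_arcs_T Jc Dbounded gen (finite_Sset kl) (finite_found_T k) ct tT.
  exact: card_set1.
apply/seteqP; split=> // u uP; apply: ct.
exact: (curve_arc_start_closure Jc Dbounded gen (finite_Sset kl) (finite_found_T k) uP).
Qed.

(** Telescoping [curve_count] bounds twice the input [S] of step [k] by [2 * bezout_bound l 0 d]
    plus the corner bounds of the earlier steps. Adding the corners of step [k] itself bounds its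
    arcs, and summing over [k] gives the weights. *)
Lemma traced_bound : traced p beta J #<= `I_(curve_bound l n d).
Proof.
pose t (i : nat) := ('C(l + n + 1, i.+1) * bezout_bound l i.+1 d)%N.
have /choice[ts tsP] := found_T_seq.
have [Q QP] := retained_seq.
have [ss ssP] : exists ss : nat -> seq pt, forall k, (k <= l)%N ->
    [/\ uniq (ss k), forall y, Sset p beta k y <-> y \in ss k &
      (2 * size (ss k) <= 2 * bezout_bound l 0 d + \sum_(i < k) t i)%N].
  suff /choice[ss ssP] : forall k, exists s : seq pt, (k <= l)%N ->
      [/\ uniq s, forall y, Sset p beta k y <-> y \in s &
      (2 * size s <= 2 * bezout_bound l 0 d + \sum_(i < k) t i)%N] by exists ss.
  elim=> [|k [s IH]].
    have [|u0 H0 b0] := QP finset.set0; first by rewrite cards0.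
    exists (Q finset.set0) => _; split=> // [y|]; first by rewrite -retained_set0.
    by rewrite big_ord0 addn0 leq_mul2l /=; rewrite cards0 in b0.
  have [kl|nkl] := ltnP k l; last by exists [::].
  have [us sS sb] := IH (ltnW kl).
  have [z' zE'] := (finite_seqP _).1 (finite_Sset kl).
  pose z := undup z'; have uz : uniq z by exact: undup_uniq.
  have zE y : Sset p beta k.+1 y <-> y \in z by rewrite zE' mem_undup.
  exists z => _; split=> //.
  pose k' := Ordinal kl; have [tT tb] := tsP k'.
  have := @curve_count _ _ _ _ _ _ Jc Dbounded gen k' (finite_Sset (ltnW kl)) (finite_found_T k') z s (ts k') uz.
  rewrite big_ord_recr /= addnA => H; apply: leq_trans (leq_add sb tb); apply: H => //.
    by move=> y yz; rewrite -Sset_zeroes; apply/zE.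
  by move=> y /sS.
have code1 (k : 'I_l) : exists code : pt * set pt * pt -> (pt * bool) + pt,
    (forall u, curve_arc p beta k (found_S p beta J k) (found_T p J k) u ->
      code u \in [seq inl (s, b) | s <- ss k, b <- [:: true; false]] ++ [seq inr t | t <- ts k]) /\
    (forall u u', curve_arc p beta k (found_S p beta J k) (found_T p J k) u ->
      curve_arc p beta k (found_S p beta J k) (found_T p J k) u' -> code u = code u' -> u = u').
  have kl := ltnW (ltn_ord k); rewrite found_SE //.
  have [code [h1 h2]] := curve_code Jc Dbounded gen (finite_Sset kl) (finite_found_T k).
  exists code; split=> // u /h1[[s [b [sS ->]]]|[v [vT ->]]]; rewrite mem_cat; apply/orP; [left|right].
    have [_ /(_ s)[/(_ sS) ss1 _] _] := ssP k kl.
    by apply/allpairsP; exists (s, b); split=> //; case: b.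
  by apply: map_f; have [tT _] := tsP k; exact: tT.
have /choice[code codeP] := code1.
pose cod (k : 'I_l) := [seq inl (s, b) | s <- ss k, b <- [:: true; false]] ++ [seq inr t | t <- ts k].
pose all := flatten [seq [seq (k, c) | c <- cod k] | k <- enum 'I_l].
apply: (@card_le_trans _ _ _ `I_(size all)); last first.
  rewrite card_le_II size_flatten sumnE !big_map.
  rewrite -enumT big_enum /=.
  apply: (@leq_trans (\sum_(k < l) (2 * bezout_bound l 0 d + \sum_(i < k.+1) t i))).
    apply: leq_sum => k _; rewrite size_map size_cat size_allpairs size_map mulnC.
    rewrite big_ord_recr /= addnA; apply: leq_add; last by case: (tsP k).
    by case: (ssP k (ltnW (ltn_ord k))).
  rewrite big_split /= sum_nat_const card_ord sum_prefix_sums /curve_bound /bezout_bound subn0.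
  rewrite addn1 expnS big_add1 /= big_mkord; apply: eq_leq; congr (_ + _)%N; first by nia.
  apply: eq_bigr => i _; rewrite /t /bezout_bound (_ : l + 1 - i.+1 = l - i)%N; last by rewrite addn1 subSS.
  rewrite -!mulnA; congr (_ * _)%N.
  by rewrite mulnC -!mulnA.
apply: (@card_le_code _ _ _ (fun u => (u.1, code u.1 u.2))) => [[k u] /= uP|[k u] [k' u'] /= uP uP' [kk]].
  apply/flattenP; exists [seq (k, c) | c <- cod k]; apply: map_f; last by case: (codeP k) => /(_ _ uP).
  by rewrite mem_enum.
by subst k' => cc; congr (_, _); apply: (codeP k).2.
Qed.

End Assembly.

(** * Elimination of variables *)

Section Affine.
Context {R : realType} {m : nat}.

Lemma peval_affine (q : mpoly m R) (y : 'rV[R]_m) : deg_le q 1 ->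
  peval q y = mcoeff mnm0 q + \sum_b mcoeff (mnm1 b) q * y 0 b.
Proof.
move=> q1; rewrite {1}(_ : q = mpolyC m (mcoeff mnm0 q) + \sum_b mcoeff (mnm1 b) q *: mpolyX R (mnm1 b)).
  rewrite pevalD [X in X + _ = _]mevalC; congr (_ + _).
  by rewrite /peval raddf_sum; apply: eq_bigr => b _; rewrite /= mevalZ mevalXU.
apply/mpolyP => a; rewrite mcoeffD mcoeffC raddf_sum /=.
have [a2|a1] := ltnP 1 (mdeg a).
  rewrite (deg_le_coeff q1 a2) big1 ?addr0; last first.
    move=> b _; rewrite mcoeffZ mcoeffX; case: eqP => [ba|_]; last by rewrite mulr0.
    by rewrite -ba mdeg1 in a2.
  by case: eqP => [a0|_]; [rewrite a0 mdeg0 in a2|rewrite mulr0].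
have [|a0] := eqVneq (mdeg a) 1%N.
  move/eqP/mdeg1P => [b /eqP ->]; rewrite (bigD1 b) //= mcoeffZ mcoeffX eqxx mulr1.
  rewrite (_ : (mnm1 b == mnm0) = false) ?mulr0 ?add0r; last first.
    by apply/eqP => /(congr1 (@mdeg m)); rewrite mdeg1 mdeg0.
  rewrite big1 ?addr0 // => c cb; rewrite mcoeffZ mcoeffX eq_mnm1 (negPf cb) mulr0 //.
have /eqP -> : a == mnm0 by rewrite -mdeg_eq0; case: (mdeg a) a0 a1 => [|[]].
rewrite eqxx mulr1 big1 ?addr0 // => b _; rewrite mcoeffZ mcoeffX.
case: eqP => [/(congr1 (@mdeg m))|_]; last by rewrite mulr0.
by rewrite mdeg1 mdeg0.
Qed.

Lemma deg_le_comp (r k : nat) (th : r.-tuple (mpoly m R)) (q : mpoly r R) :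
  (forall i, deg_le (tnth th i) 1) -> deg_le q k -> deg_le (comp_mpoly th q) k.
Proof.
move=> th1 qk; rewrite comp_mpolyE big_seq; apply: deg_le_sum => a aq; apply: deg_leZ.
apply: (@deg_leW _ _ _ (\sum_i 1 * a i)).
  by apply: deg_le_prod => i _; exact: deg_leX.
under eq_bigr do rewrite mul1n.
by rewrite -mdegE -ltnS; apply: leq_trans (msize_mdeg_lt aq) qk.
Qed.

End Affine.

Lemma subset_of_card (T : finType) (A : {set T}) k : (k <= #|A|)%N ->
  exists B : {set T}, B \subset A /\ #|B| = k.
Proof.
move=> kA; exists (finset.finset (fun x => x \in take k (enum A))); split.
  by apply/fintype.subsetP => x; rewrite finset.inE => /mem_take; rewrite mem_enum.
rewrite cardsE (card_uniqP _) ?take_uniq ?enum_uniq // size_takel // -cardE //.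
Qed.

Section Elimination.
Context {R : realType} {l n : nat}.
Local Notation pt := 'rV[R]_l.
Variable p : 'I_(l + n).+1 -> mpoly l R.
Hypothesis p_deg1 : forall i, degree (p i) = 1%N.
Hypothesis Dbounded : bounded_set (Delta p).
Hypothesis p_general : general_position p.

Definition slope i : 'I_l -> R := fun b => mcoeff (mnm1 b) (p i).

Definition slopes (I : {set 'I_(l + n).+1}) : 'M[R]_(l, #|I|) :=
  \matrix_(b, a) slope (enum_val a) b.

Lemma peval_line i (y v : pt) (t : R) : peval (p i) (y + t *: v) = peval (p i) y + t * dot (slope i) v.
Proof.
have p1 : deg_le (p i) 1 by apply: degree_le; rewrite p_deg1.
rewrite !(peval_affine _ p1) -addrA; congr (_ + _); rewrite /dot big_distrr /= -big_split /=.
by apply: eq_bigr => b _; rewrite !mxE /slope; ring.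
Qed.

Lemma slopesP (I : {set 'I_(l + n).+1}) (v : pt) : v *m slopes I = 0 <-> forall i, i \in I -> dot (slope i) v = 0.
Proof.
have E a : (v *m slopes I) 0 a = dot (slope (enum_val a)) v.
  by rewrite mxE; apply: eq_bigr => b _; rewrite mxE mulrC.
split=> [vI i iI|H]; last by apply/rowP => a; rewrite E mxE H // enum_valP.
by have := E (enum_rank_in iI i); rewrite enum_rankK_in // vI mxE.
Qed.

(** A direction annihilated by all linear parts would put a whole line into the bounded set
    [Delta]. *)
Lemma slopes_inj (v : pt) : Delta p !=set0 -> (forall i, dot (slope i) v = 0) -> v = 0.
Proof.
move=> [y yD] vp; apply/eqP; rewrite -normr_eq0; apply/eqP.
have tD (t : R) : Delta p (y + t *: v) by move=> i; rewrite peval_line vp mulr0 addr0.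
case: Dbounded => M [_ MP]; apply/eqP; rewrite eq_le normr_ge0 andbT leNgt; apply/negP => v0.
pose K := `|M| + 1; have MK : M < K by rewrite /K; have := ler_norm M; lra.
have K0 : 0 <= K by rewrite /K addr_ge0.
pose t := (K + `|y| + 1) / `|v|.
have t0 : 0 <= t by rewrite divr_ge0 // !addr_ge0.
have := MP K MK _ (tD t); rewrite /= => yt.
have := ler_normB (y + t *: v) y; rewrite addrAC subrr add0r normrZ (ger0_norm t0) /t divfK ?gt_eqF //.
lra.
Qed.

(** Enlarge [I] to a maximal set [A] with a common zero. Maximality forces the linear parts of [A]
    to have rank [l], general position gives [#|A| <= l], and adding the elements of [A] outside [I]
    raises the rank by at most their number. *)
Lemma slopes_rank (I : {set 'I_(l + n).+1}) : Delta p !=set0 -> zero_flat p I !=set0 ->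
  \rank (slopes I) = #|I|.
Proof.
move=> D0 I0; pose P (A : {set 'I_(l + n).+1}) := `[< zero_flat p A !=set0 >].
have PI : P I by apply/asboolP.
have [A /maxsetP[/asboolP[y yA] Amax] IA] := maxset_exists PI.
have Al : (#|A| <= l)%N.
  rewrite leqNgt; apply/negP => /subset_of_card[B [/fintype.subsetP BA cB]].
  by apply: (p_general cB); exists y => i /BA; exact: yA.
have rA : \rank (slopes A) = l.
  apply/eqP; rewrite -[_ == _]/(row_free (slopes A)) -kermx_eq0; apply/eqP/row_matrixP => b.
  rewrite row0; set v := row b _.
  have /slopesP vA : v *m slopes A = 0 by rewrite -row_mul mulmx_ker row0.
  (* If [v] is annihilated by [A] but not by the slope of [k], moving along [v] reaches a zero of
     [p k] without leaving the flat of [A], so [A] was not maximal. *)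
  apply: slopes_inj => // k; apply: contrapT => /eqP vk.
  have kA : k \notin A by apply/negP => /vA/eqP; rewrite (negPf vk).
  have : finset.setU (finset.set1 k) A = A.
    apply: Amax; last exact: finset.subsetUr.
    apply/asboolP; exists (y + (- peval (p k) y / dot (slope k) v) *: v) => i.
    rewrite !finset.inE peval_line => /orP[/eqP->|iA]; first by rewrite divfK ?subrr.
    by rewrite (vA _ iA) mulr0 addr0 yA.
  by move/setP/(_ k); rewrite !finset.inE eqxx (negPf kA).
apply/eqP; rewrite eqn_leq rank_leq_col /=.
have : (\rank (slopes A)^T <= \rank (slopes I)^T + \rank (slopes (finset.setD A I))^T)%N.
  apply: leq_trans (mxrank_adds_leqif _ _); apply: mxrankS; apply/row_subP => a.
  have rowE (K : {set 'I_(l + n).+1}) i (iK : i \in K) : (\row_b slope i b <= (slopes K)^T)%MS.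
    rewrite (_ : \row_b _ = row (enum_rank_in iK i) (slopes K)^T) ?row_sub //.
    by apply/rowP => b; rewrite !mxE enum_rankK_in.
  rewrite (_ : row a _ = \row_b slope (enum_val a) b); last by apply/rowP => b; rewrite !mxE.
  have [aI|aI] := boolP (enum_val a \in I).
    by apply: submx_trans (addsmxSl _ _); exact: rowE.
  apply: submx_trans (addsmxSr _ _); apply: rowE.
  by rewrite finset.inE aI enum_valP.
rewrite !mxrank_tr rA => H.
have := cardsID I A; rewrite (finset.setIidPr IA) => cA.
rewrite -(leq_add2r #|finset.setD A I|) cA; apply: leq_trans Al (leq_trans H _).
by rewrite leq_add2l rank_leq_col.
Qed.

(** The flat is a point [y0] plus the kernel of the linear parts, of dimension [l - #|I|]; a basis
    of this kernel gives the parametrization. *)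
Lemma elimination_exists (I : {set 'I_(l + n).+1}) : Delta p !=set0 -> zero_flat p I !=set0 ->
  exists th : l.-tuple (mpoly (l - #|I|) R), elimination p I th.
Proof.
move=> D0 I0; have rI := slopes_rank D0 I0; case: I0 => y0 y0I.
have rK : \rank (kermx (slopes I)) = (l - #|I|)%N by rewrite mxrank_ker rI.
have [B [Bf BK]] : exists B : 'M[R]_(l - #|I|, l), row_free B /\ (B :=: kermx (slopes I))%MS.
  by rewrite -rK; exists (row_base (kermx (slopes I))); split; [exact: row_base_free|exact: eq_row_base].
pose th : l.-tuple (mpoly (l - #|I|) R) :=
  [tuple mpolyC _ (y0 0 i) + \sum_a B a i *: mpolyX R (mnm1 a) | i < l].
have thE z : (\row_i peval (tnth th i) z : pt) = y0 + z *m B.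
  apply/rowP => i; rewrite !mxE tnth_mktuple pevalD [X in X + _ = _]mevalC; congr (_ + _).
  by rewrite /peval raddf_sum; apply: eq_bigr => a _; rewrite /= mevalZ mevalXU mulrC.
have flatE (y : pt) : zero_flat p I y <-> (y - y0 <= B)%MS.
  rewrite BK; split=> [yI|/sub_kermxP/slopesP yI i iI].
    apply/sub_kermxP/slopesP => i iI; have := peval_line i y0 (y - y0) 1.
    by rewrite scale1r addrC subrK yI // y0I // add0r mul1r.
  by have := peval_line i y0 (y - y0) 1; rewrite scale1r addrC subrK y0I // yI // mulr0 addr0.
exists th; split.
- move=> i; apply: deg_le_degree; rewrite tnth_mktuple; apply: deg_leD; first exact: deg_leC.
  by apply: deg_le_sum => a _; apply: deg_leZ; exact: deg_le_var.
- move=> z z'; rewrite !thE => /addrI; exact: (row_free_injr Bf).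
- apply/seteqP; split=> [_ [z _ <-]|y /flatE/submxP[z yz]].
    by rewrite thE; apply/flatE; rewrite addrC addKr submxMl.
  by exists z => //; rewrite thE -yz addrC subrK.
Qed.

Lemma bezout_le (J : 'I_l -> mpoly l R) (d j m : nat) (th : l.-tuple (mpoly m R)) :
  (forall k : 'I_l, (degree (J k) <= 2 ^ (l - k.+1) * d)%N) -> (j <= l)%N ->
  (forall i, (degree (tnth th i) <= 1)%N) -> (bezout J j th <= bezout_bound l j d)%N.
Proof.
move=> Jd jl th1; rewrite -prod_degrees //; apply: leq_prod => k _.
apply: deg_le_degree; apply: deg_le_comp => [i|]; exact: degree_le.
Qed.

Lemma card_index_sets j :
  [set I : {set 'I_(l + n).+1} | #|I| = j] #<= `I_('C(l + n + 1, j)).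
Proof.
rewrite addn1 -[in X in _ #<= X](card_ord (l + n).+1) -card_draws cardE.
apply: (@card_le_code _ _ _ id) => // I cI.
by rewrite mem_enum finset.inE cI.
Qed.

End Elimination.

(** * Clearing the denominators of the Jacobian determinants *)

Lemma deg_le_mderiv (R : realType) (m : nat) (q : mpoly m R) k b :
  deg_le q k -> deg_le (mderiv b q) k.-1.
Proof.
move=> qk; apply: deg_leP => a ka; rewrite mcoeff_deriv (deg_le_coeff qk) ?mul0rn //.
by rewrite mdegD mdeg1 addn1; lia.
Qed.

(** A degree bound by potentials: when entry [(a, b)] has degree at most [w a + w' b - 1], every
    term of the expansion has degree at most the total weight minus [r]. *)
Lemma deg_le_det (R : realType) (m r : nat) (M : 'M[mpoly m R]_r) (w w' : 'I_r -> nat) K :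
  (forall a b, M a b = 0 \/ (0 < w a + w' b)%N /\ deg_le (M a b) (w a + w' b).-1) ->
  (\sum_a w a + \sum_b w' b <= K + r)%N -> deg_le (\det M) K.
Proof.
move=> MP wK; apply: deg_le_sum => s _.
have [/existsP[a /eqP Ma]|nz] := boolP [exists a, M a (s a) == 0].
  by rewrite (bigD1 a) //= Ma mul0r mulr0 deg_le0.
have {}MP a : (0 < w a + w' (s a))%N /\ deg_le (M a (s a)) (w a + w' (s a)).-1.
  have [Ma|//] := MP a (s a).
  by move: nz; rewrite negb_exists => /forallP/(_ a); rewrite Ma eqxx.
have prodK : deg_le (\prod_a M a (s a)) K.
  apply: (@deg_leW _ _ _ (\sum_a (w a + w' (s a)).-1)); first by apply: deg_le_prod => a _; case: (MP a).
  rewrite -(leq_add2r r); apply: leq_trans wK.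
  rewrite [X in (X <= _)%N](_ : _ = \sum_a ((w a + w' (s a)).-1 + 1))%N; last first.
    by rewrite big_split /= sum1_card card_ord.
  rewrite [X in (_ <= _ + X)%N](reindex_inj (@perm_inj _ s)) -big_split /=.
  by apply: leq_sum => a _; rewrite addn1 prednK //; case: (MP a).
by rewrite mulr_sign; case: odd_perm => //; rewrite -scaleN1r; exact: deg_leZ.
Qed.

Lemma det_schur (R : fieldType) (r s : nat) (D : 'rV[R]_r) (L : 'M[R]_(r, s))
    (B : 'M[R]_(s, r)) (C : 'M[R]_s) : (forall i, D 0 i != 0) ->
  \det (block_mx (diag_mx D) L B C) =
  (\prod_i D 0 i) * \det (\matrix_(a, b) (C a b - \sum_i B a i * ((D 0 i)^-1 * L i b))).
Proof.
move=> D0; pose K := \matrix_(i, b) ((D 0 i)^-1 * L i b).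
have -> : block_mx (diag_mx D) L B C = block_mx (diag_mx D) 0 B 1%:M *m block_mx 1%:M K 0 (C - B *m K).
  rewrite mulmx_block !mulmx1 !mul0mx !mulmx0 !addr0 mul1mx; congr (block_mx _ _ _ _).
    by apply/matrixP => i b; rewrite mul_diag_mx !mxE mulrA mulfV ?mul1r.
  by rewrite addrC subrK.
rewrite det_mulmx det_lblock det_ublock !det1 mulr1 mul1r det_diag; congr (_ * \det _).
by apply/matrixP => a b; rewrite !mxE; congr (_ - _); apply: eq_bigr => i _; rewrite !mxE.
Qed.

Section Clearing.
Context {R : realType} {l n : nat}.
Local Notation pt := 'rV[R]_l.
Variables (p : 'I_(l + n).+1 -> mpoly l R) (beta : 'I_(l + n).+1 -> 'I_l -> R).
Hypothesis p_deg1 : forall i, degree (p i) = 1%N.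

(* Eliminating the diagonal block leaves the rows [d phi_a] for [a <= k] and
   the multiples [P^e dtildeJ_a], [e = 2^(l - a - 1)], for [a > k]; unlike the
   cleared Jacobian this form has entries of small degree. *)
Definition clearing_mx (J : 'I_l -> mpoly l R) (k : 'I_l) : 'M[mpoly l R]_((l + n).+1 + l) :=
  block_mx (diag_mx (\row_i p i)) (\matrix_(i, b) mderiv b (p i))
    (\matrix_(a, i) if (a <= k)%N then mpolyC l (- beta i a) else (2 ^ (l - a.+1))%:R *: J a)
    (\matrix_(a, b) if (a <= k)%N then 0 else mderiv b (J a)).

(** Each row above [k] contributes its power of [pprod] and the diagonal block contributes one more
    factor; together they make up the exponent for [J k]. *)
Lemma sum_powers_above (k : 'I_l) :
  (\sum_(a < l) (if a <= k then 0 else 2 ^ (l - a.+1)) + 1 = 2 ^ (l - k.+1))%N.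
Proof.
have H m : (\sum_(i < m) 2 ^ i + 1 = 2 ^ m)%N.
  by elim: m => [|m IH]; [rewrite big_ord0|rewrite big_ord_recr /= addnAC IH expnS mul2n addnn].
rewrite (reindex_inj rev_ord_inj) /= -H; congr (_ + 1)%N.
rewrite (big_ord_widen_cond l predT (fun i => 2 ^ i)%N) ?leq_subr // [in RHS]big_mkcond /=.
apply: eq_bigr => i _; have il := ltn_ord i; have kl := ltn_ord k.
rewrite subnSK // subKn ?(ltnW il) //.
by rewrite (_ : (l - i.+1 <= k)%N = ~~ (i < l - k.+1)%N) ?if_neg //; apply/idP/idP; lia.
Qed.

(** Rows and columns of the diagonal block have weight 1, the row of [J a] its degree bound. The
    former contribute [2 (l + n + 1)], and subtracting the size [2 l + n + 1] of the matrix leaves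
    the [n + 1] of the bound. *)
Lemma clearing_mx_degree J (k : 'I_l) :
  (forall a : 'I_l, (k < a)%N -> (degree (J a) <= 2 ^ (l - a.+1) * n.+1)%N) ->
  deg_le (\det (clearing_mx J k)) (2 ^ (l - k.+1) * n.+1).
Proof.
move=> Jd.
pose E (a : 'I_l) := if (a <= k)%N then 0%N else (2 ^ (l - a.+1) * n.+1)%N.
pose w (x : 'I_((l + n).+1 + l)) := match fintype.split x with inl _ => 1%N | inr a => E a end.
pose w' (x : 'I_((l + n).+1 + l)) := match fintype.split x with inl _ => 1%N | inr _ => 0%N end.
have p1 i : deg_le (p i) 1 by apply: degree_le; rewrite p_deg1.
have J1 (a : 'I_l) : (a <= k)%N = false -> deg_le (J a) (2 ^ (l - a.+1) * n.+1).
  by move=> ak; apply: degree_le; apply: Jd; rewrite ltnNge ak.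
have E0 (a : 'I_l) : (a <= k)%N = false -> (0 < 2 ^ (l - a.+1) * n.+1)%N.
  by move=> _; rewrite muln_gt0 expn_gt0.
apply: (@deg_le_det _ _ _ _ w w').
  move=> x y; rewrite /clearing_mx /w /w' !mxE.
  case: (fintype.split x) => [i|a]; rewrite !mxE; case: (fintype.split y) => [j|b]; rewrite !mxE.
  - by case: eqP => _; [right; split=> //; exact: p1|left; rewrite mulr0n].
  - by right; split=> //; rewrite addn0 /=; exact: (deg_le_mderiv b (p1 i)).
  - right; rewrite addn1; split=> //=; rewrite /E; case: ifP => ak; first exact: deg_leC.
    exact/deg_leZ/J1.
  - rewrite /E; case: ifP => ak; first by left.
    by right; rewrite addn0; split; [exact: E0|exact/deg_le_mderiv/J1].
rewrite !big_split_ord /= /w /w'.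
under eq_bigr => i _ do rewrite (unsplitK (inl i)).
under [X in (_ + X + _ <= _)%N]eq_bigr => i _ do rewrite (unsplitK (inr i)).
under [X in (_ + (X + _) <= _)%N]eq_bigr => i _ do rewrite (unsplitK (inl i)).
under [X in (_ + (_ + X) <= _)%N]eq_bigr => i _ do rewrite (unsplitK (inr i)).
rewrite !sum_nat_const !card_ord muln0 addn0 muln1 -sum_powers_above.
rewrite mulnDl mul1n big_distrl /= [X in (_ <= X + _ + _)%N](eq_bigr E); last first.
  by move=> a _; rewrite /E; case: ifP.
lia.
Qed.

Lemma clearing_step J (k : 'I_l) :
  (forall a : 'I_l, (k < a)%N -> forall y, Delta p y ->
     peval (J a) y = tildeJ p beta a y * pprod p y ^+ (2 ^ (l - a.+1))) ->
  forall y, Delta p y ->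
  peval (\det (clearing_mx J k)) y = tildeJ p beta k y * pprod p y ^+ (2 ^ (l - k.+1)).
Proof.
move=> Jc y yD; have P0 := pprod_gt0 yD.
rewrite /peval -det_map_mx map_block_mx map_diag_mx det_schur; last first.
  by move=> i; rewrite !mxE gt_eqF //; exact: yD.
pose c (a : 'I_l) := pprod p y ^+ (if (a <= k)%N then 0%N else 2 ^ (l - a.+1))%N.
have row (a b : 'I_l) : (if (a <= k)%N then 0 else peval (mderiv b (J a)) y) -
    \sum_i (if (a <= k)%N then - beta i a else (2 ^ (l - a.+1))%:R * peval (J a) y) *
      ((peval (p i) y)^-1 * peval (mderiv b (p i)) y) =
    c a * Defs.jacobian (mixed p beta k.+1) y a b.
  rewrite mxE mixedE // ltnS /c; case: leqP => ak.
    rewrite expr0 mul1r (sdiff_derive b (phi_sdiff beta a yD)) sub0r -sumrN.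
    by apply: eq_bigr => i _; rewrite mulNr opprK.
  set e := (2 ^ (l - a.+1))%N.
  (* Writing the inverse power of [pprod] as an exponential makes its logarithmic derivative appear,
     as in the Schur complement. *)
  pose u z := - e%:R * \sum_i ln (peval (p i) z).
  have Eu z : Delta p z -> expR (u z) = (pprod p z ^+ e)^-1.
    move=> zD; rewrite /u mulNr expRN expRM_natl expR_sum; congr (_ ^+ _)^-1.
    by apply: eq_bigr => i _; rewrite lnK // posrE; exact: zD.
  have ud : sdiff u (fun b => - e%:R * \sum_i ((peval (p i) y)^-1 * peval (mderiv b (p i)) y)) y.
    apply: sdiffZ; apply: sdiff_sum => i _.
    by apply: sdiff_comp (sdiff_peval _ _) (sdiff1_ln (yD i)).
  have td : sdiff (tildeJ p beta a) (fun b => peval (mderiv b (J a)) y * expR (u y) + peval (J a) y *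
      (expR (u y) * (- e%:R * \sum_i ((peval (p i) y)^-1 * peval (mderiv b (p i)) y)))) y.
    apply: (near_sdiff _ (sdiffM (sdiff_peval _ _) (sdiff_comp ud (sdiff1_expR _)))).
    have [r r0 rP] := Delta_open yD.
    apply/(@near_normP R _ y (fun z => peval (J a) z * expR (u z) = tildeJ p beta a z)).
    exists r => // z /rP zD; rewrite Eu // Jc // mulfK // expf_neq0 // gt_eqF //.
    exact: pprod_gt0.
  rewrite (sdiff_derive b td) Eu // -big_distrr /=.
  by field; rewrite expf_neq0 // gt_eqF.
rewrite [X in _ * \det X](_ : _ = diag_mx (\row_a c a) *m Defs.jacobian (mixed p beta k.+1) y); last first.
  apply/matrixP => a b; rewrite mul_diag_mx !mxE [RHS](_ : _ = c a * Defs.jacobian (mixed p beta k.+1) y a b); last first.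
    by rewrite !mxE.
  rewrite -row; congr (_ - _); first by case: ifP; rewrite ?raddf0.
  apply: eq_bigr => i _; rewrite !mxE; congr (_ * _).
  by case: ifP => _; [exact: mevalC|exact: mevalZ].
rewrite det_mulmx det_diag mulrCA mulrA [RHS]mulrC /tildeJ /Jdet; congr (_ * _).
rewrite -sum_powers_above exprD expr1 mulrC [RHS]mulrC; congr (_ * _).
  by apply: eq_bigr => i _; rewrite !mxE.
by rewrite -prodrXr; apply: eq_bigr => a _; rewrite mxE.
Qed.

(** Downward recursion on the index: the matrix for [J k] involves only the polynomials [J a] with
    [a > k]. *)
Lemma cleared_exists : exists J : 'I_l -> mpoly l R, cleared p beta J /\
  forall k : 'I_l, (degree (J k) <= 2 ^ (l - k.+1) * n.+1)%N.
Proof.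
suff H m : (m <= l)%N -> exists J : 'I_l -> mpoly l R, forall k : 'I_l, (l - m <= k)%N ->
    (forall y, Delta p y -> peval (J k) y = tildeJ p beta k y * pprod p y ^+ (2 ^ (l - k.+1))) /\
    (degree (J k) <= 2 ^ (l - k.+1) * n.+1)%N.
  have [J JP] := H l (leqnn l); rewrite subnn in JP; exists J; split=> [k|k]; by case: (JP k).
elim: m => [_|m IH ml]; first by exists (fun=> 0) => k; rewrite subn0 leqNgt ltn_ord.
have [J JP] := IH (ltnW ml).
have kl : (l - m.+1 < l)%N by lia.
pose k0 := Ordinal kl.
have above (a : 'I_l) : (k0 < a)%N -> (l - m <= a)%N by rewrite /=; lia.
exists (fun k => if k == k0 then \det (clearing_mx J k0) else J k) => k mk.
case: eqVneq => [->|kk0].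
  split; first by apply: clearing_step => a /above/JP[].
  by apply: deg_le_degree; apply: clearing_mx_degree => a /above/JP[].
by apply: JP; move: kk0 mk; rewrite -val_eqE /=; lia.
Qed.

End Clearing.

(** * Numerical bounds *)

(** After replacing [n] by [d], falling factorials are compared factor by factor, by
    [d + x <= d * x.+1]. *)
Lemma bin_dilation (l n d j : nat) : (0 < d)%N -> (n <= d)%N -> (j <= l)%N ->
  ('C(l + n + 1, j) <= d ^ j * 'C(l + 2, j))%N.
Proof.
move=> d0 nd jl; apply: (@leq_trans 'C(l + d + 1, j)); first by rewrite leq_bin2l // leq_add2r leq_add2l.
rewrite -(leq_pmul2r (fact_gt0 j)) -mulnA !bin_ffact.
elim: j jl => [|j IH] jl; first by rewrite !ffactn0.
rewrite !ffactnSr expnSr -!mulnA [(d * _)%N]mulnCA mulnA; apply: leq_mul; first exact: IH (ltnW jl).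
have -> : (l + d + 1 - j = d + (l - j).+1)%N by lia.
have -> : (l + 2 - j = (l - j).+2)%N by lia.
nia.
Qed.

Lemma weighted_bin_sum l : (4 <= l)%N ->
  (\sum_(k < l) 2 ^ 'C(k, 2) * 'C(l + 2, k.+2) <= 3 * 2 ^ 'C(l, 2))%N.
Proof.
move=> l4; suff : (l <= 'C(l, 2))%N /\
  (\sum_(k < l) 2 ^ 'C(k, 2) * 'C(l + 2, k.+2) <= 3 * 2 ^ 'C(l, 2))%N by case.
elim: l l4 => // l IHl; rewrite ltnS leq_eqVlt => /orP[/eqP<-|l4].
  by rewrite !big_ord_recr big_ord0.
have [lC IH] := IHl l4; split.
  by rewrite binS bin1; lia.
set V := (\sum_(k < l) _)%N in IH.
have -> : (\sum_(k < l.+1) 2 ^ 'C(k, 2) * 'C(l.+1 + 2, k.+2) =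
  (V + 2 ^ 'C(l, 2)) + (l.+2 + \sum_(k < l) 2 ^ 'C(k.+1, 2) * 'C(l + 2, k.+2)))%N.
  under eq_bigr => k _ do rewrite addSn binS mulnDr.
  rewrite big_split /= big_ord_recr /= addn2 binn muln1 [in X in (_ + X)%N]big_ord_recl /= bin1 mul1n.
  by rewrite /V addn2.
have tail : (\sum_(k < l) 2 ^ 'C(k.+1, 2) * 'C(l + 2, k.+2) <= 2 ^ l.-1 * V)%N.
  rewrite /V big_distrr /=; apply: leq_sum => k _.
  rewrite binS bin1 expnD -!mulnA [X in (_ <= X)%N]mulnCA leq_mul2l; apply/orP; right.
  rewrite leq_mul2r leq_exp2l //; apply/orP; right; have := ltn_ord k; lia.
have pow : (8 <= 2 ^ l.-1)%N by rewrite -[8%N]/(2 ^ 3)%N leq_exp2l //; lia.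
have C2 : (2 ^ 'C(l.+1, 2) = 2 ^ l.-1 * 2 * 2 ^ 'C(l, 2))%N.
  by rewrite binS bin1 expnD mulnC -expnSr prednK //; lia.
have lP : (l < 2 ^ 'C(l, 2))%N by exact: leq_ltn_trans lC (ltn_expl _ _).
rewrite C2; nia.
Qed.

(** At [l = 2], [d = 1] the left side is 14 and the right side 12; for [l = 2] the inequality starts
    at [d = 2] and is checked separately. *)
Lemma corner_sum_bound (l n d : nat) : (0 < l)%N -> (0 < n)%N -> (n <= d)%N -> (l, d) <> (2, 1)%N ->
  (\sum_(1 <= j < l.+1) (l + 1 - j) * 2 ^ 'C(l - j, 2) * d ^ (l - j) * 'C(l + n + 1, j) <=
   3 * (l * 2 ^ 'C(l, 2) * d ^ l))%N.
Proof.
move=> l0 n0 nd ld; have d0 := leq_trans n0 nd.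
have [l2|l2] := eqVneq l 2%N.
  have d2 : (1 < d)%N by rewrite ltn_neqAle d0 andbT; apply/eqP => d1; apply: ld; rewrite l2 -d1.
  subst l; rewrite big_add1 /= big_mkord !big_ord_recr big_ord0 /=.
  rewrite (_ : 2 + n + 1 = n.+3)%N; last by lia.
  rewrite -[(2 + 1 - 1)%N]/2%N -[(2 - 1)%N]/1%N -[(2 + 1 - 2)%N]/1%N -[(2 - 2)%N]/0%N.
  rewrite -['C(1, 2)]/0%N -['C(0, 2)]/0%N -['C(2, 2)]/1%N bin1 !expn0 !expn1 !muln1 !mul1n.
  have C2 : ('C(n.+3, 2) * 2 = n.+3 * n.+2)%N by rewrite -[X in (_ * X)%N]/(2`!) bin_ffact !ffactnS ffactn0 muln1.
  have c1 : (n.+3 * n.+2 <= (d + 3) * (d + 2))%N by apply: leq_mul; lia.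
  have c2 : (d * n.+3 <= d * (d + 3))%N by rewrite leq_mul2l; lia.
  have c3 : (2 * d <= d ^ 2)%N by rewrite expnS expn1 leq_mul2r d2 orbT.
  have c4 : (d * (d + 3) = d ^ 2 + 3 * d)%N by ring.
  have c5 : ((d + 3) * (d + 2) = d ^ 2 + 5 * d + 6)%N by ring.
  rewrite add0n -[(2 * d * _)%N]mulnA; lia.
(* With [k = l - j], [bin_dilation] factors out [d ^ l] and leaves an inequality in [l] alone,
   checked by computation for [l = 1] and [l = 3]. *)
apply: (@leq_trans (d ^ l * \sum_(k < l) k.+1 * 2 ^ 'C(k, 2) * 'C(l + 2, k.+2))).
  rewrite big_add1 /= big_mkord (reindex_inj rev_ord_inj) /= big_distrr /=; apply: leq_sum => k _.
  have kl := ltn_ord k; rewrite subnSK // subKn ?(ltnW kl) //.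
  have -> : (l + 1 - (l - k) = k.+1)%N by lia.
  have -> : (d ^ l = d ^ k * d ^ (l - k))%N by rewrite -expnD subnKC // ltnW.
  have -> : ('C(l + 2, k.+2) = 'C(l + 2, l - k))%N.
    by rewrite -bin_sub; [congr 'C(_, _); lia|lia].
  have H := bin_dilation d0 nd (leq_subr k l).
  rewrite [X in (_ <= X)%N](_ : _ = k.+1 * 2 ^ 'C(k, 2) * d ^ k * (d ^ (l - k) * 'C(l + 2, l - k)))%N; last by ring.
  by rewrite leq_mul2l H orbT.
rewrite [X in (_ <= X)%N](_ : _ = d ^ l * (3 * l * 2 ^ 'C(l, 2)))%N; last by ring.
rewrite leq_mul2l; apply/orP; right.
case: (leqP 4 l) => l4.
  apply: (@leq_trans (l * \sum_(k < l) 2 ^ 'C(k, 2) * 'C(l + 2, k.+2))).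
    by rewrite big_distrr /=; apply: leq_sum => k _; rewrite mulnA !leq_mul2r ltn_ord !orbT.
  by rewrite mulnAC mulnC leq_mul2r weighted_bin_sum // orbT.
by case: l l0 l2 l4 {ld} => [|[|[|[|]]]] // _ _ _; rewrite !big_ord_recr big_ord0.
Qed.

(** Starts from [expR (1 / 32) >= 33 / 32] and squares six times, rounding down to a small fraction
    each time; the last one, [2025 / 289], is just above 7. *)
Lemma expR1_sqr (R : realType) : 7 < expR (1 : R) ^+ 2.
Proof.
pose x : R := expR 32^-1.
have x0 : 33 / 32 <= x by have := expR_ge1Dx (32^-1 : R); rewrite /x; lra.
have sq (a b y : R) : 0 <= a -> b <= a * a -> a <= y -> b <= y ^+ 2.
  by move=> a0 ba ay; apply: le_trans ba _; rewrite expr2 ler_pM.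
have {}x0 : 84 / 79 <= x ^+ 2 by apply: sq x0; lra.
have {}x0 : 26 / 23 <= (x ^+ 2) ^+ 2 by apply: sq x0; lra.
have {}x0 : 23 / 18 <= ((x ^+ 2) ^+ 2) ^+ 2 by apply: sq x0; lra.
have {}x0 : 31 / 19 <= (((x ^+ 2) ^+ 2) ^+ 2) ^+ 2 by apply: sq x0; lra.
have {}x0 : 45 / 17 <= ((((x ^+ 2) ^+ 2) ^+ 2) ^+ 2) ^+ 2 by apply: sq x0; lra.
have {}x0 : 2025 / 289 <= (((((x ^+ 2) ^+ 2) ^+ 2) ^+ 2) ^+ 2) ^+ 2 by apply: sq x0; lra.
have -> : expR (1 : R) ^+ 2 = (((((x ^+ 2) ^+ 2) ^+ 2) ^+ 2) ^+ 2) ^+ 2.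
  by rewrite -!exprM -[1 : R](@divff _ 32) // expRM_natl -exprM.
by apply: lt_le_trans x0; rewrite ltr_pdivlMr // -natrM ltr_nat.
Qed.

Lemma curve_bound_lt (R : realType) (l n d : nat) :
  (0 < l)%N -> (0 < n)%N -> (n <= d)%N -> (l, d) <> (2, 1)%N ->
  (curve_bound l n d)%:R < l%:R * ((expR 1 ^+ 2 + 3) / 2) * 2 ^+ 'C(l, 2) * d%:R ^+ l :> R.
Proof.
move=> l0 n0 nd ld; have d0 := leq_trans n0 nd.
pose P := (l * 2 ^ 'C(l, 2) * d ^ l)%N.
have P0 : (0 : R) < P%:R by rewrite ltr0n !muln_gt0 l0 !expn_gt0 d0.
have : (curve_bound l n d <= 5 * P)%N.
  have := corner_sum_bound l0 n0 nd ld; rewrite /curve_bound -/P [('C(l, 2) + 1)%N]addn1 expnS.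
  rewrite (_ : l * (2 * 2 ^ 'C(l, 2)) * d ^ l = 2 * P)%N; last by rewrite /P; ring.
  by rewrite (_ : 5 * P = 2 * P + 3 * P)%N ?leq_add2l // -mulnDl.
rewrite -(ler_nat R) natrM => /le_lt_trans; apply.
rewrite [ltRHS](_ : _ = (expR 1 ^+ 2 + 3) / 2 * P%:R); last by rewrite /P !natrM !natrX; ring.
by rewrite ltr_pM2r //; have := expR1_sqr R; lra.
Qed.

(** Separating [J] and [d] gives the bounds at [d = n.+1] from the degrees of the first part, and at
    [d = n] whenever the degrees of [J] are small enough. *)
Theorem theorem2p5 (R : realType) (l n : nat)
    (p : 'I_(l + n).+1 -> mpoly l R)
    (beta : 'I_(l + n).+1 -> 'I_l -> R)
    (l_gt0 : (0 < l)%N) (n_gt0 : (0 < n)%N)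
    (p_deg1 : forall i, degree (p i) = 1%N)
    (Delta_bounded : bounded_set (Delta p))
    (p_general : general_position p) :
  (exists J : 'I_l -> mpoly l R, cleared p beta J /\
     forall k : 'I_l, (degree (J k) <= 2 ^ (l - k.+1) * n.+1)%N) /\
  forall (J : 'I_l -> mpoly l R) (d : nat),
    cleared p beta J ->
    (n <= d)%N -> (forall k : 'I_l, (degree (J k) <= 2 ^ (l - k.+1) * d)%N) ->
    sufficiently_general p beta J ->
    [/\ found_S p beta J l =
          [set y | Delta p y /\
                   forall k : 'I_l, \prod_i (peval (p i) y `^ beta i k) = 1],
        (forall j, (j <= l)%N -> found_S p beta J j = Sset p beta j) /\
        (forall k : 'I_l, closure (Cset p beta k) `&` boundary_Delta p `<=`
           Tset p beta J k `&` found_T p J k),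
        forall k : 'I_l,
          (forall s, found_S p beta J k s -> arcs_from p beta J k s #= `I_2) /\
          (forall t, found_T p J k t ->
             (closure (Cset p beta k) t -> arcs_from p beta J k t #= `I_1) /\
             (~ closure (Cset p beta k) t -> arcs_from p beta J k t = set0)),
        forall j : nat, (j < l)%N ->
          [set I : {set 'I_(l + n).+1} | #|I| = j] #<= `I_('C(l + n + 1, j)) /\
          forall I : {set 'I_(l + n).+1}, #|I| = j ->
            (Delta p !=set0 -> zero_flat p I !=set0 ->
               exists th : l.-tuple (mpoly (l - j) R),
                 elimination p I th) /\
            (forall th : l.-tuple (mpoly (l - j) R), elimination p I th ->
               (bezout J j th <= bezout_bound l j d)%N /\
               ((forall k : 'I_l, (j <= k)%N ->
                   degree (reduced J th k) = (2 ^ (l - k.+1) * d)%N) ->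
                bezout J j th = bezout_bound l j d)) &
        traced p beta J #<= `I_(curve_bound l n d) /\
        ((l, d) <> (2, 1)%N ->
           (curve_bound l n d)%:R <
           l%:R * ((expR 1 ^+ 2 + 3) / 2) * 2 ^+ 'C(l, 2) * d%:R ^+ l :> R)].
Proof.
split; first exact: (cleared_exists beta p_deg1).
move=> J d Jc nd Jd gen; have d0 := leq_trans n_gt0 nd.
split.
- by rewrite (found_SE p_deg1 Jc Delta_bounded gen d0 Jd) // Sset_solutions.
- split=> [j jl|k]; first exact: (found_SE p_deg1 Jc Delta_bounded gen d0 Jd).
  exact: (boundary_tracked Jc gen).
- move=> k; split=> [s|t]; first exact: (arcs_from_S p_deg1 Jc Delta_bounded gen d0 Jd).
  exact: (arcs_from_T p_deg1 Jc Delta_bounded gen d0 Jd).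
- move=> j jl; split=> [|I cI]; first exact: card_index_sets.
  subst j; split=> [D0 I0|th [th1 _ _]]; first exact: (elimination_exists p_deg1 Delta_bounded p_general D0 I0).
  split=> [|dE]; first exact: (bezout_le Jd (ltnW jl) th1).
  by rewrite /bezout (eq_bigr _ dE) prod_degrees // ltnW.
- split; first exact: (traced_bound p_deg1 Jc Delta_bounded gen d0 Jd).
  exact: curve_bound_lt.
Qed.
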